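(* For every class of pseudomanifold singularities $\mathcal{G}$, $\mathcal{G}_{\mathcal{E}_{\mathcal{G}}}=\mathcal{G}$. For every class of stratified pseudomanifold singularities $\mathcal{E}$, $\mathcal{E}_{\mathcal{G}_{\mathcal{E}}}\subset\mathcal{E}$. However, it is not necessarily true that $\mathcal{E}\subset\mathcal{E}_{\mathcal{G}_{\mathcal{E}}}$, i.e. there exists a class of stratified pseudomanifold singularities $\mathcal{E}$ with $\mathcal{E}\not\subset\mathcal{E}_{\mathcal{G}_{\mathcal{E}}}$. In particular, it is possible to have $\mathcal{G}_{\mathcal{E}}=\mathcal{G}_{\mathcal{E}'}$ for classes of stratified pseudomanifold singularities $\mathcal{E}\neq\mathcal{E}'$.
   Context: All spaces are piecewise linear (PL); $\cong$ denotes PL homeomorphism. A PL filtered space is a PL space $Y$ with closed PL subspaces $Y=Y^n\supseteq\cdots\supseteq Y^0\supseteq Y^{-1}=\emptyset$; the open cone is filtered by $(cY)^i=c(Y^{i-1})$ for $i\ge0$, with $c\emptyset$ a point. A $0$-dimensional PL stratified pseudomanifold is a discrete set of points. Inductively, an $n$-dimensional PL stratified pseudomanifold is an $n$-dimensional PL filtered space $X$ such that $X-X^{n-1}$ is dense and each $x\in X^i-X^{i-1}$ has a neighborhood $U$ for which there are a compact $(n-i-1)$-dimensional PL stratified pseudomanifold $L$ and a PL homeomorphism $\mathbb{R}^i\times cL\to U$ taking $\mathbb{R}^i\times c(L^{j-1})$ onto $X^{i+j}\cap U$. A $\partial$-stratified pseudomanifold $X$ is a filtered PL space with a subspace $\partial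 X$ such that $X-\partial X$ is an $n$-dimensional stratified pseudomanifold, $\partial X$ with $(\partial X)^i=X^{i+1}\cap\partial X$ is an $(n-1)$-dimensional stratified pseudomanifold, and $\partial X$ has a filtered collar $[0,1)\times\partial X$ in $X$. Classical means $X^{n-1}=X^{n-2}$ (no codimension one strata). $|X|$ denotes an underlying unstratified space; a classical PL ($\partial$-)pseudomanifold is a PL space admitting a classical stratification (its boundary is determined by the space). $|\Psi|$ is the class of compact classical PL $\partial$-pseudomanifolds. $|SX|$ is the suspension, with $S\emptyset=S^0$. A class of stratified pseudomanifold singularities is a subclass $\mathcal{E}\subset|\Psi|$ such that: every nonempty $|X|\in\mathcal{E}$ has dimension $>0$; $\emptyset,S^1\in\mathcal{E}$; $\mathcal{E}$ is closed under PL homeomorphism; $|X|\in\mathcal{E}$ implies $|\partial X|=\emptyset$; if $\emptyset\ne|X|\in\mathcal{E}$ then $|SX|\in\mathcal{E}$. A class of pseudomanifold singularities is a subclass $\mathcal{G}\subset|\Psi|$ such that: $|X|\in\mathcal{G}$ implies $|\partial X|=\emptyset$; $\emptyset\in\mathcal{G}$; $\mathcal{G}$ is closed under PL homeomorphism; $|X|\in\mathcal{G}$ if and only if $|SX|\in\mathcal{G}$. Given $\mathcal{E}$, the class $\mathcal{G}_{\mathcal{E}}$ is defined as follows: each compact classical pseudomanifold $|Y|$ is $\cong|S^iZ|$ for unique $i\ge0$ and $|Z|$ (up to homeomorphism) not a suspension of a pseudomanifold; $|Y|\in\mathcal{G}_{\mathcal{E}}$ iff $|Z|\in\mathcal{E}$.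 Given $\mathcal{G}$, $\mathcal{E}_{\mathcal{G}}$ is the class of stratified pseudomanifold singularities obtained by discarding all $0$-dimensional spaces from $\mathcal{G}$. *)

(* Defs.v *)
From HB Require Import structures.
From mathcomp Require Import all_boot all_order all_algebra.
From mathcomp Require Import all_classical all_reals all_analysis.

Set Implicit Arguments.
Unset Strict Implicit.
Unset Printing Implicit Defensive.

Import Order.TTheory GRing.Theory Num.Theory.
Import numFieldNormedType.Exports.

Local Open Scope classical_set_scope.
Local Open Scope ring_scope.

(* PL spaces are represented by Euclidean polyhedra, i.e. subsets of some R^N
   (row vectors) that are locally finite unions of convex polyhedra.  They need
   not be closed in R^N, so relatively open subsets of polyhedra are
   polyhedra. *)

Definition convex_polyhedron (R : realType) (N : nat) (C : set 'rV[R]_N) : Prop :=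
  exists (k : nat) (A : 'M[R]_(N, k)) (b : 'rV[R]_k),
    C = [set x | forall j, (x *m A) 0 j <= b 0 j].

Definition polyhedron (R : realType) (N : nat) (X : set 'rV[R]_N) : Prop :=
  forall a, X a -> exists (k : nat) (C : 'I_k -> set 'rV[R]_N),
    (forall l, convex_polyhedron (C l)) /\
    (\forall x \near a, X x <-> exists l, C l x).

(* PL maps on the polyhedron X; values of f outside X are irrelevant.
   Continuity on X is automatic, the finitely many pieces being closed. *)
Definition pl_map (R : realType) (N M : nat) (X : set 'rV[R]_N)
    (f : 'rV[R]_N -> 'rV[R]_M) : Prop :=
  forall a, X a -> exists (k : nat) (C : 'I_k -> set 'rV[R]_N),
    [/\ forall l, convex_polyhedron (C l),
        \forall x \near a, X x <-> exists l, C l x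
      & forall l, exists (A : 'M[R]_(N, M)) (b : 'rV[R]_M),
          \forall x \near a, C l x -> f x = x *m A + b].

Definition pl_homeo_via (R : realType) (N M : nat)
    (X : set 'rV[R]_N) (Y : set 'rV[R]_M)
    (f : 'rV[R]_N -> 'rV[R]_M) (g : 'rV[R]_M -> 'rV[R]_N) : Prop :=
  [/\ pl_map X f, pl_map Y g,
      forall x, X x -> Y (f x) /\ g (f x) = x
    & forall y, Y y -> X (g y) /\ f (g y) = y].

Definition pl_homeo (R : realType) (N M : nat)
    (X : set 'rV[R]_N) (Y : set 'rV[R]_M) : Prop :=
  exists f g, pl_homeo_via X Y f g.

Definition prod_space (R : realType) (N M : nat)
    (X : set 'rV[R]_N) (Y : set 'rV[R]_M) : set 'rV[R]_(N + M) :=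
  [set w | X (lsubmx w) /\ Y (rsubmx w)].

Definition half_open_itv (R : realType) : set 'rV[R]_1 :=
  [set t | 0 <= t 0 0 < 1].

(* Open cone on a compact X, with vertex the origin and X placed at height 1;
   the cone on the empty set is the vertex. *)
Definition cone (R : realType) (N : nat) (X : set 'rV[R]_N) :
    set 'rV[R]_(1 + N) :=
  [set w | w = 0 \/ exists (t : R) (x : 'rV[R]_N),
     [/\ 0 <= t < 1, X x & w = row_mx t%:M (t *: x)]].

(* Suspension of a compact X, as the join of X with the points (1, 0) and
   (-1, 0); the suspension of the empty set is this pair of points. *)
Definition susp (R : realType) (N : nat) (X : set 'rV[R]_N) :
    set 'rV[R]_(1 + N) :=
  [set w | w = row_mx 1%:M 0 \/ w = row_mx (- 1)%:M 0 \/
     exists (t : R) (x : 'rV[R]_N),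
       [/\ `|t| <= 1, X x & w = row_mx t%:M ((1 - `|t|) *: x)]].

Fixpoint iter_susp (R : realType) (i N : nat) (X : set 'rV[R]_N) :
    set 'rV[R]_(i + N) :=
  match i return set 'rV[R]_(i + N) with
  | 0%N => X
  | j.+1 => susp (@iter_susp R j N X)
  end.

Arguments iter_susp {R} i {N} X.

Definition circle (R : realType) : set 'rV[R]_2 :=
  [set x | `|x 0 0| + `|x 0 1| = 1].

(* [filtered n X F] : (X, F) is a filtered PL space of formal dimension n,
   F i being the skeleton X^i.  The skeleta are indexed by all integers:
   X^i is empty for i < 0 and (as a consequence) X^i = X for i >= n. *)
Definition filtered (R : realType) (n : int) (N : nat) (X : set 'rV[R]_N)
    (F : int -> set 'rV[R]_N) : Prop :=
  [/\ polyhedron X,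
      F n = X /\ (forall i, i < 0 -> F i = set0),
      forall i j, i <= j -> F i `<=` F j
    & forall i, [/\ F i `<=` X, polyhedron (F i)
                  & X `&` closure (F i) `<=` F i]].

(* The empty space is the only (-1)-dimensional stratified pseudomanifold; it
   is the link of the points of the top stratum.  It is moreover an
   n-dimensional one for every n >= 0. *)
Inductive stratified_pm (R : realType) :
    int -> forall N, set 'rV[R]_N -> (int -> set 'rV[R]_N) -> Prop :=
| spm_empty N (X : set 'rV[R]_N) (F : int -> set 'rV[R]_N) of
    filtered (-1) X F & X = set0 :
    stratified_pm (-1) X F
| spm_discrete N (X : set 'rV[R]_N) (F : int -> set 'rV[R]_N) of
    filtered 0 X F & (forall x, X x -> \forall y \near x, X y -> y = x) :
    stratified_pm 0 X F
| spm_pos (n : int) N (X : set 'rV[R]_N) (F : int -> set 'rV[R]_N) of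
    0 < n & filtered n X F
  & X `<=` closure (X `\` F (n - 1))
  & (forall (i : nat) (x : 'rV[R]_N), F i%:Z x -> ~ F (i%:Z - 1) x ->
       exists (U : set 'rV[R]_N) (M : nat) (L : set 'rV[R]_M)
              (G : int -> set 'rV[R]_M)
              (f : 'rV[R]_(i + (1 + M)) -> 'rV[R]_N)
              (g : 'rV[R]_N -> 'rV[R]_(i + (1 + M))),
         [/\ U `<=` X /\ (\forall y \near x, X y -> U y),
             compact L /\ stratified_pm (n - i%:Z - 1) L G,
             pl_homeo_via (prod_space [set: 'rV[R]_i] (cone L)) U f g
           & forall j : nat,
               f @` prod_space [set: 'rV[R]_i] (cone (G (j%:Z - 1)))
               = F (i%:Z + j%:Z) `&` U]) :
    stratified_pm n X F.

(* B is the boundary of the stratified pseudomanifold with boundary (X, F).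
   The boundary has (i-1)-skeleton F i `&` B, so that its collar has i-skeleton
   [0, 1[ x (F i `&` B). *)
Definition bd_stratified_pm (R : realType) (n : int) (N : nat)
    (X : set 'rV[R]_N) (F : int -> set 'rV[R]_N) (B : set 'rV[R]_N) : Prop :=
  [/\ filtered n X F,
      B `<=` X,
      stratified_pm n (X `\` B) (fun i => F i `\` B),
      stratified_pm (n - 1) B (fun i => F (i + 1) `&` B)
    & exists (U : set 'rV[R]_N)
             (h : 'rV[R]_(1 + N) -> 'rV[R]_N) (k : 'rV[R]_N -> 'rV[R]_(1 + N)),
        [/\ U `<=` X /\ (forall b, B b -> \forall y \near b, X y -> U y),
            pl_homeo_via (prod_space (@half_open_itv R) B) U h k,
            forall b, B b -> h (row_mx 0 b) = b
          & forall i, h @` prod_space (@half_open_itv R) (F i `&` B)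
                      = F i `&` U]].

(* X admits a classical n-dimensional stratification (no stratum of
   codimension one) with boundary B.  For given nonempty X both n and B are
   determined by X, so this is the relation "dim X = n and the boundary of X
   is B". *)
Definition classical_dim_bd (R : realType) (n : int) (N : nat)
    (X B : set 'rV[R]_N) : Prop :=
  exists F, bd_stratified_pm n X F B /\ F (n - 1) = F (n - 2).

Definition has_dim (R : realType) (N : nat) (X : set 'rV[R]_N) (n : int) : Prop :=
  exists B, classical_dim_bd n X B.

Definition has_boundary (R : realType) (N : nat) (X B : set 'rV[R]_N) : Prop :=
  exists n, classical_dim_bd n X B.

Definition Psi (R : realType) (N : nat) (X : set 'rV[R]_N) : Prop :=
  compact X /\ exists B, has_boundary X B.

Definition compact_classical_pm (R : realType) (N : nat) (X : set 'rV[R]_N) : Prop :=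
  compact X /\ has_boundary X set0.

Definition pl_class (R : realType) : Type := forall N, set (set 'rV[R]_N).

Definition pl_class_sub (R : realType) (C D : pl_class R) : Prop :=
  forall N (X : set 'rV[R]_N), C N X -> D N X.

Definition homeo_closed (R : realType) (C : pl_class R) : Prop :=
  forall N M (X : set 'rV[R]_N) (Y : set 'rV[R]_M),
    pl_homeo X Y -> C N X -> C M Y.

Record stratified_pm_singularities (R : realType) (E : pl_class R) : Prop := {
  spms_Psi : forall N (X : set 'rV[R]_N), E N X -> Psi X;
  spms_dim : forall N (X : set 'rV[R]_N), E N X -> X !=set0 ->
    exists n : int, 0 < n /\ has_dim X n;
  spms_empty : E 0%N set0;
  spms_circle : E 2%N (@circle R);
  spms_homeo : homeo_closed E;
  spms_boundary : forall N (X : set 'rV[R]_N), E N X -> has_boundary X set0;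
  spms_susp : forall N (X : set 'rV[R]_N), X !=set0 -> E N X ->
    E (1 + N)%N (susp X) }.

Record pm_singularities (R : realType) (G : pl_class R) : Prop := {
  pms_Psi : forall N (X : set 'rV[R]_N), G N X -> Psi X;
  pms_boundary : forall N (X : set 'rV[R]_N), G N X -> has_boundary X set0;
  pms_empty : G 0%N set0;
  pms_homeo : homeo_closed G;
  pms_susp : forall N (X : set 'rV[R]_N), Psi X ->
    (G N X <-> G (1 + N)%N (susp X)) }.

Definition is_suspension (R : realType) (N : nat) (Z : set 'rV[R]_N) : Prop :=
  exists (M : nat) (W : set 'rV[R]_M), compact_classical_pm W /\ pl_homeo Z (susp W).

(* i and (up to PL homeomorphism) Z are determined by Y. *)
Definition G_of (R : realType) (E : pl_class R) : pl_class R :=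
  fun N Y => compact_classical_pm Y /\
    exists (i M : nat) (Z : set 'rV[R]_M),
      [/\ compact_classical_pm Z, ~ is_suspension Z,
          pl_homeo Y (iter_susp i Z) & E M Z].

Definition E_of (R : realType) (G : pl_class R) : pl_class R :=
  fun N X => G N X /\ ~ (X !=set0 /\ has_dim X 0).

(* Main.v *)
Require Import Defs.
From mathcomp Require Import all_boot all_order all_algebra.
From mathcomp Require Import all_classical all_reals all_analysis.
From mathcomp Require Import ring lra zify.

(** If X is PL homeomorphic to iter_susp i Z and Z is not a suspension, call Z
    a desuspension of X.

    A class G is stable under suspension and desuspension, so it contains a space
    if and only if it contains a desuspension of it. One exists for each member
    (G_desuspend), since an iterated suspension contains cells of large dimension
    and injective PL maps do not lower the dimension (pl_inj_dim_le). Discarding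
    the 0-dimensional members of G loses none of these: if Z is nonempty, finite
    and in G, its suspension has neither boundary nor strata of codimension one,
    so that the pole has a neighbourhood PL homeomorphic to the line. The points
    of Z correspond to the arms leaving the pole, hence Z consists of two points
    (susp_discrete_pair) and is itself a suspension, that of the empty space.
    This gives the equality for G.

    A class E is stable under suspension of nonempty spaces. A space whose
    desuspension Z is in E is therefore in E, unless Z is empty; then it is empty,
    a pair of points, which has dimension 0 and is excluded, or an iterated
    suspension of the circle (E_of_G_of_sub).

    For the last two claims let E consist of the empty space and of the
    suspensions of positive dimension. Its only member which is not a suspension
    is the empty one, so G_of E consists of spheres only, and the spheres in E
    form a class with the same G_of. But E also contains the suspension of two
    disjoint circles, which is not a sphere because it is disconnected by removing
    the poles (susp_circles_not_sphere).

    That E is a class of singularities rests on two facts. Suspension is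
    functorial for PL homeomorphisms of compact polyhedra (pl_susp). And the
    suspension of a compact classical pseudomanifold of positive dimension is one
    (stratified_pm_susp): the link of a pole is the space itself, and charts at
    other points are obtained from charts f : R^i x cL -> U by the formula
    (t, z) |-> (t, f z - `|t| x0), which maps into the suspension because f
    commutes with small homotheties (pl_germ). These charts are defined on bounded
    neighbourhoods, which are unrolled to R^(i + 1) x cL by a PL homeomorphism
    between an open interval and the line. *)

Set Implicit Arguments.
Unset Strict Implicit.
Unset Printing Implicit Defensive.

Import Order.TTheory GRing.Theory Num.Theory.
Import numFieldNormedType.Exports.

Local Open Scope classical_set_scope.
Local Open Scope ring_scope.

(** * Neighbourhoods in spaces of row vectors *)

Section Topology.
Variable R : realType.

Lemma continuous_mx (T : topologicalType) m n (f : T -> 'M[R]_(m, n)) :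
  (forall i j, continuous (fun x => f x i j)) -> continuous f.
Proof.
move=> cf x A /= [P nP PA].
have : \forall y \near x, forall i j, P i j (f y i j).
  by apply: filter_forall => i; apply: filter_forall => j; exact/cf/nP.
by apply: filterS => y Py; exact: PA.
Qed.

Lemma near_ball N (a : 'rV[R]_N) (P : set 'rV[R]_N) :
  (\forall x \near a, P x) <->
  exists2 e : R, 0 < e & forall x, `|a - x| < e -> P x.
Proof.
split.
  move=> /nbhs_ballP[e e0 eP]; exists e => // x ax; apply: eP.
  by rewrite -ball_normE.
move=> [e e0 eP]; apply/nbhs_ballP; exists e => // x.
by rewrite -ball_normE => /eP.
Qed.

Lemma near_true N (a : 'rV[R]_N) (P : set 'rV[R]_N) :
  (forall x, P x) -> \forall x \near a, P x.
Proof. by move=> H; apply/near_ball; exists 1. Qed.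

Lemma near_all N (a : 'rV[R]_N) (T : finType) (P : T -> set 'rV[R]_N) :
  (forall l, \forall x \near a, P l x) -> \forall x \near a, forall l, P l x.
Proof. exact: (@filter_forall _ _ _ _ (nbhs_filter a)). Qed.

Lemma norm_coord_le N (x : 'rV[R]_N) i : `|x 0 i| <= `|x|.
Proof.
rewrite [leRHS]/Num.norm /= mx_normrE.
by apply/bigmax_geP; right; exists (0, i).
Qed.

Lemma norm_ltP N (x : 'rV[R]_N) (e : R) : 0 < e ->
  (forall i, `|x 0 i| < e) -> `|x| < e.
Proof.
move=> e0 H; rewrite [ltLHS]/Num.norm /= mx_normrE.
by apply/bigmax_ltP; split => // -[i j] _ /=; rewrite ord1.
Qed.

Lemma continuous_affine_coord N M (A : 'M[R]_(N, M)) (b : 'rV[R]_M) i j :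
  continuous (fun x : 'rV[R]_N => (x *m A + b) i j).
Proof.
move=> x.
have -> : (fun y : 'rV[R]_N => (y *m A + b) i j) =
    (fun y => (\sum_k y i k * A k j) + b i j).
  by apply/funext => y; rewrite !mxE.
have c1 : (\sum_k (y : 'rV[R]_N) i k * A k j) @[y --> x] --> \sum_k x i k * A k j.
  elim: (index_enum _) => [|k s IH].
    by rewrite big_nil; under eq_fun do rewrite big_nil; exact: cst_continuous.
  rewrite big_cons; under eq_fun do rewrite big_cons.
  apply: cvgD IH.
  by apply: cvgM; [exact: coord_continuous|exact: cst_continuous].
exact: cvgD c1 (@cst_continuous _ _ (b i j) x).
Qed.

Lemma continuous_affine N M (A : 'M[R]_(N, M)) (b : 'rV[R]_M) :
  continuous (fun x : 'rV[R]_N => x *m A + b).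
Proof. by apply: continuous_mx => i j; exact: continuous_affine_coord. Qed.

Lemma affine_dist_lt N M (A : 'M[R]_(N, M)) (b : 'rV[R]_M) (a : 'rV[R]_N) (e : R) : 0 < e ->
  \forall x \near a, `|a *m A + b - (x *m A + b)| < e.
Proof.
move=> e0; have /cvgrPdist_lt := @continuous_affine _ _ A b a.
exact.
Qed.

End Topology.

(** * Convex polyhedra *)

Section Pieces.
Variable R : realType.
Implicit Types N M : nat.

Lemma convex_polyhedron_far N (C : set 'rV[R]_N) a :
  convex_polyhedron C -> ~ C a -> \forall x \near a, ~ C x.
Proof.
move=> [k [A [b ->]]] /= /existsNP[j /negP]; rewrite -ltNge => bj.
have := @continuous_affine_coord R N k A 0 0 j a.
rewrite /continuous_at addr0 => cA; have := cvgr_gt (FF := nbhs_filter a) _ cA _ bj.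
by apply: filterS => x; rewrite addr0 => + /(_ j); rewrite ltNge => /negP.
Qed.

Lemma convex_polyhedron_segment N (C : set 'rV[R]_N) x y (s : R) :
  convex_polyhedron C -> C x -> C y -> 0 <= s <= 1 -> C (x + s *: (y - x)).
Proof.
move=> [k [A [b ->]]] /= Cx Cy /andP[s0 s1] j.
have := Cx j; have := Cy j.
rewrite mulmxDl -scalemxAl mulmxBl !mxE => hy hx.
by nra.
Qed.

Lemma convex_polyhedronT N : convex_polyhedron [set: 'rV[R]_N].
Proof.
exists 0%N, 0, 0; apply/seteqP; split=> x //= _ [] //.
Qed.

Lemma convex_polyhedronI N (C D : set 'rV[R]_N) :
  convex_polyhedron C -> convex_polyhedron D -> convex_polyhedron (C `&` D).
Proof.
move=> [k [A [b ->]]] [l [A' [b' ->]]].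
exists (k + l)%N, (row_mx A A'), (row_mx b b').
apply/seteqP; split=> x /=; rewrite mul_mx_row.
  move=> [H H'] j; case: (split_ordP j) => i ->; rewrite ?row_mxEl ?row_mxEr //.
move=> H; split=> j.
  by have := H (lshift _ j); rewrite !row_mxEl.
by have := H (rshift _ j); rewrite !row_mxEr.
Qed.

Lemma convex_polyhedron_preimage N M (C : set 'rV[R]_M) (A : 'M[R]_(N, M)) (b : 'rV[R]_M) :
  convex_polyhedron C -> convex_polyhedron [set x | C (x *m A + b)].
Proof.
move=> [k [A' [b' ->]]]; exists k, (A *m A'), (b' - b *m A').
apply/seteqP; split=> x /= H j; have := H j;
  by rewrite mulmxDl mulmxA !mxE lerBrDr.
Qed.

Lemma convex_polyhedron_halfspace N (A : 'cV[R]_N) (c : R) :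
  convex_polyhedron [set x : 'rV[R]_N | (x *m A) 0 0 <= c].
Proof.
have c0 : (c%:M : 'rV[R]_1) 0 0 = c by rewrite mxE eqxx mulr1n.
exists 1%N, A, (c%:M); apply/seteqP; split=> x /=; first by move=> H j; rewrite ord1 c0.
by move=> /(_ 0); rewrite c0.
Qed.

Lemma convex_polyhedron_coord_le N (i : 'I_N) (c : R) :
  convex_polyhedron [set x : 'rV[R]_N | x 0 i <= c].
Proof.
have := convex_polyhedron_halfspace (delta_mx i 0) c.
by congr convex_polyhedron; apply/seteqP; split=> x /=; rewrite -colE mxE.
Qed.

Lemma convex_polyhedron_coord_ge N (i : 'I_N) (c : R) :
  convex_polyhedron [set x : 'rV[R]_N | c <= x 0 i].
Proof.
have := convex_polyhedron_halfspace (- delta_mx i 0) (- c).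
congr convex_polyhedron; apply/seteqP; split=> x /=;
  by rewrite mulmxN -colE !mxE lerN2.
Qed.

Lemma convex_polyhedron_box N (a : 'rV[R]_N) (e : R) :
  convex_polyhedron [set x | forall i, `|a 0 i - x 0 i| <= e].
Proof.
exists (N + N)%N, (row_mx 1%:M (- 1%:M)), (row_mx (a + const_mx e) (const_mx e - a)).
apply/seteqP; split=> x /=; rewrite mul_mx_row mulmx1 mulmxN mulmx1.
  move=> H j; case: (split_ordP j) => i ->; rewrite ?row_mxEl ?row_mxEr !mxE;
    by have := H i; rewrite ler_norml => /andP[]; lra.
move=> H i; have := H (lshift _ i); have := H (rshift _ i).
by rewrite row_mxEl !row_mxEr row_mxEl !mxE ler_norml; lra.
Qed.

Lemma convex_polyhedron_point N (a : 'rV[R]_N) : convex_polyhedron [set a].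
Proof.
have := convex_polyhedron_box a 0.
congr convex_polyhedron; apply/seteqP; split=> x /=.
  by move=> H; apply/rowP => i; have := H i; rewrite normr_le0 subr_eq0 => /eqP.
by move=> -> i; rewrite subrr normr0.
Qed.

End Pieces.

(** * Piecewise linear maps *)

Section PL.
Variable R : realType.
Implicit Types N M P : nat.

(** The pieces of a PL map at a, without those that miss a and with one radius
    for all of them: near a the remaining pieces are star-shaped around a. *)
Definition pl_at N M (X : set 'rV[R]_N) (f : 'rV[R]_N -> 'rV[R]_M) a :=
  exists (T : finType) (C : T -> set 'rV[R]_N) (A : T -> 'M[R]_(N, M))
         (b : T -> 'rV[R]_M) (e : R),
    [/\ 0 < e, forall l, convex_polyhedron (C l) /\ C l a,
        forall x, `|a - x| < e -> X x <-> exists l, C l x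
      & forall l x, `|a - x| < e -> C l x -> f x = x *m A l + b l].

(** The pieces may be indexed by any finite type, for instance by a product when
    two subdivisions have a common refinement. *)
Lemma pl_mapI N M (X : set 'rV[R]_N) (f : 'rV[R]_N -> 'rV[R]_M) :
  (forall a, X a -> exists (T : finType) (C : T -> set 'rV[R]_N),
    [/\ forall l, convex_polyhedron (C l),
        \forall x \near a, X x <-> exists l, C l x
      & forall l, exists (A : 'M[R]_(N, M)) (b : 'rV[R]_M),
          \forall x \near a, C l x -> f x = x *m A + b]) ->
  pl_map X f.
Proof.
move=> H a /H[T [C [cC nC aC]]].
exists #|T|, (C \o enum_val); split => [l||l] /=; [exact: cC| |exact: aC].
apply: filterS nC => x ->; split=> -[l Cl]; last by exists (enum_val l).
by exists (enum_rank l); rewrite /= enum_rankK.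
Qed.

Lemma pl_mapP N M (X : set 'rV[R]_N) (f : 'rV[R]_N -> 'rV[R]_M) :
  pl_map X f -> forall a, X a -> pl_at X f a.
Proof.
move=> plf a /plf[k [C [cC nC aC]]].
have /choice[A /choice[b Ab]] := aC.
pose T : finType := {l : 'I_k | `[< C l a >]}.
have : \forall x \near a, (X x <-> exists l, C l x) /\
    forall l, (C l x -> f x = x *m A l + b l) /\ (~ C l a -> ~ C l x).
  apply: filterI => //; apply: near_all => l; apply: filterI; first exact: Ab.
  have [Ca|Ca] := pselect (C l a); first exact: near_true.
  by apply: filterS (convex_polyhedron_far (cC l) Ca) => x + _.
move=> /near_ball[e e0 eP].
exists T, (C \o val), (A \o val), (b \o val), e; split => //=.
- by move=> l; split; [exact: cC|exact/asboolP/(valP l)].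
- move=> x /eP[Xx Cx]; rewrite Xx; split=> -[l Cl]; last by exists (val l).
  have [Ca|Ca] := pselect (C l a); last by have [_ /(_ Ca)] := Cx l.
  by exists (exist _ l (asboolT Ca)).
- by move=> l x /eP[_ /(_ (val l))[+ _]]; apply.
Qed.

(** The subdivision for f is refined by the preimages of the subdivision for g.
    Identity maps in place of f or g give restrictions of PL maps, preimages
    and intersections of polyhedra. *)
Lemma pl_comp N M P (X : set 'rV[R]_N) (Y : set 'rV[R]_M)
    (f : 'rV[R]_N -> 'rV[R]_M) (g : 'rV[R]_M -> 'rV[R]_P) :
  pl_map X f -> pl_map Y g -> pl_map (X `&` f @^-1` Y) (g \o f).
Proof.
move=> /pl_mapP plf /pl_mapP plg; apply: pl_mapI => a [/plf + /plg].
move=> [T1 [C1 [A1 [b1 [e1 [e10 cC1 XC1 fA1]]]]]].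
move=> [T2 [C2 [A2 [b2 [e2 [e20 cC2 YC2 gA2]]]]]].
have aC l : f a = a *m A1 l + b1 l.
  by apply: fA1 (proj2 (cC1 l)); rewrite subrr normr0.
have near1 : \forall x \near a, `|a - x| < e1 /\
    forall l, `|f a - (x *m A1 l + b1 l)| < e2.
  apply: filterI; first by apply/near_ball; exists e1.
  apply: near_all => l; rewrite (aC l).
  exact: affine_dist_lt.
exists (T1 * T2)%type, (fun l => C1 l.1 `&` [set x | C2 l.2 (x *m A1 l.1 + b1 l.1)]).
split=> [[l m]||[l m]] /=.
- apply: convex_polyhedronI; first by have [] := cC1 l.
  by apply: convex_polyhedron_preimage; have [] := cC2 m.
- apply: filterS near1 => x [x1 x2]; split.
    move=> [/(XC1 _ x1)[l Cl]]; rewrite (fA1 l) // => /(YC2 _ (x2 l))[m Cm].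
    by exists (l, m).
  move=> [[l m] /= [Cl Cm]]; split; first by apply/(XC1 _ x1); exists l.
  by rewrite (fA1 l) //; apply/(YC2 _ (x2 l)); exists m.
- exists (A1 l *m A2 m), (b1 l *m A2 m + b2 m).
  apply: filterS near1 => x [x1 x2] [Cl Cm].
  by rewrite (fA1 l) // (gA2 m) // mulmxDl mulmxA addrA.
Qed.

Lemma pl_ext N M (X : set 'rV[R]_N) (f g : 'rV[R]_N -> 'rV[R]_M) :
  (forall x, X x -> f x = g x) -> pl_map X f -> pl_map X g.
Proof.
move=> fg /pl_mapP plf; apply: pl_mapI => a /plf.
move=> [T [C [A [b [e [e0 cC XC fA]]]]]].
have near1 : \forall x \near a, `|a - x| < e by apply/near_ball; exists e.
exists T, C; split=> [l||l]; first by have [] := cC l.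
  exact: filterS near1.
exists (A l), (b l); apply: filterS near1 => x x1 Cl.
by rewrite -fg; [exact: fA|apply/XC => //; exists l].
Qed.

Lemma pl_affine N M (X : set 'rV[R]_N) (A : 'M[R]_(N, M)) (b : 'rV[R]_M) :
  polyhedron X -> pl_map X (fun x => x *m A + b).
Proof.
move=> pX a /pX[k [C [cC XC]]]; exists k, C; split=> // l.
by exists A, b; apply: near_true.
Qed.

Lemma polyhedron_pl N M (X : set 'rV[R]_N) (f : 'rV[R]_N -> 'rV[R]_M) :
  pl_map X f -> polyhedron X.
Proof. by move=> plf a /plf[k [C [cC XC _]]]; exists k, C. Qed.

Lemma pl_id N (X : set 'rV[R]_N) : polyhedron X -> pl_map X id.
Proof.
move=> /(pl_affine 1%:M 0); apply: pl_ext => x _.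
by rewrite mulmx1 addr0.
Qed.

Lemma polyhedron_open N (X : set 'rV[R]_N) : open X -> polyhedron X.
Proof.
move=> oX a Xa; exists 1%N, (fun=> setT); split=> [_|]; first exact: convex_polyhedronT.
have : nbhs a X by apply: open_nbhs_nbhs.
by apply: filterS => x Xx; split => // _; exists ord0.
Qed.

Lemma polyhedron_preimage N M (X : set 'rV[R]_N) (Y : set 'rV[R]_M)
    (f : 'rV[R]_N -> 'rV[R]_M) :
  pl_map X f -> polyhedron Y -> polyhedron (X `&` f @^-1` Y).
Proof. by move=> plf /pl_id /(pl_comp plf)/polyhedron_pl. Qed.

Lemma pl_comp_sub N M P (X : set 'rV[R]_N) (Y : set 'rV[R]_M)
    (f : 'rV[R]_N -> 'rV[R]_M) (g : 'rV[R]_M -> 'rV[R]_P) :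
  (forall x, X x -> Y (f x)) -> pl_map X f -> pl_map Y g -> pl_map X (g \o f).
Proof.
move=> XY plf plg; have := pl_comp plf plg; congr pl_map.
by apply/seteqP; split=> [x []|x Xx] //; split=> //; exact: XY.
Qed.

Lemma polyhedronI N (X Y : set 'rV[R]_N) :
  polyhedron X -> polyhedron Y -> polyhedron (X `&` Y).
Proof. by move=> /pl_id plX /(polyhedron_preimage plX). Qed.

Lemma pl_restrict N M (X Y : set 'rV[R]_N) (f : 'rV[R]_N -> 'rV[R]_M) :
  Y `<=` X -> polyhedron Y -> pl_map X f -> pl_map Y f.
Proof. by move=> YX /pl_id plY; apply: pl_comp_sub plY. Qed.

Lemma pl_linear N M P (X : set 'rV[R]_N) (f : 'rV[R]_N -> 'rV[R]_M)
    (A : 'M[R]_(M, P)) (b : 'rV[R]_P) :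
  pl_map X f -> pl_map X (fun x => f x *m A + b).
Proof.
move=> plf.
have plT : pl_map setT (fun y => y *m A + b).
  by apply: pl_affine; apply: polyhedron_open; exact: openT.
exact: (pl_comp_sub (fun _ _ => I) plf plT).
Qed.

Lemma pl_cst N M (X : set 'rV[R]_N) (b : 'rV[R]_M) :
  polyhedron X -> pl_map X (fun=> b).
Proof.
move=> /(pl_affine (0 : 'M[R]_(N, M)) b); apply: pl_ext => x _.
by rewrite mulmx0 add0r.
Qed.

Lemma plD N M (X : set 'rV[R]_N) (f g : 'rV[R]_N -> 'rV[R]_M) :
  pl_map X f -> pl_map X g -> pl_map X (fun x => f x + g x).
Proof.
move=> /pl_mapP plf /pl_mapP plg; apply: pl_mapI => a Xa.
have [T1 [C1 [A1 [b1 [e1 [e10 cC1 XC1 fA1]]]]]] := plf a Xa.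
have [T2 [C2 [A2 [b2 [e2 [e20 cC2 XC2 gA2]]]]]] := plg a Xa.
have near1 : \forall x \near a, `|a - x| < e1 /\ `|a - x| < e2.
  by apply: filterI; apply/near_ball; [exists e1|exists e2].
exists (T1 * T2)%type, (fun l => C1 l.1 `&` C2 l.2).
split=> [[l m]||[l m]] /=.
- by apply: convex_polyhedronI; [have [] := cC1 l|have [] := cC2 m].
- apply: filterS near1 => x [x1 x2]; split.
    move=> Xx; have /(XC1 _ x1)[l Cl] := Xx; have /(XC2 _ x2)[m Cm] := Xx.
    by exists (l, m).
  by move=> [[l m] /= [Cl Cm]]; apply/(XC1 _ x1); exists l.
- exists (A1 l + A2 m), (b1 l + b2 m).
  apply: filterS near1 => x [x1 x2] [Cl Cm].
  by rewrite (fA1 l) // (gA2 m) // mulmxDr addrACA.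
Qed.

Definition pl_fun N (X : set 'rV[R]_N) (s : 'rV[R]_N -> R) :=
  pl_map X (fun x => (s x)%:M : 'rV[R]_1).

(** A map is the sum of its coordinates times the basis vectors, so that maps can
    be built from scalar functions. *)
Lemma pl_funP N M (X : set 'rV[R]_N) (f : 'rV[R]_N -> 'rV[R]_M) :
  polyhedron X -> pl_map X f <-> forall i, pl_fun X (fun x => f x 0 i).
Proof.
move=> pX; split=> [plf i|plf].
  have := pl_linear (delta_mx i 0 : 'cV_M) 0 plf; apply: pl_ext => x _.
  by apply/rowP => j; rewrite ord1 addr0 -colE !mxE eqxx mulr1n.
have: pl_map X (fun x => \sum_i f x 0 i *: delta_mx 0 i); last first.
  by apply: pl_ext => x _; rewrite [RHS]row_sum_delta.
elim: (index_enum _) => [|i s IH].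
  by apply: pl_ext (pl_cst 0 pX) => x _; rewrite big_nil.
have := plD (pl_linear (delta_mx 0 i : 'rV_M) 0 (plf i)) IH; apply: pl_ext => x _.
by rewrite big_cons addr0 mul_scalar_mx.
Qed.

End PL.

(** * Germs of PL maps and invariance of dimension *)

Section Germs.
Variable R : realType.
Implicit Types N M : nat.

(** Near a every piece contains a and is convex, and f is affine on it; hence f
    commutes with the homotheties of centre a and ratio at most 1. *)
Lemma pl_germ N M (X : set 'rV[R]_N) (f : 'rV[R]_N -> 'rV[R]_M) a :
  pl_map X f -> X a ->
  exists2 d : R, 0 < d & forall x (s : R), X x -> `|a - x| < d -> 0 <= s <= 1 ->
    X (a + s *: (x - a)) /\ f (a + s *: (x - a)) = f a + s *: (f x - f a).
Proof.
move=> /pl_mapP plf /plf[T [C [A [b [e [e0 cC XC fA]]]]]].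
exists e => // x s Xx xe s01; have /(XC _ xe)[l Cl] := Xx.
have [cCl Ca] := cC l.
have Cy := convex_polyhedron_segment cCl Ca Cl s01.
have ye : `|a - (a + s *: (x - a))| < e.
  rewrite opprD addrA subrr sub0r normrN normrZ ger0_norm; last by case/andP: s01.
  rewrite distrC; apply: le_lt_trans xe.
  by rewrite ler_piMl //; case/andP: s01.
split; first by apply/(XC _ ye); exists l.
rewrite (fA l) // (fA l _ xe Cl) (fA l a) ?subrr ?normr0 //.
have -> : x *m A l + b l - (a *m A l + b l) = (x - a) *m A l.
  by rewrite mulmxBl opprD addrACA subrr addr0.
by rewrite mulmxDl -scalemxAl addrAC.
Qed.

Lemma pl_continuous N M (X : set 'rV[R]_N) (f : 'rV[R]_N -> 'rV[R]_M) a (e : R) :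
  pl_map X f -> X a -> 0 < e ->
  exists2 d : R, 0 < d & forall x, X x -> `|a - x| < d -> `|f a - f x| < e.
Proof.
move=> /pl_mapP plf /plf[T [C [A [b [d [d0 cC XC fA]]]]]] e0.
have : \forall x \near a, `|a - x| < d /\
    forall l, `|a *m A l + b l - (x *m A l + b l)| < e.
  apply: filterI; first by apply/near_ball; exists d.
  by apply: near_all => l; exact: affine_dist_lt.
move=> /near_ball[d' d'0 H]; exists d' => // x Xx /H[xd xA].
have /(XC _ xd)[l Cl] := Xx.
by rewrite (fA l x) // (fA l a) ?subrr ?normr0 //; have [] := cC l.
Qed.

(** The closed sets are peeled off one at a time: if a point of the open set
    avoids the first of them, so does a neighbourhood of that point, and the
    remaining ones cover it. *)
Lemma finite_closed_cover n (T : finType) (K : T -> set 'rV[R]_n) (O : set 'rV[R]_n) :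
  (forall l a, ~ K l a -> \forall x \near a, ~ K l x) ->
  open O -> O !=set0 -> (forall x, O x -> exists l, K l x) ->
  exists l a (e : R), [/\ 0 < e, forall x, `|a - x| < e -> O x
    & forall x, `|a - x| < e -> K l x].
Proof.
move=> farK oO O0 OK.
have {OK} : forall x, O x -> exists2 l, l \in enum T & K l x.
  by move=> x /OK[l Kl]; exists l => //; rewrite mem_enum.
elim: (enum T) O oO O0 => [|l s IH] O oO [a Oa] OK; first by have [] := OK a Oa.
have [[x [Ox Kx]]|H] := pselect (exists x, O x /\ ~ K l x).
  have oO' : open (O `&` ~` K l).
    rewrite openE => y [Oy Ky]; rewrite /interior.
    by apply: filterI; [exact: open_nbhs_nbhs|exact: farK].
  have [||m [b [e [e0 bO bK]]]] := IH _ oO'; first by exists x.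
    move=> y [/OK[m]]; rewrite in_cons => /orP[/eqP-> //|ms Km _].
    by exists m.
  by exists m, b, e; split=> // y /bO[].
have /near_ball[e e0 aO] : \forall x \near a, O x by apply: open_nbhs_nbhs.
exists l, a, e; split=> // x /aO Ox; apply: contrapT => Kx.
by apply: H; exists x.
Qed.

(** Invariance of dimension for injective PL maps. Two uses of
    finite_closed_cover give a ball on which f is affine with values in a single
    d-dimensional affine subspace; the linear part is then injective from R^n
    to a space of dimension at most d. *)
Lemma pl_inj_dim_le n N M d (X : set 'rV[R]_N) (f : 'rV[R]_N -> 'rV[R]_M)
    (O : set 'rV[R]_n) (A : 'M[R]_(n, N)) (b : 'rV[R]_N)
    (T : finType) (B : T -> 'M[R]_(d, M)) (c : T -> 'rV[R]_M) :
  open O -> O !=set0 -> (forall v : 'rV[R]_n, v *m A = 0 -> v = 0) ->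
  (forall o, O o -> X (o *m A + b)) ->
  pl_map X f -> (forall x y, X x -> X y -> f x = f y -> x = y) ->
  (forall o, O o -> exists l v, f (o *m A + b) = v *m B l + c l) ->
  (n <= d)%N.
Proof.
move=> oO [w0 Ow0] Ainj OX /pl_mapP plf finj fB.
have [T1 [C1 [A1 [b1 [e [e0 cC XC fA]]]]]] := plf _ (OX _ Ow0).
pose O1 : set 'rV[R]_n := O `&` [set o | `|w0 *m A + b - (o *m A + b)| < e].
have oO1 : open O1.
  rewrite openE => y [Oy ye]; rewrite /interior; apply: filterI.
    exact: open_nbhs_nbhs.
  have e1 : 0 < e - `|w0 *m A + b - (y *m A + b)| by rewrite subr_gt0.
  apply: filterS (affine_dist_lt A b y e1) => x /= xy.
  rewrite -(subrKA (y *m A + b)); apply: le_lt_trans (ler_normD _ _) _.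
  by rewrite -ltrBrDl.
have [|||l [a1 [e1 [e10 aO aK]]]] := @finite_closed_cover n T1
    (fun l => [set o | C1 l (o *m A + b)]) O1 _ oO1.
- move=> l a Ca; apply: convex_polyhedron_far => //.
  by apply: convex_polyhedron_preimage; have [] := cC l.
- by exists w0; split=> //=; rewrite subrr normr0.
- by move=> x [/OX Xx xe]; apply/XC.
pose A' := A *m A1 l; pose b' := b *m A1 l + b1 l.
have fA' o : `|a1 - o| < e1 -> f (o *m A + b) = o *m A' + b'.
  move=> oe; have [_ /= oe'] := aO _ oe.
  by rewrite (fA l) //; [rewrite mulmxDl mulmxA addrA|exact: aK].
pose K' m := [set o : 'rV[R]_n |
  o *m (A' *m cokermx (B m)) + (b' - c m) *m cokermx (B m) = 0].
have K'P m o : K' m o <-> ((o *m A' + (b' - c m))%R <= B m)%MS.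
  rewrite submxE mulmxDl -mulmxA; exact: (rwP eqP).
have [||||m [a2 [e2 [e20 aB aK']]]] := @finite_closed_cover n T K'
    [set o | `|a1 - o| < e1] _ _.
- move=> m a Ka; apply: convex_polyhedron_far => //.
  exact: (convex_polyhedron_preimage _ _ (convex_polyhedron_point 0)).
- have -> : [set o | `|a1 - o| < e1] = ball a1 e1 by rewrite -ball_normE.
  exact: ball_open.
- by exists a1; rewrite /= subrr normr0.
- move=> x /= xe; have [Ox _] := aO _ xe; have [m [v fv]] := fB _ Ox.
  exists m; apply/K'P; rewrite addrA -fA' // fv -addrA subrr addr0.
  exact: submxMl.
have small (v : 'rV[R]_n) : exists2 s : R, 0 < s & `|a2 - (a2 + s *: v)| < e2.
  exists (e2 / (`|v| + 1)); first by rewrite divr_gt0 // ltr_wpDl.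
  rewrite opprD addrA subrr sub0r normrN normrZ ger0_norm; last first.
    by rewrite divr_ge0 // ?ltW // ltr_wpDl.
  by rewrite mulrAC ltr_pdivrMr ?ltr_wpDl // ltr_pM2l // ltrDl.
have a2e : `|a2 - a2| < e2 by rewrite subrr normr0.
have A'B : (A' <= B m)%MS.
  apply/row_subP => i; have [s s0 /aK'/K'P h] := small (delta_mx 0 i).
  have /K'P h2 := aK' _ a2e.
  move: h2; rewrite -eqmx_opp => /(addmx_sub h).
  have -> : (a2 + s *: delta_mx 0 i) *m A' + (b' - c m) - (a2 *m A' + (b' - c m)) =
      s *: row i A'.
    by rewrite rowE opprD addrACA subrr addr0 mulmxDl -scalemxAl addrAC subrr add0r.
  by rewrite eqmx_scale // gt_eqF.
have A'inj (v : 'rV[R]_n) : v *m A' = 0 -> v = 0.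
  move=> vA'; have [s s0 h] := small v.
  have vv : f ((a2 + s *: v) *m A + b) = f (a2 *m A + b).
    rewrite !fA'; [|exact: aB|exact: aB].
    by rewrite mulmxDl -scalemxAl vA' scaler0 addr0.
  have X2 o : `|a2 - o| < e2 -> X (o *m A + b) by move=> /aB/aO[/OX].
  have /addIr := finj _ _ (X2 _ h) (X2 _ a2e) vv.
  rewrite mulmxDl -scalemxAl -[RHS]addr0 => /addrI/eqP.
  by rewrite scaler_eq0 gt_eqF //= => /eqP/Ainj.
have := mxrankS A'B; move/eqP: (inj_row_free A'inj) => ->.
by move=> h; apply: leq_trans h (rank_leq_row _).
Qed.

End Germs.

(** * Suspensions *)

Section Suspension.
Variable R : realType.
Implicit Types N M : nat.

Definition height N (w : 'rV[R]_(1 + N)) : R := lsubmx w 0 0.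

Lemma height_row N t (y : 'rV[R]_N) : height (row_mx t%:M y) = t.
Proof. by rewrite /height row_mxKl mxE eqxx mulr1n. Qed.

Lemma row_height N (w : 'rV[R]_(1 + N)) : row_mx (height w)%:M (rsubmx w) = w.
Proof. by rewrite /height -mx11_scalar hsubmxK. Qed.

Lemma heightE N (w : 'rV[R]_(1 + N)) : height w = w 0 (lshift N 0).
Proof. by rewrite /height mxE. Qed.

Lemma height_norm N (w : 'rV[R]_(1 + N)) : `|height w| <= `|w|.
Proof. by rewrite heightE; exact: norm_coord_le. Qed.

Lemma rsubmx_norm i N (w : 'rV[R]_(i + N)) : `|rsubmx w| <= `|w|.
Proof.
apply/ler_addgt0Pr => e e0; apply: ltW; apply: norm_ltP => [|k].
  by rewrite ltr_wpDl.
by rewrite mxE; apply: le_lt_trans (norm_coord_le _ _) _; rewrite ltrDl.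
Qed.

Lemma heightB N (v w : 'rV[R]_(1 + N)) : height (v - w) = height v - height w.
Proof. by rewrite !heightE !mxE. Qed.

Lemma rsubmxB N (v w : 'rV[R]_(1 + N)) : rsubmx (v - w) = rsubmx v - rsubmx w.
Proof. by rewrite linearB. Qed.

(** In the definition of susp the third clause contains both poles as soon as X
    is nonempty; here the two cases exclude each other. *)
Lemma suspE N (X : set 'rV[R]_N) w : susp X w <->
  (`|height w| = 1 /\ rsubmx w = 0) \/
  (`|height w| < 1 /\ X ((1 - `|height w|)^-1 *: rsubmx w)).
Proof.
split.
  move=> [->|[->|[t [x [t1 Xx ->]]]]]; rewrite height_row row_mxKr.
  - by left; rewrite normr1.
  - by left; rewrite normrN1.
  - move: t1; rewrite le_eqVlt => /orP[/eqP t1|t1].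
      by left; rewrite t1 subrr scale0r.
    right; split=> //; rewrite scalerA mulVf ?scale1r //.
    by rewrite subr_eq0 gt_eqF.
move=> [[h1 y0]|[h1 Xy]].
  rewrite -[w]row_height y0; move: h1 => /eqP; rewrite eqr_norml => /andP[/orP[]/eqP-> _].
    by left.
  by right; left.
right; right; exists (height w), ((1 - `|height w|)^-1 *: rsubmx w).
split=> //; first exact: ltW.
by rewrite scalerA mulfV ?scale1r ?row_height // subr_eq0 gt_eqF.
Qed.

Lemma compact_susp N (X : set 'rV[R]_N) : compact X -> compact (susp X).
Proof.
move=> cX.
pose F (p : R * 'rV[R]_N) : 'rV[R]_(1 + N) := row_mx p.1%:M ((1 - `|p.1|) *: p.2).
have cF : continuous F.
  apply: continuous_mx => i j; rewrite ord1.
  case: (split_ordP j) => k ->.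
    have -> : (fun p => F p 0 (lshift N k)) = fst.
      by apply/funext => p; rewrite row_mxEl ord1 mxE eqxx mulr1n.
    by move=> p; exact: cvg_fst.
  have -> : (fun p => F p 0 (rshift 1 k)) = (fun p => (1 - `|p.1|) * p.2 0 k).
    by apply/funext => p; rewrite row_mxEr mxE.
  have c1 : continuous (fun p : R * 'rV[R]_N => 1 - `|p.1|).
    move=> p; apply: cvgB; first exact: cst_continuous.
    by apply: cvg_norm; exact: cvg_fst.
  have c2 : continuous (fun p : R * 'rV[R]_N => p.2 0 k).
    move=> p; apply: (@continuous_comp _ _ _ snd (fun y : 'rV[R]_N => y 0 k)).
      exact: cvg_snd.
    exact: coord_continuous.
  by move=> p; exact: cvgM (c1 p) (c2 p).
pose I : set R := `[-1, 1]%classic.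
have cI : compact (I `*` X : set (R * 'rV[R]_N)).
  by apply: compact_setX => //; exact: segment_compact.
have cFI := continuous_compact (continuous_subspaceT cF) cI.
have -> : susp X = [set row_mx 1%:M 0; row_mx (-1)%:M 0] `|`
    F @` (I `*` X).
  apply/seteqP; split=> w.
    move=> [->|[->|[t [x [t1 Xx ->]]]]]; [by left; left|by left; right|right].
    by exists (t, x) => //; split=> //=; rewrite /I /= in_itv /= -ler_norml.
  move=> [[->|->]|[[t x] [/= + Xx] <-]]; [by left|by right; left|].
  rewrite /I /= in_itv /= -ler_norml => t1; right; right.
  by exists t, x.
apply: compactU => //; apply: compactU; exact: compact_set1.
Qed.

End Suspension.

(** * Suspensions of PL maps *)

Section SuspensionPL.
Variable R : realType.
Implicit Types N M P : nat.

Lemma box_lt N (a x : 'rV[R]_N) (e : R) : 0 < e ->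
  (forall i, `|a 0 i - x 0 i| <= e / 2) -> `|a - x| < e.
Proof.
move=> e0 H; apply: norm_ltP => // i; rewrite !mxE.
by apply: le_lt_trans (H i) _; rewrite ltr_pdivrMr // ltr_pMr // ltr1n.
Qed.

Lemma compact_finite_net N (X : set 'rV[R]_N) (e : 'rV[R]_N -> R) :
  compact X -> (forall a, X a -> 0 < e a) ->
  exists s : seq 'rV[R]_N, (forall a, a \in s -> X a) /\
    forall x, X x -> exists2 a, a \in s & `|a - x| < e a.
Proof.
rewrite compact_cover => cX e0.
have [||D DX XD] := cX _ X (fun a => ball a (e a)).
- by move=> a Xa; apply: ball_open; exact: e0.
- by move=> a Xa; exists a => //; apply: ballxx; exact: e0.
exists (finmap.enum_fset D); split=> [a /DX|x /XD[a Da]]; first by rewrite inE.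
by rewrite -ball_normE; exists a.
Qed.

(** By compactness the local pieces are replaced by finitely many global ones,
    bounded because they are cut with boxes. *)
Lemma pl_compact_cover N M (X : set 'rV[R]_N) (f : 'rV[R]_N -> 'rV[R]_M) :
  compact X -> pl_map X f ->
  exists (T : finType) (C : T -> set 'rV[R]_N) (A : T -> 'M[R]_(N, M))
         (b : T -> 'rV[R]_M),
    [/\ forall l, convex_polyhedron (C l) /\ C l !=set0,
        forall l, exists r : R, forall x, C l x -> `|x| <= r,
        forall x, X x <-> exists l, C l x
      & forall l x, C l x -> f x = x *m A l + b l].
Proof.
move=> cX /pl_mapP plf.
pose data := {T : finType & ((T -> set 'rV[R]_N) * (T -> 'M[R]_(N, M)) *
  (T -> 'rV[R]_M))%type}.
have /choice[p Hp] : forall a, exists p : data * R, X a ->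
    [/\ 0 < p.2, forall l, convex_polyhedron ((projT2 p.1).1.1 l) /\ (projT2 p.1).1.1 l a,
        forall x, `|a - x| < p.2 -> X x <-> exists l, (projT2 p.1).1.1 l x
      & forall l x, `|a - x| < p.2 -> (projT2 p.1).1.1 l x ->
          f x = x *m (projT2 p.1).1.2 l + (projT2 p.1).2 l].
  move=> a; have [Xa|nXa] := pselect (X a).
    have [T [C [A [b [e He]]]]] := plf a Xa.
    by exists (existT _ T (C, A, b), e).
  have d0 : data by exists unit; exact: ((fun=> set0), (fun=> 0), (fun=> 0)).
  by exists (d0, 1).
pose T a := projT1 (p a).1; pose C a : T a -> _ := (projT2 (p a).1).1.1.
pose A a : T a -> _ := (projT2 (p a).1).1.2; pose b a : T a -> _ := (projT2 (p a).1).2.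
pose e a := (p a).2.
have H a : X a -> [/\ 0 < e a, forall l, convex_polyhedron (C a l) /\ C a l a,
        forall x, `|a - x| < e a -> X x <-> exists l, C a l x
      & forall l x, `|a - x| < e a -> C a l x -> f x = x *m A a l + b a l].
  exact: Hp.
have e2 a : X a -> 0 < e a / 2 by case/H => e0 _ _ _; rewrite divr_gt0.
have [s [sX Xs]] := compact_finite_net cX e2.
pose D := seq_sub s.
have XD' (a : D) : X (ssval a) by exact: sX (ssvalP a).
have box (a : D) l (ea := e (ssval a)) (x : 'rV[R]_N) :
    (forall i, `|(ssval a) 0 i - x 0 i| <= ea / 2) -> C (ssval a) l x ->
    X x /\ f x = x *m A _ l + b _ l /\ `|x| <= ea + `|ssval a|.
  have [e0 cC XC fA] := H _ (XD' a) => /(box_lt e0) xe Cl; split.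
    by apply/(XC _ xe); exists l.
  split; first exact: fA.
  have -> : x = ssval a - (ssval a - x) by rewrite subKr.
  apply: le_trans (ler_normB _ _) _.
  by rewrite addrC lerD2r ltW.
pose pt (l : {a : D & T (ssval a)}) : 'rV[R]_N := ssval (tag l).
exists {a : D & T (ssval a)}.
exists (fun l => C _ (tagged l) `&`
  [set x | forall i, `|pt l 0 i - x 0 i| <= e (pt l) / 2]).
exists (fun l => A _ (tagged l)), (fun l => b _ (tagged l)); split.
- move=> [a l] /=; have [e0 cC _ _] := H _ (XD' a); have [c1 c2] := cC l.
  split; first by apply: convex_polyhedronI => //; exact: convex_polyhedron_box.
  by exists (ssval a); split => //= i; rewrite subrr normr0 divr_ge0 // ltW.
- by move=> [a l] /=; exists (e (ssval a) + `|ssval a|) => x [/= Cl /box/(_ Cl)[_ []]].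
- move=> x; split; last by move=> [[a l] /= [Cl /box/(_ Cl)[]]].
  move=> Xx; have [a sa ax] := Xs _ Xx; have Xa := sX _ sa.
  have [e0 cC XC fA] := H _ Xa.
  have xe : `|a - x| < e a.
    by apply: lt_trans ax _; rewrite ltr_pdivrMr // ltr_pMr // ltr1n.
  have /(XC _ xe)[l Cl] := Xx.
  exists (Tagged (fun a : D => T (ssval a)) (l : T (ssval (SeqSub sa)))); split => //= i.
  apply: ltW; apply: le_lt_trans ax.
  by have := norm_coord_le (a - x) i; rewrite !mxE.
- by move=> [a l] x /= [Cl /box/(_ Cl)[_ []]].
Qed.

(** At the poles the factor 1 - `|t| vanishes, and the value is the pole of the
    same sign. *)
Definition susp_map N M (f : 'rV[R]_N -> 'rV[R]_M) (w : 'rV[R]_(1 + N)) :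
    'rV[R]_(1 + M) :=
  row_mx (height w)%:M ((1 - `|height w|) *: f ((1 - `|height w|)^-1 *: rsubmx w)).

(** A bounded polyhedron contains no half-line. The closed cone over it thus
    meets the hyperplane of its vertex in the vertex only. *)
Lemma bounded_recession N k (A : 'M[R]_(N, k)) (b : 'rV[R]_k) (x y : 'rV[R]_N) (r : R) :
  (forall z : 'rV[R]_N, (forall j, (z *m A) 0 j <= b 0 j) -> `|z| <= r) ->
  (forall j, (x *m A) 0 j <= b 0 j) -> (forall j, (y *m A) 0 j <= 0) -> y = 0.
Proof.
move=> bd Cx y0; apply/eqP; apply: contraT => ny.
pose s := (r + `|x| + 1) / `|y|.
have y_gt0 : 0 < `|y| by rewrite normr_gt0.
have r0 : 0 <= r by apply: le_trans (bd x Cx).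
have s0 : 0 <= s by rewrite divr_ge0 // !addr_ge0.
have := bd (x + s *: y).
have : forall j, ((x + s *: y) *m A) 0 j <= b 0 j.
  move=> j; rewrite mulmxDl -scalemxAl !mxE.
  have := Cx j; have := y0 j; rewrite !mxE => h1 h2.
  rewrite -[leRHS]addr0; apply: lerD => //.
  exact: mulr_ge0_le0.
move=> h0 /(_ h0) h.
have : `|s *: y| <= r + `|x|.
  rewrite -[s *: y](addKr x) addrC; apply: le_trans (ler_normD _ _) _.
  by rewrite normrN lerD2r.
rewrite normrZ ger0_norm // /s mulfVK ?gt_eqF //.
by rewrite gerDl ler10.
Qed.

(** The obvious map from `[-1, 1] x X to the suspension is not PL, but suspension
    is still functorial for PL maps: over a piece x D <= c the suspension is
    given by y D <= (1 - `|t|) c, and if f x = x A + b there, then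
    (1 - `|t|) f (y / (1 - `|t|)) = y A + (1 - `|t|) b is affine in (t, y). *)
Lemma pl_susp N M (X : set 'rV[R]_N) (f : 'rV[R]_N -> 'rV[R]_M) :
  compact X -> pl_map X f -> pl_map (susp X) (susp_map f).
Proof.
move=> cX plf; have [T [C [A [b [cC bC XC fA]]]]] := pl_compact_cover cX plf.
have XC' l x : C l x -> X x by move=> Cl; apply/XC; exists l.
have fam l : exists k (D : 'M[R]_(N, k)) (c : 'rV[R]_k),
    C l = [set x | forall j, (x *m D) 0 j <= c 0 j].
  by have [[k [D [c ->]]] _] := cC l; exists k, D, c.
(* the cone over the piece C l, on the side of the pole of height s *)
pose S l (s : R) := [set w : 'rV[R]_(1 + N) | [/\ 0 <= s * height w, s * height w <= 1,
  s * height w = 1 -> rsubmx w = 0 &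
  s * height w < 1 -> C l ((1 - s * height w)^-1 *: rsubmx w)]].
have cS l s : convex_polyhedron (S l s).
  have [k [D [c Cl]]] := fam l.
  have hw (t : R) (w : 'rV[R]_(1 + N)) : (w *m col_mx t%:M 0) 0 0 = t * height w.
    rewrite -{1}[w]row_height mul_row_col mulmx0 addr0.
    by rewrite -scalar_mxM mxE eqxx mulr1n mulrC.
  have c1 := convex_polyhedron_halfspace (col_mx s%:M 0 : 'cV[R]_(1 + N)) 1.
  have c2 := convex_polyhedron_halfspace (col_mx (- s)%:M 0 : 'cV[R]_(1 + N)) 0.
  have c3 : convex_polyhedron [set w : 'rV[R]_(1 + N) |
      forall j, (w *m col_mx (s *: c) D) 0 j <= c 0 j].
    by exists k, (col_mx (s *: c) D), c.
  have := convex_polyhedronI c3 (convex_polyhedronI c1 c2).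
  congr convex_polyhedron; apply/seteqP.
  have eq (w : 'rV[R]_(1 + N)) j : (w *m col_mx (s *: c) D) 0 j =
      s * height w * c 0 j + (rsubmx w *m D) 0 j.
    rewrite -{1}[w]row_height mul_row_col mul_scalar_mx scalerA mxE mxE.
    by rewrite [_ * s]mulrC.
  split=> w /=; rewrite !hw mulNr oppr_le0.
    move=> [h [h1 h0]]; split=> //.
      move=> h1'; have [x Cx] := proj2 (cC l); have [r br] := bC l.
      apply: (@bounded_recession _ _ D c x _ r); first by move=> y Cy; apply: br; rewrite Cl.
        by rewrite Cl in Cx.
      by move=> j; have := h j; rewrite eq h1' mul1r gerDl.
    move=> h1'; rewrite Cl /= => j; rewrite -scalemxAl mxE mulrC ler_pdivrMr ?subr_gt0 //.
    by have := h j; rewrite eq mulrBr mulr1 -lerBrDl mulrC.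
  move=> [h0 h1 w0 w1]; split=> // j; rewrite eq.
  move: h1; rewrite le_eqVlt => /orP[/eqP h1|h1].
    by rewrite h1 w0 // mul0mx mxE mul1r addr0.
  have := w1 h1; rewrite Cl /= => /(_ j); rewrite -scalemxAl mxE mulrC.
  by rewrite ler_pdivrMr ?subr_gt0 // mulrBr mulr1 -lerBrDl [_ * c _ _]mulrC.
pose sg (s : bool) : R := if s then 1 else - 1.
have sgP (t : R) : exists s, sg s * t = `|t|.
  by have [t0|t0] := leP 0 t; [exists true; rewrite /= mul1r ger0_norm|
    exists false; rewrite /= mulN1r ltr0_norm].
have sgN s (t : R) : 0 <= sg s * t -> sg s * t = `|t|.
  rewrite /sg; case: s; rewrite ?mul1r ?mulN1r => h; first by rewrite ger0_norm.
  by rewrite -normrN ger0_norm.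
pose E (i : T * bool + bool) : set 'rV[R]_(1 + N) :=
  match i with inl (l, s) => S l (sg s) | inr s => [set row_mx (sg s)%:M 0] end.
have cE i : convex_polyhedron (E i).
  by case: i => [[l s]|s] /=; [exact: cS|exact: convex_polyhedron_point].
apply: pl_mapI => a _; exists (T * bool + bool)%type, E; split=> //.
  apply: near_true => w; split.
    move=> /suspE[[h1 y0]|[h1 /XC[l Cl]]].
      have [s hs] := sgP (height w); exists (inr s) => /=.
      rewrite -[w]row_height y0; congr (row_mx _%:M _).
      have := congr1 ( *%R (sg s)) hs; rewrite h1 mulr1 mulrA /sg.
      by case: (s); rewrite ?mulr1 ?mulrNN ?mul1r.
    have [s hs] := sgP (height w); exists (inl (l, s)) => /=.
    rewrite /S /= hs; split=> //; first exact: ltW.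
    by move=> h; rewrite h ltxx in h1.
  move=> [[[l s]|s] /=]; last first.
    by move=> ->; case: s; [left|right; left].
  move=> [/sgN h0]; rewrite h0 => h1 w0 w1; apply/suspE.
  move: h1; rewrite le_eqVlt => /orP[/eqP h1|h1]; first by left; split => //; exact: w0.
  by right; split=> //; apply: (XC' l); exact: w1.
have hl (w : 'rV[R]_(1 + N)) : `|height w| = 1 -> rsubmx w = 0 ->
    susp_map f w = row_mx (height w)%:M 0.
  by move=> h1 w0; rewrite /susp_map h1 subrr scale0r.
move=> [[l s]|s] /=.
  exists (block_mx 1%:M (- sg s *: b l) 0 (A l)), (row_mx 0 (b l)).
  apply: near_true => w [/sgN h0]; rewrite h0 => h1 w0 w1.
  rewrite -[in RHS](row_height w) mul_row_block mulmx1 mulmx0 addr0 add_row_mx addr0.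
  rewrite mul_scalar_mx scalerA mulrN [_ * sg s]mulrC h0.
  move: h1; rewrite le_eqVlt => /orP[/eqP h1|h1].
    by rewrite hl ?w0 // mul0mx addr0 h1 scaleN1r addNr.
  rewrite /susp_map (fA _ _ (w1 h1)); congr row_mx.
  rewrite scalerDr -scalemxAl scalerA mulfV ?subr_eq0 ?gt_eqF // scale1r.
  by rewrite scalerBl scale1r scaleNr [b l - _]addrC addrA [rsubmx w *m _ - _]addrC.
exists 0, (row_mx (sg s)%:M 0); apply: near_true => w ->.
rewrite mulmx0 add0r hl ?height_row ?row_mxKr //.
by rewrite /sg; case: s; rewrite ?normrN normr1.
Qed.

End SuspensionPL.

(** * PL homeomorphisms, spheres and cells *)

Section Homeo.
Variable R : realType.
Implicit Types N M P : nat.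

Lemma pl_homeo_refl N (X : set 'rV[R]_N) : polyhedron X -> pl_homeo X X.
Proof. by move=> pX; exists id, id; split=> //; exact: pl_id. Qed.

Lemma pl_homeo_sym N M (X : set 'rV[R]_N) (Y : set 'rV[R]_M) :
  pl_homeo X Y -> pl_homeo Y X.
Proof. by move=> [f [g [plf plg fK gK]]]; exists g, f; split. Qed.

Lemma pl_homeo_trans N M P (X : set 'rV[R]_N) (Y : set 'rV[R]_M) (Z : set 'rV[R]_P) :
  pl_homeo X Y -> pl_homeo Y Z -> pl_homeo X Z.
Proof.
move=> [f [g [plf plg fK gK]]] [f' [g' [plf' plg' fK' gK']]].
exists (f' \o f), (g \o g'); split.
- by apply: pl_comp_sub plf plf' => x /fK[].
- by apply: pl_comp_sub plg' plg => x /gK'[].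
- move=> x Xx /=; have [Yf gf] := fK x Xx; have [Zf ->] := fK' _ Yf.
  by [].
- move=> z Zz /=; have [Yg fg] := gK' z Zz; have [Xg ->] := gK _ Yg.
  by [].
Qed.

Lemma susp_mapK N M (X : set 'rV[R]_N) (Y : set 'rV[R]_M)
    (f : 'rV[R]_N -> 'rV[R]_M) (g : 'rV[R]_M -> 'rV[R]_N) :
  (forall x, X x -> Y (f x) /\ g (f x) = x) ->
  forall w, susp X w -> susp Y (susp_map f w) /\ susp_map g (susp_map f w) = w.
Proof.
move=> fK w /suspE Xw; rewrite suspE /susp_map !height_row !row_mxKr.
case: Xw => [[h1 w0]|[h1 /fK[Yf gf]]].
  rewrite h1 subrr !scale0r; split; first by left.
  by rewrite -{2}[w]row_height w0.
have h0 : 1 - `|height w| != 0 by rewrite subr_eq0 gt_eqF.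
by rewrite scalerK // gf scalerKV // row_height; split=> //; right.
Qed.

Lemma pl_homeo_susp N M (X : set 'rV[R]_N) (Y : set 'rV[R]_M) :
  compact X -> compact Y -> pl_homeo X Y -> pl_homeo (susp X) (susp Y).
Proof.
move=> cX cY [f [g [plf plg fK gK]]]; exists (susp_map f), (susp_map g); split.
- exact: pl_susp.
- exact: pl_susp.
- exact: susp_mapK fK.
- exact: susp_mapK gK.
Qed.

Lemma pl_homeo_polyhedron N M (X : set 'rV[R]_N) (Y : set 'rV[R]_M) :
  pl_homeo X Y -> polyhedron X /\ polyhedron Y.
Proof. by move=> [f [g [/polyhedron_pl ? /polyhedron_pl ?]]]. Qed.

Lemma polyhedron_susp N (X : set 'rV[R]_N) :
  compact X -> polyhedron X -> polyhedron (susp X).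
Proof. by move=> cX /pl_id /(pl_susp cX)/polyhedron_pl. Qed.

Lemma pl_compact_image N M (X : set 'rV[R]_N) (f : 'rV[R]_N -> 'rV[R]_M) :
  compact X -> pl_map X f -> compact (f @` X).
Proof.
move=> cX plf; apply: continuous_compact => //.
apply/subspace_continuousP => a Xa.
apply/cvgrPdist_lt => e e0.
have [d d0 H] := pl_continuous plf Xa e0.
have : \forall x \near a, X x -> `|f a - f x| < e.
  by apply/near_ball; exists d => // x ax Xx; exact: H.
exact.
Qed.

Lemma pl_homeo_compact N M (X : set 'rV[R]_N) (Y : set 'rV[R]_M) :
  compact X -> pl_homeo X Y -> compact Y.
Proof.
move=> cX [f [g [plf _ fK gK]]].
rewrite (_ : Y = f @` X); first exact: pl_compact_image.
apply/seteqP; split=> [y Yy|_ [x /fK[Yf _] <-]] //.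
by have [Xg fg] := gK y Yy; exists (g y).
Qed.

(** Linear changes of ambient coordinates pass to suspensions of arbitrary sets;
    they identify iterated suspensions that lie in different ambient spaces. *)
Definition lin_equiv N M (X : set 'rV[R]_N) (Y : set 'rV[R]_M) :=
  exists (A : 'M[R]_(N, M)) (B : 'M[R]_(M, N)),
    (forall x, X x -> Y (x *m A) /\ x *m A *m B = x) /\
    (forall y, Y y -> X (y *m B) /\ y *m B *m A = y).

Lemma lin_equiv_refl N (X : set 'rV[R]_N) : lin_equiv X X.
Proof. by exists 1%:M, 1%:M; split=> x Xx; rewrite !mulmx1. Qed.

Lemma lin_equiv_pl N M (X : set 'rV[R]_N) (Y : set 'rV[R]_M) :
  polyhedron X -> polyhedron Y -> lin_equiv X Y -> pl_homeo X Y.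
Proof.
move=> pX pY [A [B [AK BK]]].
exists (fun x => x *m A + 0), (fun x => x *m B + 0); split.
- exact: pl_affine.
- exact: pl_affine.
- by move=> x /AK; rewrite !addr0.
- by move=> x /BK; rewrite !addr0.
Qed.

Lemma lin_equiv_susp N M (X : set 'rV[R]_N) (Y : set 'rV[R]_M) :
  lin_equiv X Y -> lin_equiv (susp X) (susp Y).
Proof.
suff H N1 N2 (X1 : set 'rV[R]_N1) (X2 : set 'rV[R]_N2) (A : 'M[R]_(N1, N2))
    (B : 'M[R]_(N2, N1)) :
    (forall x, X1 x -> X2 (x *m A) /\ x *m A *m B = x) ->
    forall w, susp X1 w -> susp X2 (w *m block_mx 1%:M 0 0 A) /\
      w *m block_mx 1%:M 0 0 A *m block_mx 1%:M 0 0 B = w.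
  by move=> [A [B [AK BK]]]; exists (block_mx 1%:M 0 0 A), (block_mx 1%:M 0 0 B);
    split; apply: H.
move=> AK w; rewrite -[w]row_height !mul_row_block !mulmx1 !mulmx0 add0r addr0.
rewrite add0r addr0 !suspE !height_row !row_mxKr.
move=> [[h1 ->]|[h1 /AK[Ax Bx]]].
  by rewrite !mul0mx; split=> //; left.
split; first by right; rewrite scalemxAl.
have h0 : 1 - `|height w| != 0 by rewrite subr_eq0 gt_eqF.
congr row_mx; move: Bx; rewrite -!scalemxAl.
by move=> /(congr1 ( *:%R (1 - `|height w|))); rewrite !scalerKV.
Qed.

Lemma lin_equiv_iter_susp i N M (X : set 'rV[R]_N) (Y : set 'rV[R]_M) :
  lin_equiv X Y -> lin_equiv (iter_susp i X) (iter_susp i Y).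
Proof. by move=> XY; elim: i => //= i; exact: lin_equiv_susp. Qed.

Lemma lin_equiv_iter_suspS i N (X : set 'rV[R]_N) :
  lin_equiv (iter_susp i (susp X)) (iter_susp i.+1 X).
Proof.
elim: i => [|i IH] /=; first exact: lin_equiv_refl.
exact: lin_equiv_susp.
Qed.

Lemma lin_equiv_set0 N M : lin_equiv (set0 : set 'rV[R]_N) (set0 : set 'rV[R]_M).
Proof. by exists 0, 0; split. Qed.

(** The iterated suspensions of the empty set are the unit spheres of the
    l1-norm. *)
Lemma iter_susp0E i :
  iter_susp i (set0 : set 'rV[R]_0) = [set x | \sum_k `|x 0 k| = 1].
Proof.
elim: i => [|i IH] /=.
  apply/seteqP; split=> x //=.
  by rewrite big_ord0 => /esym/eqP; rewrite oner_eq0.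
apply/seteqP.
have sumE (w : 'rV[R]_(1 + (i + 0))) :
    \sum_k `|w 0 k| = `|height w| + \sum_k `|rsubmx w 0 k|.
  rewrite big_split_ord big_ord1 heightE; congr (_ + _).
  by apply: eq_bigr => k _; rewrite mxE.
have s0 (y : 'rV[R]_(i + 0)) : 0 <= \sum_k `|y 0 k| by apply: sumr_ge0.
have sumZ (c : R) (y : 'rV[R]_(i + 0)) : 0 <= c ->
    \sum_k `|(c *: y) 0 k| = c * \sum_k `|y 0 k|.
  move=> c0; rewrite mulr_sumr; apply: eq_bigr => k _.
  by rewrite mxE normrM ger0_norm.
split=> w; rewrite suspE IH /= sumE.
  move=> [[-> ->]|[h1]].
    by rewrite big1 ?addr0 // => k _; rewrite mxE normr0.
  have h0 : 0 < 1 - `|height w| by rewrite subr_gt0.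
  rewrite sumZ ?invr_ge0 ?ltW // => /(congr1 ( *%R (1 - `|height w|))).
  by rewrite mulrA mulfV ?gt_eqF // mul1r mulr1 => ->; rewrite addrC subrK.
move=> hw; have : `|height w| <= 1 by rewrite -hw lerDl s0.
rewrite le_eqVlt => /orP[/eqP h1|h1].
  left; split=> //; apply/rowP => k; rewrite [RHS]mxE.
  move: hw; rewrite h1 => /(canRL (addKr _)); rewrite addNr => /psumr_eq0P.
  by move=> /(_ (fun _ _ => normr_ge0 _) k isT)/normr0_eq0.
right; split=> //; have h0 : 0 < 1 - `|height w| by rewrite subr_gt0.
have hs : \sum_k `|@rsubmx R 1 1 (i + 0) w 0 k| = 1 - `|height w| by move: hw; lra.
by rewrite sumZ ?invr_ge0 ?ltW // hs mulVf // gt_eqF.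
Qed.

Lemma circleE : susp (susp (set0 : set 'rV[R]_0)) = @circle R.
Proof.
rewrite -[LHS]/(iter_susp 2 (set0 : set 'rV[R]_0)) iter_susp0E.
have e1 : lift ord0 ord0 = 1 :> 'I_2 by apply: val_inj.
by apply/seteqP; split=> x /=; rewrite big_ord_recl big_ord1 e1.
Qed.

(** Affinely embedded balls bound the dimension from below. *)
Definition has_cell n N (X : set 'rV[R]_N) :=
  exists (a : 'rV[R]_n) (e : R) (A : 'M[R]_(n, N)) (b : 'rV[R]_N),
    [/\ 0 < e, forall v : 'rV[R]_n, v *m A = 0 -> v = 0
      & forall o, `|a - o| < e -> X (o *m A + b)].

Lemma has_cell_pole N (X : set 'rV[R]_N) : has_cell 0 (susp X).
Proof.
exists 0, 1, 0, (row_mx 1%:M 0); split=> // [v _|v _]; first by rewrite thinmx0.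
by rewrite mulmx0 add0r; left.
Qed.

(** The points o A + b of the cell, spread over the heights 0 < t < 1, give the
    points (t, y A + (1 - t) b) with y = (1 - t) o, which depend affinely on
    (t, y). *)
Lemma has_cell_susp n N (X : set 'rV[R]_N) : has_cell n X -> has_cell (1 + n) (susp X).
Proof.
move=> [a [e [A [b [e0 Ainj XA]]]]].
pose d := Num.min (4^-1) (e / (4 * (1 + `|a|))).
have d0 : 0 < d.
  by rewrite lt_min invr_gt0 ltr0n /= divr_gt0 // mulr_gt0 // ltr_pwDl.
pose c : 'rV[R]_(1 + n) := row_mx (2^-1)%:M (2^-1 *: a).
exists c, d, (block_mx 1%:M (- b) 0 A), (row_mx 0 b); split=> //.
  move=> w; rewrite -[w]row_height mul_row_block mulmx1 mulmx0 addr0.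
  rewrite -[X in _ = X -> _]row_mx0 => /eq_row_mx[h0].
  by rewrite h0 mul0mx add0r => /Ainj ->; rewrite row_mx0.
move=> w wd; have hd := le_lt_trans (height_norm _) wd.
have rd := le_lt_trans (rsubmx_norm _) wd.
move: hd rd; rewrite heightB rsubmxB height_row row_mxKr.
set h := height w; set y := rsubmx w => hd rd.
have : d <= 4^-1 by rewrite ge_min lexx.
move: (hd); rewrite ltr_norml => hd' d4.
have h01 : 0 < h < 1 /\ 4^-1 < 1 - h.
  by move: hd' d4 => /andP[h1 h2] h3; split; [apply/andP; split|]; lra.
have [/andP[h0 h1] h4] := h01.
have hq : 0 < 1 - h by rewrite subr_gt0.
apply/suspE; rewrite -[w]row_height -/h -/y mul_row_block mulmx1 mulmx0 addr0.
rewrite add_row_mx addr0 height_row row_mxKr ger0_norm ?ltW //; right; split=> //.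
have -> : (1 - h)^-1 *: (h%:M *m - b + y *m A + b) = ((1 - h)^-1 *: y) *m A + b.
  rewrite mul_scalar_mx -scalemxAl scalerN addrAC addrC.
  have -> : - (h *: b) + b = (1 - h) *: b by rewrite scalerBl scale1r addrC.
  rewrite scalerDr scalerA.
  by rewrite mulVf ?gt_eqF // scale1r.
apply: XA.
have -> : a - (1 - h)^-1 *: y =
    (1 - h)^-1 *: ((2^-1 *: a - y) + (2^-1 - h) *: a).
  rewrite addrAC -scalerDl scalerDr scalerN scalerA; congr (_ - _).
  rewrite -[LHS]scale1r; congr (_ *: _).
  have -> : 2^-1 + (2^-1 - h) = 1 - h by field.
  by rewrite mulVf // gt_eqF.
rewrite normrZ ger0_norm ?invr_ge0 ?ltW // mulrC ltr_pdivrMr //.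
apply: le_lt_trans (ler_normD _ _) _; rewrite normrZ.
have s1 : `|2^-1 *: a - y| + `|2^-1 - h| * `|a| < d * (1 + `|a|).
  by rewrite mulrDr mulr1; apply: ltr_leD => //; apply: ler_wpM2r => //; apply: ltW.
apply: lt_le_trans s1 _.
have s2 : d * (1 + `|a|) <= e / 4.
  have : d <= e / (4 * (1 + `|a|)) by rewrite ge_min lexx orbT.
  rewrite -ler_pdivlMr ?ltr_pwDl // => s3.
  by apply: le_trans s3 _; rewrite invfM mulrA.
by apply: le_trans s2 _; rewrite ler_pM2l // ltW.
Qed.

Lemma has_cell_iter_susp i N (X : set 'rV[R]_N) : has_cell i (iter_susp i.+1 X).
Proof.
elim: i => [|i IH]; first exact: has_cell_pole.
exact: has_cell_susp.
Qed.

Lemma has_cell_dim_le n N M d (X : set 'rV[R]_N) (Y : set 'rV[R]_M)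
    (T : finType) (B : T -> 'M[R]_(d, M)) (c : T -> 'rV[R]_M) :
  has_cell n X -> pl_homeo X Y -> (forall y, Y y -> exists l v, y = v *m B l + c l) ->
  (n <= d)%N.
Proof.
move=> [a [e [A [b [e0 Ainj XA]]]]] [f [g [plf _ fK _]]] YB.
apply: (@pl_inj_dim_le R n N M d X f [set o | `|a - o| < e] A b T B c) => //.
- have -> : [set o | `|a - o| < e] = ball a e by rewrite -ball_normE.
  exact: ball_open.
- by exists a; rewrite /= subrr normr0.
- by move=> x y /fK[_ gx] /fK[_ gy] fxy; rewrite -gx fxy.
- by move=> o /= oe; apply: YB; have [] := fK _ (XA _ oe).
Qed.

End Homeo.

(** * Stratified pseudomanifolds without boundary *)

Section Stratified.
Variable R : realType.
Implicit Types (N M : nat) (n : int).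

Lemma closureP N (A : set 'rV[R]_N) x :
  closure A x <-> forall e : R, 0 < e -> exists2 y, A y & `|x - y| < e.
Proof.
split=> [cA e e0|H B /near_ball[e e0 eB]].
  have : \forall y \near x, `|x - y| < e by apply/near_ball; exists e.
  by move=> /cA[y [Ay ye]]; exists y.
by have [y Ay ye] := H e e0; exists y; split=> //; exact: eB.
Qed.

Lemma pl_closure N M (X A : set 'rV[R]_N) (f : 'rV[R]_N -> 'rV[R]_M) x :
  pl_map X f -> A `<=` X -> X x -> closure A x -> closure (f @` A) (f x).
Proof.
move=> plf AX Xx /closureP cA; apply/closureP => e e0.
have [d d0 H] := pl_continuous plf Xx e0.
have [y Ay yd] := cA d d0; exists (f y); first by exists y.
by apply: H => //; exact: AX.
Qed.

Lemma pl_homeo_image N M (X A : set 'rV[R]_N) (Y : set 'rV[R]_M) f g :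
  pl_homeo_via X Y f g -> A `<=` X -> f @` A = Y `&` g @^-1` A.
Proof.
move=> [_ _ fK gK] AX; apply/seteqP; split=> [_ [x Ax <-]|y [Yy Ag]] /=.
  by have [Yf ->] := fK x (AX x Ax).
by have [_ fg] := gK y Yy; exists (g y).
Qed.

Lemma pl_homeo_polyhedron_image N M (X A : set 'rV[R]_N) (Y : set 'rV[R]_M) f g :
  pl_homeo_via X Y f g -> A `<=` X -> polyhedron A -> polyhedron (f @` A).
Proof.
move=> H AX pA; rewrite (pl_homeo_image H AX); case: H => _ plg _ _.
exact: polyhedron_preimage.
Qed.

(** The image of a skeleton is its preimage under the inverse map, hence a
    polyhedron. *)
Lemma filtered_homeo n N M (X : set 'rV[R]_N) F (Y : set 'rV[R]_M) f g :
  pl_homeo_via X Y f g -> filtered n X F -> filtered n Y (fun i => f @` F i).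
Proof.
move=> H [pX [Fn F0] Fle FX]; have [plf plg fK gK] := H.
have FsX i : F i `<=` X by have [] := FX i.
split.
- exact: polyhedron_pl plg.
- split; last by move=> i /F0 ->; rewrite image_set0.
  rewrite Fn (pl_homeo_image H) //; apply/seteqP; split=> [y []|y Yy] //.
  by split=> //=; have [] := gK y Yy.
- by move=> i j /Fle Fij; exact: image_subset.
- move=> i; split.
  + by move=> _ [x /FsX/fK[Yx _] <-].
  + by apply: pl_homeo_polyhedron_image H _ _ => //; have [] := FX i.
  + move=> y [Yy cy]; have [Xg fg] := gK y Yy; exists (g y) => //.
    have [_ _] := FX i; apply; split=> //.
    have := pl_closure plg _ Yy cy; rewrite image_comp.
    have -> : (g \o f) @` F i = F i.
      rewrite -[RHS]image_id; apply: eq_imagel => x /FsX/fK[_] //.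
    by apply=> _ [x /FsX/fK[Yx _] <-].
Qed.

(** The local condition on the strata, isolated for the inversion principle of
    stratified_pm. *)
Definition conical_charts n N (X : set 'rV[R]_N) (F : int -> set 'rV[R]_N) :=
  forall (i : nat) (x : 'rV[R]_N), F i%:Z x -> ~ F (i%:Z - 1) x ->
       exists (U : set 'rV[R]_N) (M : nat) (L : set 'rV[R]_M)
              (G : int -> set 'rV[R]_M)
              (f : 'rV[R]_(i + (1 + M)) -> 'rV[R]_N)
              (g : 'rV[R]_N -> 'rV[R]_(i + (1 + M))),
         [/\ U `<=` X /\ (\forall y \near x, X y -> U y),
             compact L /\ stratified_pm (n - i%:Z - 1) L G,
             pl_homeo_via (prod_space [set: 'rV[R]_i] (cone L)) U f g
           & forall j : nat,
               f @` prod_space [set: 'rV[R]_i] (cone (G (j%:Z - 1)))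
               = F (i%:Z + j%:Z) `&` U].

Lemma stratified_pm_inv n N (X : set 'rV[R]_N) F : stratified_pm n X F ->
  [\/ [/\ n = -1, filtered (-1) X F & X = set0],
      [/\ n = 0, filtered 0 X F & forall x, X x -> \forall y \near x, X y -> y = x]
    | [/\ 0 < n, filtered n X F, X `<=` closure (X `\` F (n - 1))
        & conical_charts n X F]].
Proof.
case=> {n N X F} [N X F fX X0|N X F fX dX|n N X F n0 fX dX cX].
- by apply: Or31.
- by apply: Or32.
- by apply: Or33.
Qed.

Lemma stratified_pm_filtered n N (X : set 'rV[R]_N) F :
  stratified_pm n X F -> filtered n X F.
Proof. by move=> /stratified_pm_inv[[-> fX _]|[-> fX _]|[_ fX _ _]]. Qed.

Lemma stratified_pm_neg n N (X : set 'rV[R]_N) F :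
  stratified_pm n X F -> n = -1 -> X = set0.
Proof. by move=> /stratified_pm_inv[[_ _ ->]|[->]|[n0 _ _ _ ne]] //; rewrite ne in n0. Qed.

Lemma stratified_pm_homeo n N M (X : set 'rV[R]_N) F (Y : set 'rV[R]_M) f g :
  pl_homeo_via X Y f g -> stratified_pm n X F -> stratified_pm n Y (fun i => f @` F i).
Proof.
move=> H spX; have := filtered_homeo H (stratified_pm_filtered spX).
have [plf plg fK gK] := H => fY.
case/stratified_pm_inv: spX fY => [[-> _ X0]|[-> _ dX]|[n0 [_ [Fn _] Fle FX] dX cX]] fY.
- apply: spm_empty => //; rewrite -subset0 => y /gK[].
  by rewrite X0.
- apply: spm_discrete => // y Yy; have [Xg fg] := gK y Yy.
  have /near_ball[e e0 eX] := dX _ Xg.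
  have [d d0 H'] := pl_continuous plg Yy e0.
  apply/near_ball; exists d => // y' yd Yy'; have [Xg' <-] := gK y' Yy'.
  by rewrite (eX _ (H' _ Yy' yd)).
have FsX i : F i `<=` X by have [] := FX i.
apply: spm_pos => //.
  move=> y Yy; have [Xg <-] := gK y Yy.
  have -> : Y `\` f @` F (n - 1) = f @` (X `\` F (n - 1)).
    rewrite (pl_homeo_image H (@subDsetl _ _ _)) (pl_homeo_image H (FsX _)).
    apply/seteqP; split=> z [Yz h]; split=> //=; have [Xz _] := gK z Yz.
      by split=> // Fz; apply: h.
    by move=> [_ Fz]; case: h.
  exact: (pl_closure plf (@subDsetl _ _ _) Xg (dX _ Xg)).
move=> i y [x Fx <-] nFx; have Xx := FsX _ _ Fx; have [Yfx gfx] := fK x Xx.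
have {}nFx : ~ F (i%:Z - 1) x by move=> h; apply: nFx; exists x.
have [U [P [L [G [f' [g' [[UX nU] cL [plf' plg' fK' gK'] Fj]]]]]]] := cX i x Fx nFx.
exists (f @` U), P, L, G, (f \o f'), (g' \o g); split=> //.
- split; first by move=> _ [u /UX/fK[Yu _] <-].
  move: nU => /near_ball[e e0 eU].
  have [d d0 H'] := pl_continuous plg Yfx e0.
  apply/near_ball; exists d => // z zd Yz; rewrite (pl_homeo_image H UX).
  split=> //=; apply: eU; first by rewrite -{1}gfx; exact: H'.
  by have [] := gK z Yz.
- split.
  + by apply: pl_comp_sub plf' plf => z /fK'[/UX].
  + by rewrite (pl_homeo_image H UX); exact: pl_comp.
  + move=> z Dz /=; have [Uf gf] := fK' z Dz; split; first by exists (f' z).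
    by have [_ ->] := fK _ (UX _ Uf).
  + move=> _ [u Uu <-] /=; have [_ ->] := fK _ (UX _ Uu); have [Dg ->] := gK' u Uu.
    by [].
move=> j; rewrite -image_comp Fj; apply/seteqP; split=> [_ [z [Fz Uz] <-]|_ [[z Fz <-] [u Uu uz]]].
  by split; exists z.
exists z => //; split=> //; have [_ <-] := fK _ (FsX _ _ Fz).
by rewrite -uz; have [_ ->] := fK _ (UX _ Uu).
Qed.

Lemma polyhedron0 N : polyhedron (set0 : set 'rV[R]_N).
Proof. by []. Qed.

Lemma filtered_set0 n N : filtered n (set0 : set 'rV[R]_N) (fun=> set0).
Proof. by split=> // [i j _ x|i] //; split=> // x []. Qed.

Lemma stratified_pm_set0 n N : -1 <= n -> stratified_pm n (set0 : set 'rV[R]_N) (fun=> set0).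
Proof.
move=> n1; have [n0|n0] := ltP 0 n; first exact: spm_pos (filtered_set0 _ _) _ _.
have : n = -1 \/ n = 0 by lia.
move=> [->|->]; first exact: spm_empty (filtered_set0 _ _) _.
exact: spm_discrete (filtered_set0 _ _) _.
Qed.

(** The case of an empty boundary, in which no collar has to be given. *)
Definition classical_pm n N (X : set 'rV[R]_N) :=
  exists F, stratified_pm n X F /\ F (n - 1) = F (n - 2).

Lemma classical_dim_bd0 n N (X : set 'rV[R]_N) :
  classical_dim_bd n X set0 -> classical_pm n X.
Proof.
move=> [F [[_ _ + _ _] cF]]; rewrite setD0.
under eq_fun do rewrite setD0.
by exists F.
Qed.

Lemma classical_pm_bd0 n N (X : set 'rV[R]_N) : 0 <= n ->
  classical_pm n X -> classical_dim_bd n X set0.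
Proof.
move=> n0 [F [spX cF]]; exists F; split=> //; split=> //.
- exact: stratified_pm_filtered.
- by rewrite setD0; under eq_fun do rewrite setD0.
- under eq_fun do rewrite setI0.
  by apply: stratified_pm_set0; lia.
exists set0, (fun=> 0), (fun=> 0).
have c0 (A : set 'rV[R]_1) : prod_space A (set0 : set 'rV[R]_N) = set0.
  by apply/seteqP; split=> w //= [].
split=> //; first by split=> // x [].
- by rewrite c0; split=> // x; exact: polyhedron0.
- by move=> i; rewrite setI0 c0 image_set0.
Qed.

Lemma classical_pm_homeo n N M (X : set 'rV[R]_N) (Y : set 'rV[R]_M) :
  pl_homeo X Y -> classical_pm n X -> classical_pm n Y.
Proof.
move=> [f [g H]] [F [spX cF]]; exists (fun i => f @` F i); split.
  exact: stratified_pm_homeo H spX.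
by rewrite cF.
Qed.

Lemma classical_pm_set0 N : classical_pm 0 (set0 : set 'rV[R]_N).
Proof. by exists (fun=> set0); split=> //; exact: stratified_pm_set0. Qed.

End Stratified.

(** * The line and the open interval *)

Section Stretching.
Variable R : realType.
Implicit Types (N M n : nat) (m : int).

(** The line is PL homeomorphic to the interval from -1 to 1, with locally finite
    but infinitely many pieces: the homeomorphism squash, which is not PL, is
    interpolated at the integers. Its inverse y / (1 - `|y|) locates the piece
    which contains y. *)
Definition squash (x : R) : R := x / (1 + `|x|).
Definition knot m : R := squash m%:~R.

Lemma squash_le (x y : R) : `|y| < 1 -> (squash x <= y) = (x <= y / (1 - `|y|)).
Proof.
move=> y1; have hy : 0 < 1 - `|y| by rewrite subr_gt0.
have hx : 0 < 1 + `|x| by rewrite ltr_pwDl.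
rewrite /squash ler_pdivrMr // ler_pdivlMr // mulrDr mulr1 mulrBr mulr1.
clear y1; move: hy hx; have [x0|x0] := leP 0 x; have [y0|y0] := leP 0 y;
  rewrite ?(ger0_norm x0) ?(ltr0_norm x0) ?(ger0_norm y0) ?(ltr0_norm y0);
  by move=> hy hx; apply/idP/idP => h; nra.
Qed.

Lemma knot_lt1 m : `|knot m| < 1.
Proof.
rewrite /knot /squash normrM normfV [`|1 + _|]ger0_norm; last exact: addr_ge0.
by rewrite ltr_pdivrMr ?ltr_pwDl // mul1r ltrDr ltr01.
Qed.

Lemma knot_le m y : `|y| < 1 -> (knot m <= y) = (m <= Num.floor (y / (1 - `|y|))).
Proof. by move=> y1; rewrite /knot squash_le // -floor_ge_int. Qed.

Lemma knotK m : knot m / (1 - `|knot m|) = m%:~R.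
Proof.
rewrite /knot /squash; set x : R := m%:~R.
have hx : 0 < 1 + `|x| by rewrite ltr_pwDl.
rewrite normrM normfV [`|1 + _|]ger0_norm ?addr_ge0 //.
have -> : 1 - `|x| / (1 + `|x|) = (1 + `|x|)^-1.
  by apply: (mulIf (lt0r_neq0 hx)); rewrite mulrBl mulfVK ?gt_eqF // mulVf ?gt_eqF // mul1r addrK.
by rewrite invrK mulfVK // gt_eqF.
Qed.

Lemma knot_mono m m' : (knot m <= knot m') = (m <= m').
Proof. by rewrite knot_le ?knot_lt1 // knotK intrKfloor. Qed.

Lemma knot_gap m : 0 < knot (m + 1) - knot m.
Proof. by rewrite subr_gt0 ltNge knot_mono; lia. Qed.

Definition shrink (x : R) : R :=
  let m := Num.floor x in knot m + (x - m%:~R) * (knot (m + 1) - knot m).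
Definition stretch (y : R) : R :=
  let m := Num.floor (y / (1 - `|y|)) in
  m%:~R + (y - knot m) / (knot (m + 1) - knot m).

Lemma floor_eq m (x : R) : m%:~R <= x -> x < (m + 1)%:~R -> Num.floor x = m.
Proof. by move=> h1 h2; apply/floor_def; rewrite h1. Qed.

Lemma shrink_itv m x : m%:~R <= x <= (m + 1)%:~R ->
  shrink x = knot m + (x - m%:~R) * (knot (m + 1) - knot m).
Proof.
move=> /andP[h1]; rewrite le_eqVlt => /orP[/eqP->|h2]; last by rewrite /shrink (floor_eq h1 h2).
rewrite /shrink intrKfloor subrr mul0r addr0 intrD addrAC subrr add0r mul1r.
by rewrite addrCA subrr addr0.
Qed.

Lemma stretch_itv m y : `|y| < 1 -> knot m <= y <= knot (m + 1) ->
  stretch y = m%:~R + (y - knot m) / (knot (m + 1) - knot m).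
Proof.
move=> y1 /andP[h1]; rewrite le_eqVlt => /orP[/eqP->|h2].
  rewrite /stretch knotK intrKfloor subrr mul0r addr0 divff ?gt_eqF ?knot_gap //.
  by rewrite intrD.
rewrite /stretch; suff -> : Num.floor (y / (1 - `|y|)) = m by [].
apply/eqP; rewrite eq_le -knot_le // h1 andbT.
by move: h2; rewrite ltNge knot_le // -ltNge; lia.
Qed.

Lemma stretch_in y : `|y| < 1 -> exists m, knot m <= y < knot (m + 1).
Proof.
move=> y1; exists (Num.floor (y / (1 - `|y|))).
by rewrite knot_le // lexx /= ltNge knot_le //; lia.
Qed.

Lemma shrink_in (x : R) : exists m, m%:~R <= x < (m + 1)%:~R.
Proof. by exists (Num.floor x); rewrite floor_le /= floorD1_gt. Qed.

Lemma shrinkK x : `|shrink x| < 1 /\ stretch (shrink x) = x.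
Proof.
have [m /andP[h1 h2]] := shrink_in x; have g0 := knot_gap m.
have := shrink_itv (m := m) (x := x); rewrite h1 ltW //= => /(_ isT) sx.
have x1 : x - m%:~R < 1 by move: h2; rewrite intrD; lra.
have s1 : knot m <= shrink x by rewrite sx lerDl mulr_ge0 ?subr_ge0 // ltW // -subr_gt0.
have s2 : shrink x < knot (m + 1).
  by rewrite sx -ltrBrDl gtr_pMl.
have s3 : `|shrink x| < 1.
  have := knot_lt1 m; have := knot_lt1 (m + 1); rewrite !ltr_norml.
  by move=> /andP[_ k1] /andP[k2 _]; apply/andP; split; lra.
split=> //; rewrite (stretch_itv (m := m)) // ?s1 ?ltW // sx.
by rewrite addrAC subrr add0r mulfK ?gt_eqF // addrC subrK.
Qed.

Lemma stretchK y : `|y| < 1 -> shrink (stretch y) = y.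
Proof.
move=> y1; have [m /andP[h1 h2]] := stretch_in y1; have g0 := knot_gap m.
have := stretch_itv (m := m) y1; rewrite h1 ltW //= => /(_ isT) sy.
rewrite (shrink_itv (m := m)) sy.
  by rewrite addrAC subrr add0r mulfVK ?gt_eqF // addrC subrK.
rewrite lerDl divr_ge0 ?subr_ge0 // ?intrD ?lerD2l; last by rewrite -subr_ge0 ltW.
by rewrite ler_pdivrMr // mul1r lerD2r ltW.
Qed.

(** The two half-lines bounded by the knot q m serve as pieces at every point
    strictly between q (m - 1) and q (m + 1). *)
Lemma pl_interp (D : set 'rV[R]_1) (q c s : int -> R) (h : R -> R) :
  open D -> (forall v, D v -> exists m, q (m - 1) < v 0 0 < q (m + 1)) ->
  (forall (v : 'rV[R]_1) m, D v -> q m <= v 0 0 <= q (m + 1) ->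
     h (v 0 0) = c m + v 0 0 * s m) ->
  pl_map D (fun v => (h (v 0 0))%:M : 'rV[R]_1).
Proof.
move=> oD Dq qh; apply: pl_mapI => a Da; have [m /andP[m1 m2]] := Dq a Da.
have near1 : \forall x \near a, D x /\ q (m - 1) < x 0 0 < q (m + 1).
  apply: filterI; first exact: open_nbhs_nbhs.
  apply/near_ball; exists (Num.min (a 0 0 - q (m - 1)) (q (m + 1) - a 0 0)).
    by rewrite lt_min !subr_gt0 m1.
  move=> x xa; have := le_lt_trans (norm_coord_le (a - x) 0) xa.
  by rewrite !mxE lt_min !ltr_norml => /andP[/andP[_ h1] /andP[h2 _]]; lra.
exists bool, (fun b : bool => if b then [set v : 'rV[R]_1 | v 0 0 <= q m]
              else [set v | q m <= v 0 0]); split=> [[]||b].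
- exact: convex_polyhedron_coord_le.
- exact: convex_polyhedron_coord_ge.
- apply: filterS near1 => x [Dx _]; split=> // _.
  by have [xm|/ltW xm] := leP (x 0 0) (q m); [exists true|exists false].
(* to the left of q m the formula of the preceding interval applies *)
pose m' := if b then m - 1 else m.
exists (s m')%:M, (c m')%:M; apply: filterS near1 => x [Dx /andP[h1 h2]] hb.
have -> : x = (x 0 0)%:M by rewrite -mx11_scalar.
rewrite -scalar_mxM -raddfD /= !mxE eqxx mulr1n; congr (_%:M).
rewrite addrC; apply: qh => //; rewrite /m'; case: (b) hb => /= hb; last by rewrite hb ltW.
by rewrite subrK hb ltW.
Qed.

Lemma open_cube n : open [set v : 'rV[R]_n | forall i, `|v 0 i| < 1].
Proof.
have -> : [set v : 'rV[R]_n | forall i, `|v 0 i| < 1] = ball 0 1.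
  rewrite -ball_normE; apply/seteqP; split=> v /=; rewrite sub0r normrN.
    exact: norm_ltP.
  by move=> h i; apply: le_lt_trans h; exact: norm_coord_le.
exact: ball_open.
Qed.

Lemma pl_shrink1 : pl_map setT (fun v : 'rV[R]_1 => (shrink (v 0 0))%:M : 'rV[R]_1).
Proof.
apply: (@pl_interp _ (fun m => m%:~R)
  (fun m => knot m - m%:~R * (knot (m + 1) - knot m)) (fun m => knot (m + 1) - knot m)).
- exact: openT.
- move=> v _; have [m /andP[h1 h2]] := shrink_in (v 0 0); exists m.
  by rewrite h2 andbT; apply: lt_le_trans h1; rewrite ltr_int; lia.
- by move=> v m _ h; rewrite (shrink_itv h) mulrBl addrA addrAC.
Qed.

Lemma pl_stretch1 : pl_map [set v : 'rV[R]_1 | forall i, `|v 0 i| < 1]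
  (fun v : 'rV[R]_1 => (stretch (v 0 0))%:M : 'rV[R]_1).
Proof.
apply: (@pl_interp _ knot
  (fun m => m%:~R - knot m / (knot (m + 1) - knot m)) (fun m => (knot (m + 1) - knot m)^-1)).
- exact: open_cube.
- move=> v v1; have [m /andP[h1 h2]] := stretch_in (v1 0); exists m.
  rewrite h2 andbT; apply: lt_le_trans h1.
  by rewrite -subr_gt0; have := knot_gap (m - 1); rewrite subrK.
- by move=> v m v1 h; rewrite (stretch_itv (v1 0) h) mulrBl addrA addrAC.
Qed.

Definition shrink_mx n (v : 'rV[R]_n) : 'rV[R]_n := \row_i shrink (v 0 i).
Definition stretch_mx n (v : 'rV[R]_n) : 'rV[R]_n := \row_i stretch (v 0 i).

Lemma pl_coordwise n (h : R -> R) (D : set 'rV[R]_n) (D1 : set 'rV[R]_1) :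
  polyhedron D -> (forall v i, D v -> D1 (v 0 i)%:M) ->
  pl_map D1 (fun v => (h (v 0 0))%:M : 'rV[R]_1) ->
  pl_map D (fun v => \row_i h (v 0 i)).
Proof.
move=> pD DD1 plh; apply/(pl_funP _ pD) => i.
have /(pl_funP _ pD)/(_ i) pli := pl_id pD.
have := pl_comp_sub (fun v => DD1 v i) pli plh.
by apply: pl_ext => v _ /=; rewrite !mxE eqxx mulr1n.
Qed.

Lemma pl_shrink n : pl_map setT (@shrink_mx n).
Proof.
apply: (pl_coordwise (D1 := setT)) pl_shrink1 => //.
by apply: polyhedron_open; exact: openT.
Qed.

Lemma pl_stretch n : pl_map [set v : 'rV[R]_n | forall i, `|v 0 i| < 1] (@stretch_mx n).
Proof.
apply: pl_coordwise pl_stretch1; first by apply: polyhedron_open; exact: open_cube.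
by move=> v i v1 j; rewrite ord1 mxE eqxx mulr1n.
Qed.

Lemma shrink_mxK n (v : 'rV[R]_n) :
  (forall i, `|shrink_mx v 0 i| < 1) /\ stretch_mx (shrink_mx v) = v.
Proof.
split=> [i|]; first by rewrite mxE; have [] := shrinkK (v 0 i).
by apply/rowP => i; rewrite !mxE; have [] := shrinkK (v 0 i).
Qed.

Lemma stretch_mxK n (v : 'rV[R]_n) :
  (forall i, `|v 0 i| < 1) -> shrink_mx (stretch_mx v) = v.
Proof. by move=> v1; apply/rowP => i; rewrite !mxE stretchK. Qed.

End Stretching.

(** * Operations on PL maps *)

Section PLclosure.
Variable R : realType.
Implicit Types N M P : nat.

Lemma pl_homeo_via_trans N M P (X : set 'rV[R]_N) (Y : set 'rV[R]_M) (Z : set 'rV[R]_P)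
    f g f' g' :
  pl_homeo_via X Y f g -> pl_homeo_via Y Z f' g' ->
  pl_homeo_via X Z (f' \o f) (g \o g').
Proof.
move=> [plf plg fK gK] [plf' plg' fK' gK']; split.
- by apply: pl_comp_sub plf plf' => x /fK[].
- by apply: pl_comp_sub plg' plg => x /gK'[].
- by move=> x Xx /=; have [Yf gf] := fK x Xx; have [Zf ->] := fK' _ Yf.
- by move=> z Zz /=; have [Yg fg] := gK' z Zz; have [Xg ->] := gK _ Yg.
Qed.

Lemma pl_scale N M (X : set 'rV[R]_N) (f : 'rV[R]_N -> 'rV[R]_M) a b :
  pl_map X f -> pl_map X (fun x => a *: f x + b).
Proof.
by move=> /(pl_linear a%:M b); apply: pl_ext => x _; rewrite mul_mx_scalar.
Qed.

Lemma pl_row_mx N M P (X : set 'rV[R]_N) (f : 'rV[R]_N -> 'rV[R]_M)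
    (g : 'rV[R]_N -> 'rV[R]_P) :
  pl_map X f -> pl_map X g -> pl_map X (fun x => row_mx (f x) (g x)).
Proof.
move=> /(pl_linear (row_mx 1%:M 0) (0 : 'rV[R]_(M + P))) plf.
move=> /(pl_linear (row_mx 0 1%:M) (0 : 'rV[R]_(M + P))) plg.
have := plD plf plg; apply: pl_ext => x _.
by rewrite !addr0 !mul_mx_row !mulmx1 !mulmx0 add_row_mx addr0 add0r.
Qed.

Lemma pl_lsubmx N M P (X : set 'rV[R]_N) (f : 'rV[R]_N -> 'rV[R]_(M + P)) :
  pl_map X f -> pl_map X (fun x => lsubmx (f x)).
Proof.
move=> /(pl_linear (col_mx 1%:M 0) (0 : 'rV[R]_M)); apply: pl_ext => x _.
by rewrite addr0 -{1}[f x]hsubmxK mul_row_col mulmx1 mulmx0 addr0.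
Qed.

Lemma pl_rsubmx N M P (X : set 'rV[R]_N) (f : 'rV[R]_N -> 'rV[R]_(M + P)) :
  pl_map X f -> pl_map X (fun x => rsubmx (f x)).
Proof.
move=> /(pl_linear (col_mx 0 1%:M) (0 : 'rV[R]_P)); apply: pl_ext => x _.
by rewrite addr0 -{1}[f x]hsubmxK mul_row_col mulmx1 mulmx0 add0r.
Qed.

Lemma pl_height N M (X : set 'rV[R]_N) (f : 'rV[R]_N -> 'rV[R]_(1 + M)) :
  pl_map X f -> pl_fun X (fun x => height (f x)).
Proof.
by move=> /pl_lsubmx; apply: pl_ext => x _; rewrite /height -mx11_scalar.
Qed.

Lemma pl_fun_scale N M (X : set 'rV[R]_N) s (d : 'rV[R]_M) :
  pl_fun X s -> pl_map X (fun x => s x *: d).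
Proof.
by move=> /(pl_linear d 0); apply: pl_ext => x _; rewrite addr0 mul_scalar_mx.
Qed.

Lemma pl_fun_affine N (X : set 'rV[R]_N) s (a b : R) :
  pl_fun X s -> pl_fun X (fun x => a * s x + b).
Proof.
move=> /(pl_scale a b%:M); apply: pl_ext => x _.
by rewrite scale_scalar_mx -raddfD.
Qed.

Lemma polyhedronT N : polyhedron [set: 'rV[R]_N].
Proof. by apply: polyhedron_open; exact: openT. Qed.

Lemma pl_abs N (X : set 'rV[R]_N) s : pl_fun X s -> pl_fun X (fun x => `|s x|).
Proof.
have plabs : pl_map setT (fun v : 'rV[R]_1 => `|v 0 0|%:M : 'rV[R]_1).
  apply: pl_mapI => a _; exists bool, (fun b : bool =>
    if b then [set v : 'rV[R]_1 | v 0 0 <= 0] else [set v | 0 <= v 0 0]).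
  split=> [[]||b]; [exact: convex_polyhedron_coord_le|exact: convex_polyhedron_coord_ge| |].
    apply: near_true => x; split=> // _.
    by have [h|/ltW h] := leP (x 0 0) 0; [exists true|exists false].
  exists (if b then - 1 else 1)%:M, 0; apply: near_true => x hb.
  rewrite addr0 mul_mx_scalar [in RHS](mx11_scalar x) scale_scalar_mx; congr (_%:M).
  by case: b hb => /= hb; [rewrite mulN1r ler0_norm|rewrite mul1r ger0_norm].
move=> pls; have := pl_comp_sub (fun _ _ => I) pls plabs.
by apply: pl_ext => x _ /=; rewrite mxE eqxx mulr1n.
Qed.

Lemma open_height N (B : set R) : open B -> open [set w : 'rV[R]_(1 + N) | B (height w)].
Proof.
move=> oB; rewrite openE => w /= Bw; rewrite /interior.
have : nbhs (height w) B by apply: open_nbhs_nbhs.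
move=> /nbhs_ballP[e /= e0 eB]; apply/near_ball; exists e => // x xe.
apply: eB; rewrite -ball_normE /=; apply: le_lt_trans xe.
by rewrite -heightB; exact: height_norm.
Qed.

Lemma open_height_ball N (t e : R) :
  open [set w : 'rV[R]_(1 + N) | `|height w - t| < e].
Proof.
have := @open_height N (ball t e) (ball_open _ _).
by congr open; apply/seteqP; split=> w /=; rewrite -ball_normE /= distrC.
Qed.

End PLclosure.

(** * Open cones *)

Section Cones.
Variable R : realType.
Implicit Types N M : nat.

Lemma coneE N (X : set 'rV[R]_N) c :
  cone X c <-> c = 0 \/ 0 < height c < 1 /\ X ((height c)^-1 *: rsubmx c).
Proof.
split=> [[->|[t [x [/andP[t0 t1] Xx ->]]]]|[->|[/andP[t0 t1] Xc]]]; [by left| |by left|right].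
  rewrite height_row row_mxKr; move: t0; rewrite le_eqVlt => /orP[/eqP<-|t0].
    by left; rewrite scale0r raddf0 row_mx0.
  by right; rewrite t0 t1 scalerK ?gt_eqF.
exists (height c), ((height c)^-1 *: rsubmx c); split=> //; first by rewrite ltW.
by rewrite scalerKV ?gt_eqF // row_height.
Qed.

Lemma height0 N : height (0 : 'rV[R]_(1 + N)) = 0.
Proof. by rewrite heightE mxE. Qed.

Lemma heightZ N a (c : 'rV[R]_(1 + N)) : height (a *: c) = a * height c.
Proof. by rewrite !heightE mxE. Qed.

Lemma cone_height N (X : set 'rV[R]_N) c : cone X c -> 0 <= height c < 1.
Proof. by move=> /coneE[->|[/andP[/ltW-> ->]]] //; rewrite height0 lexx ltr01. Qed.

Lemma cone_scale N (X : set 'rV[R]_N) c a :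
  cone X c -> 0 <= a -> a * height c < 1 -> cone X (a *: c).
Proof.
rewrite le_eqVlt => + /orP[/eqP<-|a0] h1; first by move=> _; rewrite scale0r; left.
move=> /coneE[->|[/andP[c0 c1] Xc]]; first by rewrite scaler0; left.
apply/coneE; right; rewrite heightZ h1 mulr_gt0 //=; split=> //.
rewrite linearZ /= scalerA invfM mulrAC mulVf ?mul1r ?gt_eqF //.
Qed.

Lemma cone_sub N (X Y : set 'rV[R]_N) : X `<=` Y -> cone X `<=` cone Y.
Proof. by move=> XY c /coneE[->|[h /XY Yc]]; [left|apply/coneE; right]. Qed.

Lemma cone0 N c : cone (set0 : set 'rV[R]_N) c -> c = 0.
Proof. by move=> /coneE[//|[_ []]]. Qed.

Lemma susp_sub N (X Y : set 'rV[R]_N) : X `<=` Y -> susp X `<=` susp Y.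
Proof.
by move=> XY w; rewrite !suspE => -[h|[h /XY Yw]]; [left|right].
Qed.

Lemma cone_bounded N (L : set 'rV[R]_N) : compact L ->
  exists2 K : R, 1 <= K & forall c, cone L c -> `|c| < K.
Proof.
move=> cL; have [K0 [K0r bK]] := compact_bounded cL.
pose K := Num.max K0 0 + 1.
have K0K : K0 < K by rewrite ltr_pwDr // le_max lexx.
have K1 : 0 <= K - 1 by rewrite addrK le_max lexx orbT.
exists (K + 1); first by rewrite lerDr; lra.
move=> c [->|[t [x [/andP[t0 t1] Lx ->]]]]; first by rewrite normr0; lra.
apply: norm_ltP => [|j]; first by lra.
case: (split_ordP j) => k ->.
  by rewrite row_mxEl ord1 mxE eqxx mulr1n ger0_norm //; lra.
rewrite row_mxEr mxE normrM ger0_norm //.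
have := bK _ K0K x Lx => /= xK; have := norm_coord_le x k => xk.
apply: (@le_lt_trans _ _ (1 * K)); last by lra.
apply: ler_pM => //; first exact: ltW.
exact: le_trans xk xK.
Qed.

(** Around the pole of height s = 1 or s = -1 the suspension is the cone turned
    upside down. *)
Definition to_pole N (s : R) (c : 'rV[R]_(1 + N)) : 'rV[R]_(1 + N) :=
  row_mx (s * (1 - height c))%:M (rsubmx c).

Lemma to_poleK N (s : R) : s * s = 1 -> forall c : 'rV[R]_(1 + N),
  row_mx (1 - s * height (to_pole s c))%:M (rsubmx (to_pole s c)) = c.
Proof.
move=> ss c; rewrite height_row row_mxKr mulrA ss mul1r opprB addrCA subrr addr0.
exact: row_height.
Qed.

Lemma cone_susp N (A : set 'rV[R]_N) (s : R) c : s * s = 1 ->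
  cone A c <-> susp A (to_pole s c) /\ `|height (to_pole s c) - s| < 1.
Proof.
move=> ss; have s1 : `|s| = 1.
  by apply/eqP; rewrite -sqrp_eq1 // -normrX expr2 ss normr1.
rewrite suspE height_row row_mxKr normrM s1 mul1r.
have -> : s * (1 - height c) - s = - (s * height c) by ring.
rewrite normrN normrM s1 mul1r; split.
  move=> /[dup] /cone_height/andP[c0 c1].
  rewrite (ger0_norm c0) ger0_norm ?subr_ge0 ?ltW // => /coneE[->|[/andP[h0 h1] Ac]].
    by rewrite height0 subr0; split => //; left; rewrite linear0.
  by split=> //; right; rewrite opprB addrCA subrr addr0 ltrBlDr ltrDl.
move=> [+ c1]; have c1' : height c < 1 by apply: le_lt_trans c1; exact: ler_norm.
rewrite ger0_norm ?subr_ge0 ?ltW // => -[[/eqP h1 c0]|[h1 Ac]]; apply/coneE.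
  left; rewrite -[c]row_height c0; move: h1; rewrite -subr_eq0 addrAC subrr add0r oppr_eq0.
  by move=> /eqP->; rewrite raddf0 row_mx0.
right; move: h1 Ac; rewrite opprB addrCA subrr addr0 ltrBlDr ltrDl => h1 Ac.
by rewrite h1 c1'.
Qed.

End Cones.

(** * Charts of a suspension away from the poles *)

Section SuspensionChart.
Variable R : realType.
Implicit Types N M : nat.

(** A bounded model of R^i x cL: charts of a suspension are first defined on
    bounded neighbourhoods, where charts of the given space are homogeneous. *)
Definition box_cone i M (L : set 'rV[R]_M) : set 'rV[R]_(i + (1 + M)) :=
  [set u | (forall k, `|lsubmx u 0 k| < 1) /\ cone L (rsubmx u)].

Definition slab i M (L : set 'rV[R]_M) (t0 e : R) : set 'rV[R]_(1 + (i + (1 + M))) :=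
  [set w | `|height w - t0| < e /\ box_cone L (rsubmx w)].

Lemma polyhedron_box_cone i M (L : set 'rV[R]_M) :
  polyhedron (prod_space [set: 'rV[R]_i] (cone L)) -> polyhedron (box_cone (i := i) L).
Proof.
move=> pD.
have pl1 : pl_map setT (fun u : 'rV[R]_(i + (1 + M)) => lsubmx u).
  by apply: pl_lsubmx; apply: pl_id; exact: polyhedronT.
have := polyhedronI (polyhedron_preimage pl1 (polyhedron_open (open_cube (n := i)))) pD.
congr polyhedron; apply/seteqP; split=> u /=; first by move=> [[_ h1] [_ h2]].
by move=> [h1 h2].
Qed.

(** The first i + 1 coordinates are shrunk one by one. The cone coordinate is
    preserved, and with it the skeleta, which are cones on skeleta of L. *)
Lemma slab_chart i M (L : set 'rV[R]_M) (t0 e : R) : 0 < e ->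
  polyhedron (prod_space [set: 'rV[R]_i] (cone L)) ->
  exists a b, pl_homeo_via (prod_space [set: 'rV[R]_i.+1] (cone L)) (slab (i := i) L t0 e) a b /\
    forall z, rsubmx (rsubmx (a z)) = rsubmx z.
Proof.
move=> e0 pD.
pose D1 : set 'rV[R]_((1 + i) + (1 + M)) := prod_space setT (cone L).
pose sh (z : 'rV[R]_((1 + i) + (1 + M))) : 'rV[R]_(1 + i) := shrink_mx (lsubmx z).
pose a z : 'rV[R]_(1 + (i + (1 + M))) :=
  row_mx (e * height (sh z) + t0)%:M (row_mx (rsubmx (sh z)) (rsubmx z)).
pose st (w : 'rV[R]_(1 + (i + (1 + M)))) : 'rV[R]_(1 + i) :=
  row_mx (e^-1 * height w + - (e^-1 * t0))%:M (lsubmx (rsubmx w)).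
pose b w : 'rV[R]_((1 + i) + (1 + M)) :=
  row_mx (stretch_mx (st w)) (rsubmx (rsubmx w)).
exists a, b; split; last by move=> z; rewrite !row_mxKr.
have plid N' : pl_map setT (@id 'rV[R]_N') by apply: pl_id; exact: polyhedronT.
have pD1 : polyhedron D1.
  have pl1 : pl_map setT (fun z : 'rV[R]_((1 + i) + (1 + M)) =>
      row_mx (0 : 'rV[R]_i) (rsubmx z)).
    by apply: pl_row_mx; [apply: pl_cst; exact: polyhedronT|apply: pl_rsubmx].
  have := polyhedron_preimage pl1 pD; congr polyhedron.
  apply/seteqP; split=> z /=; rewrite /prod_space /= row_mxKr; first by move=> [_ [_ h]].
  by move=> [_ h].
have pS : polyhedron (slab (i := i) L t0 e).
  have pl1 : pl_map setT (fun w : 'rV[R]_(1 + (i + (1 + M))) => rsubmx w).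
    exact: pl_rsubmx.
  have := polyhedronI (polyhedron_preimage pl1 (polyhedron_box_cone pD))
    (polyhedron_open (@open_height_ball R (i + (1 + M)) t0 e)).
  congr polyhedron; apply/seteqP; split=> w /=; first by move=> [[_ h] h'].
  by move=> [h h'].
have idD1 := pl_id pD1; have idS := pl_id pS.
have stE w : e^-1 * height w + - (e^-1 * t0) = e^-1 * (height w - t0) by rewrite mulrBr.
have st1 w : `|height w - t0| < e -> `|e^-1 * height w + - (e^-1 * t0)| < 1.
  by move=> h; rewrite stE normrM gtr0_norm ?invr_gt0 // ltr_pdivrMl // mulr1.
have stc w : slab L t0 e w -> forall k, `|st w 0 k| < 1.
  move=> [h1 [h2 _]] k; case: (split_ordP k) => j ->; rewrite ?row_mxEl ?row_mxEr //.
  by rewrite ord1 mxE eqxx mulr1n; exact: st1.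
split.
- have pl1 : pl_map D1 (fun z : 'rV[R]_((1 + i) + (1 + M)) => lsubmx z).
    exact: pl_lsubmx.
  have plsh : pl_map D1 sh := pl_comp_sub (fun _ _ => I) pl1 (@pl_shrink R (1 + i)).
  apply: pl_row_mx; first by apply: pl_fun_affine; exact: pl_height.
  by apply: pl_row_mx; exact: pl_rsubmx.
- apply: pl_row_mx; last by apply: pl_rsubmx; exact: pl_rsubmx.
  apply: (pl_comp_sub (Y := [set v : 'rV[R]_(1 + i) | forall k, `|v 0 k| < 1])
    (f := st) (g := @stretch_mx R _)) _ (@pl_stretch R (1 + i)) => //.
  apply: pl_row_mx; first by apply: pl_fun_affine; exact: pl_height.
  by apply: pl_lsubmx; exact: pl_rsubmx.
- move=> z [_ cz]; have [s1 sK] := shrink_mxK (lsubmx z : 'rV[R]_(1 + i)).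
  split.
    rewrite /slab /box_cone /= /a height_row !row_mxKr row_mxKl; split.
      rewrite addrK normrM gtr0_norm // gtr_pMr //.
      by rewrite heightE; exact: s1.
    by split=> // k; rewrite mxE; exact: s1.
  rewrite /b /st /a height_row !row_mxKr row_mxKl.
  rewrite mulrDr mulKf ?gt_eqF // addrK row_height.
  by rewrite /sh sK hsubmxK.
- move=> w sw; split; first by split=> //=; rewrite /b row_mxKr; have [_ []] := sw.
  rewrite /a /sh /b row_mxKl row_mxKr stretch_mxK; last exact: stc.
  rewrite /st height_row row_mxKr stE mulrA mulfV ?gt_eqF // mul1r subrK.
  by rewrite hsubmxK row_height.
Qed.

(** Let f be a chart with f z0 = x0. The chart at the point of height t0 over x0
    is (t, u) |-> (t, f (z0 + e u) - `|t| x0) for t near t0 and u in the bounded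
    model. By pl_germ, with s = 1 - `|t|,
      f (z0 + e u) - `|t| x0 = s f (z0 + (e / s) u),
    so that its values are in the suspension, and in the suspension of a skeleton
    exactly when the cone coordinate of u is in the cone on the corresponding
    skeleton of L. It is PL, as is its inverse
    (t, y) |-> (t, (g (y + `|t| x0) - z0) / e). *)
Lemma susp_chart i N M (X U : set 'rV[R]_N) (L : set 'rV[R]_M)
    (f : 'rV[R]_(i + (1 + M)) -> 'rV[R]_N) (g : 'rV[R]_N -> 'rV[R]_(i + (1 + M)))
    (v0 : 'rV[R]_i) (t0 : R) (x0 := f (row_mx v0 0)) :
  `|t0| < 1 -> compact L -> U `<=` X -> (\forall x \near x0, X x -> U x) ->
  pl_homeo_via (prod_space [set: 'rV[R]_i] (cone L)) U f g ->
  exists (V : set 'rV[R]_(1 + N)) f' g',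
    [/\ V `<=` susp X,
        \forall w \near (row_mx t0%:M ((1 - `|t0|) *: x0)), susp X w -> V w,
        pl_homeo_via (prod_space [set: 'rV[R]_i.+1] (cone L)) V f' g'
      & forall (A : set 'rV[R]_N) (B : set 'rV[R]_M), B `<=` L ->
        f @` prod_space [set: 'rV[R]_i] (cone B) = A `&` U ->
        f' @` prod_space [set: 'rV[R]_i.+1] (cone B) = susp A `&` V].
Proof.
move=> t01 cL UX nU Hfg; have [plf plg fK gK] := Hfg.
set D := prod_space _ _ in Hfg plf fK gK.
set z0 : 'rV[R]_(i + (1 + M)) := row_mx v0 0 in x0 nU *.
have Dz0 : D z0 by split=> //=; rewrite row_mxKr; left.
have pD : polyhedron D := polyhedron_pl plf.
have [Ux0 gx0] : U x0 /\ g x0 = z0 := fK _ Dz0.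
have [rho rho0 Hg] := pl_germ plf Dz0; rewrite -/x0 in Hg.
have [K K1 bK] := cone_bounded cL.
have K0 : 0 < K by apply: lt_le_trans K1.
pose s0 : R := (1 - `|t0|) / 2.
have s00 : 0 < s0 by rewrite divr_gt0 // subr_gt0.
have s02 : s0 + s0 = 1 - `|t0| by rewrite /s0; field.
(* heights within e of t0 stay at distance s0 from the poles, and z0 + (e / s) u
   stays in the domain of homogeneity of f for all s >= s0 *)
pose e : R := Num.min s0 (rho * s0 / (2 * K)).
have rs : 0 < rho * s0 by rewrite mulr_gt0.
have k2 : 0 < 2 * K by rewrite mulr_gt0.
have e0 : 0 < e by rewrite lt_min s00 divr_gt0.
have es0 : e <= s0 by rewrite ge_min lexx.
have e1 : e <= 1 by have := normr_ge0 t0; lra.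
have eK : e / s0 * K < rho.
  rewrite mulrAC ltr_pdivrMr //.
  have : e <= rho * s0 / (2 * K) by rewrite ge_min lexx orbT.
  rewrite ler_pdivlMr // => h.
  by have : 0 < e * K by [rewrite mulr_gt0]; lra.
have ht t : `|t - t0| < e -> s0 <= 1 - `|t|.
  move=> h; have : `|t| <= `|t - t0| + `|t0|.
    by rewrite -{1}(subrK t0 t); exact: ler_normD.
  by move: h es0 s02; lra.
have nu (u : 'rV[R]_(i + (1 + M))) : box_cone L u -> `|u| < K.
  move=> [u1 u2]; apply: norm_ltP => // k; case: (split_ordP k) => j ->.
    by apply: lt_le_trans K1; have := u1 j; rewrite mxE.
  have := norm_coord_le (rsubmx u) j; rewrite mxE => h.
  exact: le_lt_trans h (bK _ u2).
have Dz (u : 'rV[R]_(i + (1 + M))) r : box_cone L u -> 0 <= r -> r <= 1 -> D (z0 + r *: u).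
  move=> [_ cu] r0 r1; split=> //=.
  rewrite linearD /= row_mxKr add0r linearZ /=; apply: cone_scale => //.
  have /andP[h0 h1] := cone_height cu.
  by apply: le_lt_trans h1; rewrite ler_piMl.
have key t (u : 'rV[R]_(i + (1 + M))) (s := 1 - `|t|) : `|t - t0| < e -> box_cone L u ->
    D (z0 + (e / s) *: u) /\ f (z0 + e *: u) = x0 + s *: (f (z0 + (e / s) *: u) - x0).
  move=> te ub; have ss := ht _ te; have sp : 0 < s by apply: lt_le_trans ss.
  have r0 : 0 <= e / s by rewrite divr_ge0 // ltW.
  have r1 : e / s <= 1 by rewrite ler_pdivrMr // mul1r (le_trans es0).
  have Dz' := Dz u _ ub r0 r1; split=> //.
  have near' : `|z0 - (z0 + (e / s) *: u)| < rho.
    rewrite opprD addrA subrr sub0r normrN normrZ (ger0_norm r0).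
    apply: le_lt_trans eK; apply: ler_pM => //; last by rewrite ltW // nu.
    by rewrite ler_pM2l // lef_pV2.
  have s01 : 0 <= s <= 1 by rewrite ltW //= lerBlDr lerDl.
  have [_ <-] := Hg _ s Dz' near' s01; congr f.
  by rewrite addrAC subrr add0r scalerA mulrCA mulfV ?mulr1 // gt_eqF.
pose theta (w : 'rV[R]_(1 + (i + (1 + M)))) : 'rV[R]_(1 + N) :=
  row_mx (height w)%:M (f (z0 + e *: rsubmx w) - `|height w| *: x0).
pose kap (w : 'rV[R]_(1 + N)) := rsubmx w + `|height w| *: x0.
pose q w := e^-1 *: g (kap w) + - (e^-1 *: z0).
have qE w : q w = e^-1 *: (g (kap w) - z0) by rewrite scalerBr.
pose V : set 'rV[R]_(1 + N) := [set w | [/\ `|height w - t0| < e, U (kap w) & box_cone L (q w)]].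
pose xi w : 'rV[R]_(1 + (i + (1 + M))) := row_mx (height w)%:M (q w).
have plid N' : pl_map setT (@id 'rV[R]_N') by apply: pl_id; exact: polyhedronT.
have plk : pl_map setT kap.
  apply: plD; first exact: pl_rsubmx.
  by apply: pl_fun_scale; apply: pl_abs; exact: pl_height.
have plgk : pl_map (setT `&` kap @^-1` U) (g \o kap) := pl_comp plk plg.
have plq : pl_map (setT `&` kap @^-1` U) q := pl_scale e^-1 (- (e^-1 *: z0)) plgk.
have VE : V = ((setT `&` kap @^-1` U) `&` q @^-1` (box_cone L)) `&`
    [set w | `|height w - t0| < e].
  by apply/seteqP; split=> w /=; [move=> []|move=> [[[_ h1] h2] h3]].
have pV : polyhedron V.
  rewrite VE; apply: polyhedronI; last by apply: polyhedron_open; exact: open_height_ball.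
  exact: polyhedron_preimage plq (polyhedron_box_cone pD).
have Ds (w : 'rV[R]_(1 + (i + (1 + M)))) : slab L t0 e w -> D (z0 + e *: rsubmx w).
  by move=> [_ w2]; apply: Dz => //; exact: ltW.
have thetaK w : slab L t0 e w -> V (theta w) /\ xi (theta w) = w.
  move=> sw; have [w1 w2] := sw; have Dw := Ds w sw.
  have [Uf gf] := fK _ Dw.
  have kt : kap (theta w) = f (z0 + e *: rsubmx w).
    by rewrite /kap /theta height_row row_mxKr subrK.
  have qt : q (theta w) = rsubmx w.
    by rewrite qE kt gf addrAC subrr add0r scalerK // gt_eqF.
  split; last by rewrite /xi qt /theta height_row row_height.
  by rewrite /V /= kt qt /theta height_row.
have xiK w : V w -> slab L t0 e (xi w) /\ theta (xi w) = w.
  move=> [w1 w2 w3]; split; first by rewrite /slab /= height_row row_mxKr.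
  rewrite /theta /xi height_row row_mxKr qE scalerA mulfV ?gt_eqF // scale1r.
  rewrite addrCA subrr addr0; have [_ ->] := gK _ w2.
  by rewrite /kap addrK row_height.
have [a [b [Hab abr]]] := slab_chart t0 e0 pD; have [_ _ aK bK'] := Hab.
have pS := polyhedron_pl (let: And4 _ h _ _ := Hab in h).
have Hth : pl_homeo_via (slab L t0 e) V theta xi.
  have idS := pl_id pS; split=> //.
    apply: pl_row_mx; first exact: pl_height.
    apply: plD; last first.
      have := pl_fun_scale (- x0) (pl_abs (pl_height idS)).
      by apply: pl_ext => w _; rewrite scalerN.
    apply: (pl_comp_sub (Y := D) (f := fun w => z0 + e *: rsubmx w)) plf.
      exact: Ds.
    have := pl_scale e z0 (pl_rsubmx idS).
    by apply: pl_ext => w _; rewrite addrC.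
  apply: pl_row_mx; first by apply: pl_height; exact: pl_id.
  by apply: pl_restrict plq => // w [].
(* membership in a skeleton is read off the cone coordinate *)
have suspA (A : set 'rV[R]_N) (B : set 'rV[R]_M) w : B `<=` L ->
    f @` prod_space [set: 'rV[R]_i] (cone B) = A `&` U -> slab L t0 e w ->
    susp A (theta w) <-> cone B (rsubmx (rsubmx w)).
  move=> BL fB [w1 w2]; have [Dz' fz'] := key _ _ w1 w2.
  set s := 1 - `|height w| in Dz' fz'; have sp : 0 < s by apply: lt_le_trans (ht _ w1).
  have [Uf gf] := fK _ Dz'.
  have w1' : `|height w| < 1 by rewrite -subr_gt0.
  have inner : s^-1 *: (f (z0 + e *: rsubmx w) - `|height w| *: x0) =
      f (z0 + (e / s) *: rsubmx w).
    rewrite fz' addrAC -{1}[x0]scale1r -scalerBl -/s -scalerDr addrC subrK.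
    by rewrite scalerK // gt_eqF.
  rewrite suspE /theta height_row row_mxKr -/s inner; split.
    move=> [[h1 _]|[_ Af]]; first by rewrite h1 ltxx in w1'.
    have : (A `&` U) (f (z0 + (e / s) *: rsubmx w)) by [].
    rewrite -fB => -[y [_ cy] fy].
    have Dy : D y by split=> //; exact: cone_sub BL _ cy.
    have zy : z0 + (e / s) *: rsubmx w = y by rewrite -gf -fy; have [] := fK _ Dy.
    move: cy; rewrite -zy /= linearD /= row_mxKr add0r linearZ /= => cy.
    have es : s / e * (e / s) = 1 by rewrite mulrA mulfVK ?gt_eqF // mulfV ?gt_eqF.
    have -> : rsubmx (rsubmx w) = (s / e) *: ((e / s) *: rsubmx (rsubmx w)).
      by rewrite scalerA es scale1r.
    apply: cone_scale => //; first by rewrite divr_ge0 // ltW.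
    by rewrite heightZ mulrA es mul1r; have /andP[] := cone_height (proj2 w2).
  move=> cB; right; split=> //.
  suff : (A `&` U) (f (z0 + (e / s) *: rsubmx w)) by case.
  rewrite -fB; exists (z0 + (e / s) *: rsubmx w) => //; split=> //=.
  rewrite linearD /= row_mxKr add0r linearZ /=; apply: cone_scale => //.
    by rewrite divr_ge0 // ltW.
  have := cone_height (proj2 Dz'); rewrite linearD /= row_mxKr add0r linearZ /= heightZ.
  by move=> /andP[].
have thX w : slab L t0 e w -> susp X (theta w).
  move=> sw; have [w1 w2] := sw.
  have fD : f @` D = X `&` U.
    apply/seteqP; split=> [_ [y /fK[Uf _] <-]|y [_ /gK[Dg fg]]]; last by exists (g y).
    by split=> //; exact: UX.
  by apply/(suspA _ _ _ (fun _ h => h) fD sw); case: w2.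
exists V, (theta \o a), (b \o xi); split.
- by move=> w /xiK[sw <-]; exact: thX.
- have /near_ball[eta eta0 etaU] := nU.
  have [|d d0 Hd] := @pl_continuous _ _ _ _ _ _ (Num.min rho e) plg Ux0.
    by rewrite lt_min rho0.
  pose eta' := Num.min eta d.
  have eta'0 : 0 < eta' by rewrite lt_min eta0.
  have nx0 : 0 < 1 + `|x0| by rewrite ltr_pwDl.
  pose delta := Num.min e (eta' * s0 / (1 + `|x0|)).
  have delta0 : 0 < delta by rewrite lt_min e0 divr_gt0 // mulr_gt0.
  apply/near_ball; exists delta => // w wd.
  have hd := le_lt_trans (height_norm _) wd; have rd := le_lt_trans (rsubmx_norm _) wd.
  move: hd rd; rewrite heightB rsubmxB height_row row_mxKr => hd rd.
  have w1 : `|height w - t0| < e.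
    by rewrite distrC; apply: lt_le_trans hd _; rewrite ge_min lexx.
  set s := 1 - `|height w|; have ss : s0 <= s := ht _ w1.
  have sp : 0 < s by apply: lt_le_trans ss.
  have s1 : s <= 1 by rewrite lerBlDr lerDl.
  move=> /suspE[[h1 _]|[_]]; first by move: sp; rewrite /s h1 subrr ltxx.
  rewrite -/s; set x := s^-1 *: rsubmx w => Xx.
  have yx : rsubmx w = s *: x by rewrite scalerKV // gt_eqF.
  have xe : `|x0 - x| < eta'.
    have -> : x0 - x = s^-1 *: ((1 - `|t0|) *: x0 - rsubmx w +
        (`|t0| - `|height w|) *: x0).
      rewrite addrAC -scalerDl yx scalerDr scalerN scalerA scalerK ?gt_eqF //.
      by rewrite addrA subrK mulVf ?gt_eqF // scale1r.
    rewrite normrZ ger0_norm ?invr_ge0 ?ltW // mulrC ltr_pdivrMr //.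
    apply: (@lt_le_trans _ _ (delta * (1 + `|x0|))).
      rewrite mulrDr mulr1; apply: le_lt_trans (ler_normD _ _) _.
      apply: ltr_leD => //; rewrite normrZ; apply: ler_wpM2r => //.
      by apply: le_trans (ltW hd); exact: ler_dist_dist.
    apply: (@le_trans _ _ (eta' * s0)); last by rewrite ler_pM2l.
    by rewrite -ler_pdivlMr // ge_min lexx orbT.
  have Ux : U x by apply: etaU => //; apply: lt_le_trans xe _; rewrite ge_min lexx.
  have [Dg fg] := gK _ Ux.
  have : `|g x0 - g x| < Num.min rho e.
    by apply: Hd => //; apply: lt_le_trans xe _; rewrite ge_min lexx orbT.
  rewrite gx0 lt_min => /andP[zr ze].
  have s01 : 0 <= s <= 1 by rewrite ltW.
  have [Dp fp] := Hg _ s Dg zr s01.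
  have kw : kap w = f (z0 + s *: (g x - z0)).
    rewrite fp fg /kap yx scalerBr addrCA; congr (_ + _).
    by rewrite -{2}[x0]scale1r -scalerBl /s opprB addrCA subrr addr0.
  have [Up gp] := fK _ Dp.
  have qw : q w = (s / e) *: (g x - z0).
    by rewrite qE kw gp addrAC subrr add0r scalerA mulrC.
  have ze' : `|g x - z0| < e by rewrite distrC.
  have se : s / e * e <= 1 by rewrite mulfVK ?gt_eqF.
  have se0 : 0 < s / e by rewrite divr_gt0.
  split=> //; first by rewrite kw.
  rewrite qw; split=> [k|].
    rewrite linearZ /= mxE normrM gtr0_norm //; apply: lt_le_trans se.
    rewrite ltr_pM2l //; apply: le_lt_trans ze'; rewrite mxE; exact: norm_coord_le.
  have -> : rsubmx ((s / e) *: (g x - z0)) = (s / e) *: rsubmx (g x).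
    by rewrite linearZ /= linearB /= row_mxKr subr0.
  apply: cone_scale; [by case: Dg|exact: ltW|].
  apply: lt_le_trans se; rewrite ltr_pM2l //; apply: le_lt_trans ze'.
  apply: le_trans (ler_norm _) _; have -> : rsubmx (g x) = rsubmx (g x - z0).
    by rewrite linearB /= row_mxKr subr0.
  exact: le_trans (height_norm _) (rsubmx_norm _).
- exact: pl_homeo_via_trans Hab Hth.
move=> A B BL fB; apply/seteqP; split=> [_ [z [_ cz] <-]|w [Aw Vw]].
  have [sa _] := aK z (conj I (cone_sub BL cz)).
  have [Vt _] := thetaK _ sa; split=> //=.
  by apply/(suspA _ _ _ BL fB sa); rewrite abr.
have [sx tx] := xiK _ Vw; have [Pb ab] := bK' _ sx.
exists (b (xi w)) => /=; last by rewrite ab tx.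
split=> //=; rewrite -abr ab; apply/(suspA _ _ _ BL fB sx).
by rewrite tx.
Qed.

End SuspensionChart.

(** * Suspensions of stratified pseudomanifolds *)

Section SuspensionPM.
Variable R : realType.
Implicit Types N M : nat.

Lemma norm_row_lt N (a e : R) (y : 'rV[R]_N) :
  `|a| < e -> `|y| < e -> `|row_mx a%:M y| < e.
Proof.
move=> ae ye; apply: norm_ltP => [|k]; first exact: le_lt_trans ae.
case: (split_ordP k) => j ->; first by rewrite row_mxEl ord1 mxE eqxx mulr1n.
by rewrite row_mxEr; apply: le_lt_trans ye; exact: norm_coord_le.
Qed.

Lemma compact_skeleton n N (X : set 'rV[R]_N) F i :
  compact X -> filtered n X F -> compact (F i).
Proof.
move=> cX [_ _ _ FX]; have [FsX _ cF] := FX i.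
have clX : closed X by apply: compact_closed cX; exact: norm_hausdorff.
apply: (subclosed_compact _ cX FsX) => x cx; apply: cF; split=> //.
exact: clX (closure_subset FsX cx).
Qed.

Lemma compact_closure_sub N (X A : set 'rV[R]_N) : compact A -> X `&` closure A `<=` A.
Proof.
move=> cA x [_ cx]; have : closed A by apply: compact_closed cA; exact: norm_hausdorff.
exact.
Qed.

(** The link of a pole is the space itself. *)
Lemma pole_chart N (X : set 'rV[R]_N) (s : R) : s * s = 1 -> compact X -> polyhedron X ->
  exists f g, pl_homeo_via (prod_space [set: 'rV[R]_0] (cone X))
      (susp X `&` [set w | `|height w - s| < 1]) f g /\
    forall A, A `<=` X -> f @` prod_space [set: 'rV[R]_0] (cone A) =
      susp A `&` (susp X `&` [set w | `|height w - s| < 1]).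
Proof.
move=> ss cX pX.
pose f (z : 'rV[R]_(0 + (1 + N))) := to_pole s (rsubmx z).
pose g (w : 'rV[R]_(1 + N)) : 'rV[R]_(0 + (1 + N)) :=
  row_mx 0 (row_mx (1 - s * height w)%:M (rsubmx w)).
have gK z : g (f z) = z.
  rewrite /g /f to_poleK // -[in RHS](hsubmxK z); congr row_mx.
  by apply/rowP => -[].
have fK w : f (g w) = w.
  rewrite /f /g row_mxKr /to_pole height_row row_mxKr opprB addrCA subrr addr0.
  by rewrite mulrA ss mul1r row_height.
have plid N' : pl_map setT (@id 'rV[R]_N') by apply: pl_id; exact: polyhedronT.
have plf : pl_map setT f.
  apply: pl_row_mx; last by apply: pl_rsubmx; apply: pl_rsubmx.
  have := pl_fun_affine (- s) s (pl_height (pl_rsubmx (plid (0 + (1 + N))%N))).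
  by apply: pl_ext => z _; congr (_%:M); ring.
have plg : pl_map setT g.
  apply: pl_row_mx; first by apply: pl_cst; exact: polyhedronT.
  apply: pl_row_mx; last exact: pl_rsubmx.
  have := pl_fun_affine (- s) 1 (pl_height (plid (1 + N)%N)).
  by apply: pl_ext => z _; congr (_%:M); ring.
have pV : polyhedron (susp X `&` [set w | `|height w - s| < 1]).
  apply: polyhedronI; first exact: polyhedron_susp.
  by apply: polyhedron_open; exact: open_height_ball.
have fP A z : prod_space [set: 'rV[R]_0] (cone A) z <->
    (susp A `&` [set w | `|height w - s| < 1]) (f z).
  rewrite /= -cone_susp //; split; first by case.
  by move=> cz; split.
have pD : polyhedron (prod_space [set: 'rV[R]_0] (cone X)).
  have := polyhedron_preimage plf pV; congr polyhedron.
  by apply/seteqP; split=> z; [move=> [_ /fP]|move=> /fP].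
exists f, g; split.
  split.
  - exact: pl_restrict plf.
  - exact: pl_restrict plg.
  - by move=> z /fP.
  - by move=> w Vw; split; [apply/fP; rewrite fK|].
move=> A AX; apply/seteqP; split=> [_ [z /fP[Az hz] <-]|w [Aw [_ hw]]].
  by split=> //; split=> //; exact: susp_sub Az.
by exists (g w); rewrite ?fK //; apply/fP; rewrite fK.
Qed.

(** The skeleta of negative index stay empty, although the suspension of the
    empty set does not: the poles form the 0-skeleton. *)
Definition susp_skeleton N (F : int -> set 'rV[R]_N) (i : int) : set 'rV[R]_(1 + N) :=
  if i < 0 then set0 else susp (F (i - 1)).

Lemma susp_skeletonE N (F : int -> set 'rV[R]_N) i :
  0 <= i -> susp_skeleton F i = susp (F (i - 1)).
Proof. by rewrite /susp_skeleton; case: ltP. Qed.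

Lemma filtered_susp n N (X : set 'rV[R]_N) F : 0 < n -> compact X ->
  filtered n X F -> filtered (n + 1) (susp X) (susp_skeleton F).
Proof.
move=> n0 cX fX; have [pX [Fn F0] Fle FX] := fX; split.
- exact: polyhedron_susp.
- split; first by rewrite susp_skeletonE ?addrK ?Fn //; lia.
  by move=> i i0; rewrite /susp_skeleton i0.
- move=> i j ij; rewrite /susp_skeleton; case: ltP => i0; first by move=> x [].
  have -> : j < 0 = false by apply/negP/negP; rewrite -leNgt; lia.
  by apply: susp_sub; apply: Fle; lia.
- move=> i; rewrite /susp_skeleton; case: ltP => i0.
    by rewrite closure0 setI0; split=> // x [].
  have [FsX pF _] := FX (i - 1); have cF := compact_skeleton (i := i - 1) cX fX.
  split; [exact: susp_sub|exact: polyhedron_susp|].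
  by apply: compact_closure_sub; exact: compact_susp.
Qed.

(** A pole is the limit of points over a fixed point of the dense part of X; this
    is where X must be nonempty. *)
Lemma dense_susp N (X A : set 'rV[R]_N) : X !=set0 ->
  X `<=` closure (X `\` A) -> susp X `<=` closure (susp X `\` susp A).
Proof.
move=> [x1 Xx1] dX w Xw; apply/closureP => e e0.
have row_diff a (y z : 'rV[R]_N) : `|height w - a| < e -> `|rsubmx w - z| < e ->
    `|w - row_mx a%:M z| < e.
  by move=> h1 h2; rewrite -[w]row_height opp_row_mx add_row_mx -raddfB /=; exact: norm_row_lt.
have memE a (x : 'rV[R]_N) (B : set 'rV[R]_N) : `|a| < 1 ->
    susp B (row_mx a%:M ((1 - `|a|) *: x)) <-> B x.
  move=> a1; rewrite suspE height_row row_mxKr scalerK; last by rewrite subr_eq0 gt_eqF.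
  split=> [[[h _]|[]]|Bx] //; first by rewrite h ltxx in a1.
  by right.
have [x [Xx nAx]] : exists x, X x /\ ~ A x.
  have /closureP/(_ 1 ltr01)[x [Xx Ax] _] := dX _ Xx1; by exists x.
move/suspE: Xw => [[h1 y0]|[h1 Xy]].
  have nx : 0 < 1 + `|x| by rewrite ltr_pwDl.
  pose d := Num.min 2^-1 (e / 2 / (1 + `|x|)).
  have d0 : 0 < d by rewrite lt_min invr_gt0 ltr0n /= !divr_gt0.
  have d1 : d <= 2^-1 by rewrite ge_min lexx.
  have de : d * (1 + `|x|) <= e / 2 by rewrite -ler_pdivlMr // ge_min lexx orbT.
  have dx : 0 <= d * `|x| by rewrite mulr_ge0 // ltW.
  have ha : `|height w * (1 - d)| = 1 - d.
    by rewrite normrM h1 mul1r ger0_norm //; lra.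
  exists (row_mx (height w * (1 - d))%:M ((1 - `|height w * (1 - d)|) *: x)).
    by split; rewrite /= memE // ha; lra.
  apply: row_diff => //; rewrite ?y0.
    have -> : height w - height w * (1 - d) = height w * d by ring.
    by rewrite normrM h1 mul1r gtr0_norm //; lra.
  by rewrite ha sub0r normrN opprB addrCA subrr addr0 normrZ gtr0_norm //; lra.
set y := _ *: _ in Xy.
have /closureP/(_ e e0)[x' [Xx' Ax'] xe] := dX _ Xy.
exists (row_mx (height w)%:M ((1 - `|height w|) *: x')).
  by split; rewrite /= memE.
have hp : 0 < 1 - `|height w| by rewrite subr_gt0.
apply: row_diff; rewrite ?subrr ?normr0 //.
have -> : rsubmx w = (1 - `|height w|) *: y by rewrite scalerKV // gt_eqF.
rewrite -scalerBr normrZ gtr0_norm //; apply: le_lt_trans xe.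
by rewrite ler_piMl // lerBlDr lerDl.
Qed.

(** The suspension of a compact stratified pseudomanifold of positive dimension
    is one, with links unchanged except at the poles. A point of the 0-skeleton
    is a pole, as skeleta of negative index are empty. *)
Theorem stratified_pm_susp n N (X : set 'rV[R]_N) F : 0 < n -> compact X -> X !=set0 ->
  stratified_pm n X F -> stratified_pm (n + 1) (susp X) (susp_skeleton F).
Proof.
move=> n0 cX X0 spX; have fX := stratified_pm_filtered spX.
have [pX [Fn F0] Fle FX] := fX.
case/stratified_pm_inv: (spX) => [[ne]|[ne]|[_ _ dX chX]]; try by rewrite ne in n0.
apply: spm_pos; first by lia.
- exact: filtered_susp.
- by rewrite addrK susp_skeletonE ?ltW //; exact: dense_susp.
move=> i w; rewrite susp_skeletonE // => Fw nFw.
have wP : (`|height w| = 1 /\ rsubmx w = 0) \/ (exists i', i = i'.+1) /\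
    `|height w| < 1 /\ F (i%:Z - 1) ((1 - `|height w|)^-1 *: rsubmx w).
  move/suspE: Fw => [h|[h1 Fx]]; first by left.
  right; split=> //; case: i Fx {nFw} => [|i'] Fx; last by exists i'.
  by rewrite F0 in Fx.
have pole_i : `|height w| = 1 /\ rsubmx w = 0 -> i = 0%N.
  move=> h; case: i nFw {Fw wP} => // i' []; rewrite susp_skeletonE; last by lia.
  by apply/suspE; left.
case: wP => [hw|[[i' ii'] [h1 Fx]]].
  have i0 := pole_i hw; have [h1 y0] := hw; subst i.
  have ss : height w * height w = 1 by rewrite -expr2 -real_normK ?num_real // h1 expr1n.
  have [f [g [Hfg skel]]] := pole_chart ss cX pX.
  exists (susp X `&` [set v | `|height v - height w| < 1]), N, X, F, f, g; split=> //.
  - split; first by move=> v [].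
    have : nbhs w [set v | `|height v - height w| < 1].
      apply: open_nbhs_nbhs; split; first exact: open_height_ball.
      by rewrite /= subrr normr0.
    by apply: filterS => v hv Xv.
  - by rewrite subr0 addrK.
  - move=> j; rewrite skel; last by have [] := FX (j%:Z - 1).
    by rewrite add0r susp_skeletonE.
subst i; set x := _ *: _ in Fx.
have e1 : i'.+1%:Z - 1 = i'%:Z by lia.
rewrite e1 in Fx nFw.
have nFx : ~ F (i'%:Z - 1) x.
  by move=> h; apply: nFw; rewrite susp_skeletonE //; apply/suspE; right.
have [U [M [L [G [f [g [[UX nU] [cL spL] Hfg skel]]]]]]] := chX i' x Fx nFx.
have [_ [_ G0] _ GL] := stratified_pm_filtered spL.
have Xx : X x by have [FsX _ _] := FX i'; exact: FsX.
have Ux : U x by exact: nbhs_singleton nU Xx.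
have [v0 xE] : exists v0 : 'rV[R]_i', x = f (row_mx v0 0).
  have : (F (i'%:Z + 0) `&` U) x by rewrite addr0.
  rewrite -(skel 0%N) sub0r G0 // => -[z [_ /cone0 z0] <-].
  by exists (lsubmx z); rewrite -z0 hsubmxK.
rewrite xE in nU.
have [V [f' [g' [VX nV Hfg' skel']]]] := susp_chart (v0 := v0) h1 cL UX nU Hfg.
exists V, M, L, G, f', g'; split=> //.
- split=> //; rewrite -xE in nV.
  rewrite scalerKV ?row_height // in nV.
  by rewrite subr_eq0 gt_eqF.
- split=> //; have -> : n + 1 - i'.+1%:Z - 1 = n - i'%:Z - 1 by lia.
  exact: spL.
- move=> j; have [GsL _ _] := GL (j%:Z - 1).
  rewrite (skel' _ _ GsL (skel j)) susp_skeletonE //.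
  by have -> : i'.+1%:Z + j%:Z - 1 = i'%:Z + j%:Z by lia.
Qed.

Lemma classical_pm_susp n N (X : set 'rV[R]_N) : 0 < n -> compact X -> X !=set0 ->
  classical_pm n X -> classical_pm (n + 1) (susp X).
Proof.
move=> n0 cX X0 [F [spX cF]]; exists (susp_skeleton F); split.
  exact: stratified_pm_susp.
rewrite !susp_skeletonE; [|lia|lia].
by have -> : n + 1 - 1 - 1 = n - 1 by [lia]; have -> : n + 1 - 2 - 1 = n - 2 by [lia]; rewrite cF.
Qed.

End SuspensionPM.

(** * One or two circles *)

Section Circles.
Variable R : realType.
Implicit Types N M : nat.

Lemma pl_discrete N M (X : set 'rV[R]_N) (f : 'rV[R]_N -> 'rV[R]_M) :
  (forall x, X x -> \forall y \near x, X y -> y = x) -> pl_map X f.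
Proof.
move=> dX; apply: pl_mapI => a Xa; exists unit, (fun=> [set a]); split=> [_||_].
- exact: convex_polyhedron_point.
- by apply: filterS (dX a Xa) => x xa; split=> [/xa->|[_ ->]] //; exists tt.
- by exists 0, (f a); apply: near_true => x ->; rewrite mulmx0 add0r.
Qed.

Lemma polyhedron_discrete N (X : set 'rV[R]_N) :
  (forall x, X x -> \forall y \near x, X y -> y = x) -> polyhedron X.
Proof. by move=> /(@pl_discrete _ 0 _ (fun=> 0))/polyhedron_pl. Qed.

Definition nu (x : 'rV[R]_2) : R := `|x 0 0| + `|x 0 1|.
Definition other (k : 'I_2) : 'I_2 := if k == 0 then 1 else 0.

Lemma nuE k x : nu x = `|x 0 k| + `|x 0 (other k)|.
Proof.
rewrite /nu /other; have [->//|k0] := eqVneq k 0.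
suff -> : k = 1 by rewrite addrC.
by apply: val_inj; case: k k0 => [[|[|]]] //.
Qed.

(** In the l1-norm: one circle, or two disjoint ones. *)
Definition circles (b : bool) : set 'rV[R]_2 := [set x | nu x = 1 \/ b /\ nu x = 2].

Lemma circles_false : circles false = @circle R.
Proof. by apply/seteqP; split=> x /=; rewrite /circles /=; [case=> // -[]|left]. Qed.

Lemma pl_coord N (X : set 'rV[R]_N) k : polyhedron X -> pl_fun X (fun x => x 0 k).
Proof. by move=> pX; have /(pl_funP _ pX) := pl_id pX. Qed.

Lemma pl_nu : pl_fun setT nu.
Proof.
have plc k : pl_fun setT (fun x : 'rV[R]_2 => `|x 0 k|).
  by apply: pl_abs; apply: pl_coord; exact: polyhedronT.
by have := plD (plc 0) (plc 1); apply: pl_ext => x _; rewrite -raddfD.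
Qed.

Lemma polyhedron_circles b : polyhedron (circles b).
Proof.
pose V : set 'rV[R]_1 := [set v | v 0 0 = 1 \/ b /\ v 0 0 = 2].
have pV : polyhedron V.
  apply: polyhedron_discrete => v Vv; apply/near_ball; exists 1 => // w wv Vw.
  have := le_lt_trans (norm_coord_le (v - w) 0) wv; rewrite !mxE ltr_norml => /andP[h1 h2].
  rewrite [w]mx11_scalar [v]mx11_scalar; congr (_%:M).
  by case: Vv Vw => [v1|[_ v2]] [w1|[_ w2]]; lra.
have := polyhedron_preimage pl_nu pV; congr polyhedron.
have hE x : (nu x)%:M 0 0 = nu x by rewrite mxE eqxx mulr1n.
by apply/seteqP; split=> x /=; rewrite /V /= hE; [case|].
Qed.

Lemma compact_circles b : compact (circles b).
Proof.
have c1 : compact (@circle R).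
  rewrite -circleE; apply: compact_susp; apply: compact_susp; exact: compact0.
pose dbl (x : 'rV[R]_2) : 'rV[R]_2 := 2 *: x + 0.
have c2 : compact (dbl @` @circle R).
  apply: pl_compact_image c1 _; apply: pl_scale; apply: pl_id.
  by rewrite -circles_false; exact: polyhedron_circles.
case: b; last by rewrite circles_false.
have := compactU c1 c2; congr compact; apply/seteqP; split=> x /=.
  move=> [h|[y yc <-]]; first by left.
  right; split=> //; rewrite /dbl addr0 /nu !mxE !normrM ger0_norm // -mulrDr.
  by rewrite yc mulr1.
move=> [h|[_ h]]; [by left|right; exists (2^-1 *: x)].
  by rewrite /circle /= !mxE !normrM ger0_norm // -mulrDr -/(nu x) h mulVf.
by rewrite /dbl addr0 scalerKV.
Qed.

Lemma cone0E N : prod_space [set: 'rV[R]_1] (cone (set0 : set 'rV[R]_N)) =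
  [set z | rsubmx z = 0].
Proof.
by apply/seteqP; split=> z /=; [move=> [_ /cone0]|move=> h; split=> //=; left].
Qed.

(** On the arc where some coordinate k keeps its sign, the other coordinate is a
    parameter running through an interval, which is stretched to the line. *)
Lemma circles_chart b x : circles b x ->
  exists U f g, [/\ U `<=` circles b, \forall y \near x, circles b y -> U y
    & pl_homeo_via (prod_space [set: 'rV[R]_1] (cone (set0 : set 'rV[R]_0))) U f g].
Proof.
move=> cx; set r := nu x.
have r0 : 0 < r by case: cx => [|[_]]; rewrite /r => ->.
have [k xk] : exists k, x 0 k != 0.
  apply: contrapT => /forallNP h; move: r0; rewrite /r /nu.
  have z k : x 0 k = 0 by have /negP := h k; rewrite negbK => /eqP.
  by rewrite !z normr0 addr0 ltxx.
pose s : R := if 0 < x 0 k then 1 else - 1.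
have ss : s * s = 1 by rewrite /s; case: ifP; rewrite ?mulrNN mulr1.
have sx : 0 < s * x 0 k.
  rewrite /s; have [h|h] := ltP 0 (x 0 k); first by rewrite mul1r.
  by rewrite mulN1r oppr_gt0 lt_neqAle xk.
have sN y : 0 < s * y -> s * y = `|y|.
  rewrite /s; case: ifP => _; first by rewrite mul1r => h; rewrite gtr0_norm.
  by rewrite mulN1r => h; rewrite ltr0_norm -?oppr_gt0.
pose U : set 'rV[R]_2 := circles b `&` [set y | `|nu y - r| < 1 /\ 0 < s * y 0 k].
have Unu y : U y -> nu y = r.
  move=> [cy [+ _]]; rewrite ltr_norml => /andP[h1 h2].
  by move: cx cy; rewrite /circles /= -/r => -[x1|[_ x1]] [y1|[_ y1]]; lra.
have pU : polyhedron U.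
  pose B1 : set 'rV[R]_1 := [set v | `|v 0 0 - r| < 1].
  pose B2 : set 'rV[R]_1 := [set v | 0 < s * v 0 0].
  have oB1 : open B1.
    have -> : B1 = ball r%:M 1.
      rewrite -ball_normE; apply/seteqP; split=> v /= h.
        apply: norm_ltP => // j; rewrite ord1 !mxE eqxx mulr1n distrC //.
      by have := le_lt_trans (norm_coord_le _ 0) h; rewrite !mxE eqxx mulr1n distrC.
    exact: ball_open.
  have oB2 : open B2.
    rewrite openE => v Bv; apply/near_ball; exists (s * v 0 0) => // w wv.
    have := le_lt_trans (norm_coord_le _ 0) wv; rewrite !mxE /B2 /= => h.
    have : `|s * (v 0 0 - w 0 0)| < s * v 0 0.
      rewrite normrM; have -> : `|s| = 1 by rewrite /s; case: ifP; rewrite ?normrN normr1.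
      by rewrite mul1r.
    by rewrite ltr_norml => /andP[_]; rewrite mulrBr; lra.
  have plk : pl_fun setT (fun y : 'rV[R]_2 => y 0 k) by apply: pl_coord; exact: polyhedronT.
  have := polyhedronI (@polyhedron_circles b) (polyhedronI
    (polyhedron_preimage pl_nu (polyhedron_open oB1))
    (polyhedron_preimage plk (polyhedron_open oB2))).
  congr polyhedron; apply/seteqP; split=> y /=; rewrite /B1 /B2 /= !mxE !eqxx !mulr1n.
    by move=> [h [[_ h1] [_ h2]]].
  by move=> [h [h1 h2]].
pose f (z : 'rV[R]_(1 + (1 + 0))) : 'rV[R]_2 :=
  \row_j if j == k then s * r * (1 - `|shrink (height z)|) else r * shrink (height z).
pose g (y : 'rV[R]_2) : 'rV[R]_(1 + (1 + 0)) := row_mx (stretch (r^-1 * y 0 (other k)))%:M 0.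
have kk : (other k == k) = false.
  by rewrite /other; case: (eqVneq k 0) => [->|] //; rewrite eq_sym => /negbTE.
have otherP j : j != k -> j = other k.
  rewrite /other; case: (eqVneq k 0) => [->|k0] j0; apply: val_inj; first by case: j j0 => [[|[|]]].
  by case: k j k0 j0 {kk f g pU Unu U sN sx ss s xk} => [[|[|]]] // ? [[|[|]]].
have fnu z : nu (f z) = r.
  rewrite (nuE k) !mxE eqxx kk !normrM (gtr0_norm r0).
  have -> : `|s| = 1 by rewrite /s; case: ifP; rewrite ?normrN normr1.
  have [h _] := shrinkK (height z); rewrite ger0_norm; last by rewrite subr_ge0 ltW.
  by rewrite mul1r; ring.
have g1 y : U y -> `|r^-1 * y 0 (other k)| < 1.
  move=> Uy; have := Unu y Uy; case: Uy => _ [_ sy]; rewrite (nuE k) => yr.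
  rewrite normrM gtr0_norm ?invr_gt0 // mulrC ltr_pdivrMr // mul1r -yr ltrDr.
  by rewrite -(sN _ sy).
have fU z : U (f z).
  split; first by rewrite /circles /= fnu.
  rewrite /= fnu subrr normr0; split=> //.
  rewrite !mxE eqxx mulrA mulrA ss mul1r mulr_gt0 // subr_gt0.
  by have [] := shrinkK (height z).
have plD : pl_map [set z : 'rV[R]_(1 + (1 + 0)) | rsubmx z = 0] id.
  apply: pl_id; have p0 : polyhedron [set (0 : 'rV[R]_(1 + 0))].
    by apply: polyhedron_discrete => v ->; apply: near_true => y ->.
  have := polyhedron_preimage (pl_rsubmx (pl_id (@polyhedronT R (1 + (1 + 0))))) p0.
  by congr polyhedron; apply/seteqP; split=> z /=; [case|].
exists U, f, g; split; first by move=> y [].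
- have [d1 d10 H1] := pl_continuous pl_nu (I : setT x) ltr01.
  have d20 : 0 < Num.min d1 (s * x 0 k) by rewrite lt_min d10.
  apply/near_ball; exists (Num.min d1 (s * x 0 k)) => // y yd cy.
  split=> //=; split.
    have := H1 y I (lt_le_trans yd _); rewrite ge_min lexx => /(_ isT) h.
    have := le_lt_trans (norm_coord_le _ 0) h.
    by rewrite !mxE eqxx !mulr1n distrC.
  have : `|x - y| < s * x 0 k by apply: lt_le_trans yd _; rewrite ge_min lexx orbT.
  move=> /(le_lt_trans (norm_coord_le _ k)); rewrite !mxE => h.
  have : `|s * (x 0 k - y 0 k)| < s * x 0 k.
    rewrite normrM; have -> : `|s| = 1 by rewrite /s; case: ifP; rewrite ?normrN normr1.
    by rewrite mul1r.
  by rewrite ltr_norml mulrBr => /andP[_]; lra.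
rewrite cone0E; split.
- apply/(pl_funP _ (polyhedron_pl plD)) => j.
  have plsh : pl_fun [set z : 'rV[R]_(1 + (1 + 0)) | rsubmx z = 0]
      (fun z => shrink (height z)).
    have := pl_comp_sub (fun _ _ => I) (pl_height plD) (@pl_shrink1 R).
    by apply: pl_ext => z _ /=; rewrite mxE eqxx mulr1n.
  have [->|jk] := eqVneq j k.
    have := pl_fun_affine (- (s * r)) (s * r) (pl_abs plsh).
    by apply: pl_ext => z _; rewrite mxE eqxx; congr (_%:M); ring.
  have := pl_fun_affine r 0 plsh.
  by apply: pl_ext => z _; rewrite mxE (negbTE jk) addr0.
- apply: pl_row_mx; last exact: pl_cst.
  have := pl_fun_affine r^-1 0 (pl_coord (other k) pU) => plc.
  have := pl_comp_sub (Y := [set v : 'rV[R]_1 | forall i, `|v 0 i| < 1]) _ plc (@pl_stretch1 R).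
  have h y : U y -> forall i : 'I_1, `|((r^-1 * y 0 (other k) + 0)%:M : 'rV[R]_1) 0 i| < 1.
    by move=> Uy i; rewrite ord1 mxE eqxx mulr1n addr0; exact: g1.
  by move=> /(_ h); apply: pl_ext => y _ /=; rewrite mxE eqxx mulr1n addr0.
- move=> z z0; split; first exact: fU.
  rewrite /g mxE kk mulKf ?gt_eqF //; have [_ ->] := shrinkK (height z).
  by rewrite -[RHS]row_height z0.
- move=> y Uy; split; first by rewrite /= /g row_mxKr.
  apply/rowP => j; rewrite mxE /g height_row stretchK; last exact: g1.
  have yr := Unu y Uy; have [_ [_ sy]] := Uy.
  have [->|jk] := eqVneq j k.
    have -> : s * r * (1 - `|r^-1 * y 0 (other k)|) = s * (r - `|y 0 (other k)|).
      by rewrite normrM gtr0_norm ?invr_gt0 // -mulrA mulrBr mulr1 mulVKf // gt_eqF.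
    by rewrite -{1}yr (nuE k) addrK -(sN _ sy) mulrA ss mul1r.
  by rewrite mulVKf ?gt_eqF // (otherP _ jk).
Qed.

Definition manifold_skeleton (n : int) N (X : set 'rV[R]_N) (i : int) : set 'rV[R]_N :=
  if i < n then set0 else X.

Lemma classical_pm_circles b : classical_pm 1 (circles b).
Proof.
exists (manifold_skeleton 1 (circles b)); split; last by [].
have pC := @polyhedron_circles b.
apply: spm_pos => //.
- split=> //.
  + by split=> // i i0; rewrite /manifold_skeleton; case: ltP => //; lia.
  + move=> i j ij; rewrite /manifold_skeleton; case: ltP => i1; first by move=> x [].
    by have -> : j < 1 = false by apply/negP/negP; rewrite -leNgt; lia.
  + move=> i; rewrite /manifold_skeleton; case: ltP => _.
      by rewrite closure0 setI0; split=> // x [].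
    by split=> // x [].
- by rewrite /manifold_skeleton /= setD0; exact: subset_closure.
move=> i x; rewrite /manifold_skeleton; case: ltP => // i1 cx.
case: ltP => // i2 _; have i1' : i = 1%N by lia.
subst i; have [U [f [g [UC nU Hfg]]]] := circles_chart cx.
exists U, 0%N, set0, (fun=> set0), f, g; split=> //.
- by split; [exact: compact0|rewrite subrr sub0r; exact: stratified_pm_set0].
- move=> j; have -> : 1%:Z + j%:Z < 1 = false by apply/negP/negP; rewrite -leNgt; lia.
  case: Hfg => _ _ fK gK; apply/seteqP; split=> [_ [z /fK[Uf _] <-]|y [_ /gK[Dg fg]]].
    by split=> //; exact: UC.
  by exists (g y).
Qed.

End Circles.

(** * The suspension of two circles is not a sphere *)

Section NotSphere.
Variable R : realType.
Implicit Types N M n : nat.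

Definition norm1 n (x : 'rV[R]_n) : R := \sum_k `|x 0 k|.

Lemma norm1_ge0 n (x : 'rV[R]_n) : 0 <= norm1 x.
Proof. by apply: sumr_ge0. Qed.

Lemma norm1Z n a (x : 'rV[R]_n) : norm1 (a *: x) = `|a| * norm1 x.
Proof. by rewrite /norm1 mulr_sumr; apply: eq_bigr => k _; rewrite mxE normrM. Qed.

Lemma norm1_eq0 n (x : 'rV[R]_n) : norm1 x = 0 -> x = 0.
Proof.
move=> /psumr_eq0P h; apply/rowP => k; rewrite mxE.
by have /normr0_eq0 := h (fun _ _ => normr_ge0 _) k isT.
Qed.

(** On the l1-sphere let m vanish at most at p and q. The radial projection of the
    segment from a to c misses p and q, since otherwise c would be in the plane
    spanned by a and p, or by a and q. By the intermediate value theorem m keeps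
    its sign along this path. *)
Lemma sphere_segment n (m : 'rV[R]_n -> R) (p q a c : 'rV[R]_n) :
  (forall x (e : R), norm1 x = 1 -> 0 < e -> exists2 d : R, 0 < d &
     forall y, norm1 y = 1 -> `|x - y| < d -> `|m x - m y| < e) ->
  (forall x, norm1 x = 1 -> m x = 0 -> x = p \/ x = q) ->
  (forall v : 'rV[R]_(1 + 1), c <> v *m col_mx a p) ->
  (forall v : 'rV[R]_(1 + 1), c <> v *m col_mx a q) ->
  norm1 a = 1 -> m a != 0 -> 0 < m a * m ((norm1 c)^-1 *: c).
Proof.
move=> cm zm cp cq a1 ma; rewrite ltNge; apply/negP => mac.
pose z (s : R) : 'rV[R]_n := (1 - s) *: a + s *: c.
pose ga s := (norm1 (z s))^-1 *: z s.
have spanE (r : 'rV[R]_n) s lam : s != 0 -> z s = lam *: r ->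
    exists v : 'rV[R]_(1 + 1), c = v *m col_mx a r.
  move=> s0 zs; (* solve z s = (1 - s) a + s c for c *)
  exists (row_mx (- (s^-1 * (1 - s)))%:M (s^-1 * lam)%:M).
  rewrite mul_row_col !mul_scalar_mx scaleNr -!scalerA -zs addrC -scalerBr.
  by rewrite /z addrAC subrr add0r scalerA mulVf // scale1r.
have z0 s : norm1 (z s) != 0.
  apply/eqP => /norm1_eq0 zs; have [s0|s0] := eqVneq s 0.
    move: zs a1; rewrite /z s0 subr0 scale1r scale0r addr0 => ->.
    by rewrite /norm1 big1 => [/esym/eqP|k _]; rewrite ?oner_eq0 // mxE normr0.
  have [|v cv] := spanE p s 0 s0; first by rewrite zs scale0r.
  exact: cp cv.
have ga1 s : norm1 (ga s) = 1.
  by rewrite norm1Z ger0_norm ?invr_ge0 ?norm1_ge0 // mulVf.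
have ga0 : ga 0 = a by rewrite /ga /z subr0 scale1r scale0r addr0 a1 invr1 scale1r.
have mga s : m (ga s) != 0.
  have [->|s0] := eqVneq s 0; first by rewrite ga0.
  apply/eqP => /(zm _ (ga1 s)) gs.
  have zs : z s = norm1 (z s) *: ga s by rewrite scalerKV.
  case: gs => gs; rewrite gs in zs.
    by have [v cv] := spanE p s _ s0 zs; exact: cp cv.
  by have [v cv] := spanE q s _ s0 zs; exact: cq cv.
have czk k : continuous (fun s => z s 0 k).
  have -> : (fun s => z s 0 k) = (fun s => (1 - s) * a 0 k + s * c 0 k).
    by apply/funext => s; rewrite !mxE.
  move=> s; apply: cvgD; apply: cvgM; try exact: cst_continuous.
    by apply: cvgB; [exact: cst_continuous|exact: cvg_id].
  exact: cvg_id.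
have cn : continuous (fun s => norm1 (z s)).
  rewrite /norm1 => s; elim: (index_enum _) => [|k r IH].
    by under eq_fun do rewrite big_nil; exact: cst_continuous.
  under eq_fun do rewrite big_cons.
  by apply: cvgD IH; apply: cvg_norm; exact: czk.
have cga : continuous ga.
  apply: continuous_mx => i k; rewrite ord1.
  have -> : (fun s => ga s 0 k) = (fun s => (norm1 (z s))^-1 * z s 0 k).
    by apply/funext => s; rewrite mxE.
  by move=> s; apply: cvgM; [apply: cvgV => //; exact: cn|exact: czk].
have cH : continuous (fun s => m (ga s)).
  move=> s; apply/cvgrPdist_lt => e e0; have [d d0 Hd] := cm _ _ (ga1 s) e0.
  have /cvgrPdist_lt/(_ d d0) := cga s.
  by apply: filterS => t; exact: Hd.
have ga1E : ga 1 = (norm1 c)^-1 *: c.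
  by rewrite /ga /z subrr scale0r add0r scale1r.
have [||s _ ms] := @IVT _ (fun s => m (ga s)) 0 1 0 ler01.
- exact: continuous_subspaceT.
- rewrite ga0 ga1E ge_min le_max; move: mac ma.
  set u := m a; set v := m _ => uv u0.
  move: u0; rewrite neq_lt => /orP[u1|u1].
    have v1 : 0 <= v by rewrite leNgt; apply/negP => v1; nra.
    by rewrite (ltW u1) v1 orbT.
  have v1 : v <= 0 by rewrite leNgt; apply/negP => v1; nra.
  by rewrite v1 (ltW u1) orbT.
by have := mga s; rewrite ms eqxx.
Qed.

(** Otherwise the identity of R^n would be an injective PL map into a finite
    union of planes. *)
Lemma planes_miss n (T : finType) (B : T -> 'M[R]_(2, n)) : (2 < n)%N ->
  exists c, forall l (v : 'rV[R]_2), c <> v *m B l.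
Proof.
move=> n2; apply: contrapT => /forallNP H.
have : (n <= 2)%N; last by rewrite leqNgt n2.
apply: (@pl_inj_dim_le R n n n 2 setT id setT 1%:M 0 T B (fun=> 0)) => //.
- exact: openT.
- by exists 0.
- by move=> v; rewrite mulmx1.
- by apply: pl_id; exact: polyhedronT.
- move=> x _; rewrite mulmx1 addr0; have := H x.
  move=> /existsNP[l /existsNP[v /contrapT xv]].
  by exists l, v; rewrite addr0.
Qed.

(** A sphere of dimension at least 2 stays connected when two points are
    removed: a and b are joined through a point c outside the four planes spanned
    by one of a, b and one of p, q. *)
Lemma sphere_minus_two_points n (m : 'rV[R]_n -> R) (p q a b : 'rV[R]_n) : (2 < n)%N ->
  (forall x (e : R), norm1 x = 1 -> 0 < e -> exists2 d : R, 0 < d &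
     forall y, norm1 y = 1 -> `|x - y| < d -> `|m x - m y| < e) ->
  (forall x, norm1 x = 1 -> m x = 0 -> x = p \/ x = q) ->
  norm1 a = 1 -> norm1 b = 1 -> m a < 0 -> m b <= 0.
Proof.
move=> n2 cm zm a1 b1 ma; rewrite leNgt; apply/negP => mb.
pose B (l : bool * bool) : 'M[R]_(2, n) :=
  col_mx (if l.1 then a else b) (if l.2 then p else q) : 'M[R]_(1 + 1, n).
have [c cB] := planes_miss B n2.
have ha := sphere_segment cm zm (cB (true, true)) (cB (true, false)) a1.
have hb := sphere_segment cm zm (cB (false, true)) (cB (false, false)) b1.
have := ha; rewrite lt_eqF // => /(_ isT) h1.
have := hb; rewrite gt_eqF // => /(_ isT) h2.
by move: h1 h2; set u := m (_ *: c); nra.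
Qed.

(** This bounds the dimension of the suspension of a finite set by 1. *)
Lemma susp_finite_lines N (X : set 'rV[R]_N) (s : seq 'rV[R]_N) :
  (forall x, X x -> x \in s) ->
  exists (T : finType) (B : T -> 'M[R]_(1, 1 + N)) (c : T -> 'rV[R]_(1 + N)),
    forall w, susp X w -> exists l v, w = v *m B l + c l.
Proof.
move=> Xs; exists (seq_sub (0 :: s) * bool)%type.
exists (fun l => row_mx 1%:M (if l.2 then - ssval l.1 else ssval l.1)).
exists (fun l => row_mx 0 (ssval l.1)) => w /suspE[[h1 y0]|[h1 /Xs xs]].
  exists (SeqSub (mem_head 0 s), true), (height w)%:M.
  rewrite /= -[LHS]row_height y0 mul_mx_row mulmx1 oppr0 mulmx0 add_row_mx !addr0.
  by [].
set x := _ *: _ in xs; have xs' : x \in 0 :: s by rewrite in_cons xs orbT.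
have wx : rsubmx w = (1 - `|height w|) *: x by rewrite scalerKV // subr_eq0 gt_eqF.
exists (SeqSub xs', 0 <= height w), (height w)%:M.
rewrite /= mul_mx_row mulmx1 add_row_mx addr0 mul_scalar_mx -[LHS]row_height wx.
congr row_mx; rewrite scalerBl scale1r addrC; congr (_ + _).
have [h0|h0] := leP 0 (height w); first by rewrite ger0_norm // scalerN.
by rewrite ltr0_norm // scaleNr opprK.
Qed.

Lemma iter_susp_polyhedron i N (X : set 'rV[R]_N) : compact X -> polyhedron X ->
  compact (iter_susp i X) /\ polyhedron (iter_susp i X).
Proof.
move=> cX pX; elim: i => //= i [cS pS].
by split; [exact: compact_susp|exact: polyhedron_susp].
Qed.

Lemma iter_susp_set0_homeo i N M :
  pl_homeo (iter_susp i (set0 : set 'rV[R]_N)) (iter_susp i (set0 : set 'rV[R]_M)).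
Proof.
have p0 N' := proj2 (iter_susp_polyhedron i (@compact0 'rV[R]_N') (@polyhedron0 R N')).
apply: lin_equiv_pl; [exact: p0|exact: p0|].
by apply: lin_equiv_iter_susp; exact: lin_equiv_set0.
Qed.

Lemma nu_row (r s : R) : nu (row_mx r%:M s%:M : 'rV[R]_(1 + 1)) = `|r| + `|s|.
Proof.
set w := row_mx _ _.
have e0 : w 0 (lshift 1 0) = r by rewrite row_mxEl mxE eqxx mulr1n.
have e1 : w 0 (rshift 1 0) = s by rewrite row_mxEr mxE eqxx mulr1n.
have i0 : (@lshift 1 1 0 : 'I_2) = 0 by apply: val_inj.
have i1 : (@rshift 1 1 0 : 'I_2) = 1 by apply: val_inj.
have {}e0 : w 0 0 = r by rewrite -e0 -i0.
have {}e1 : w 0 1 = s by rewrite -e1 -i1.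
by rewrite /nu e0 e1.
Qed.

Lemma has_cell_circles b : has_cell 1 (@circles R b).
Proof.
change (@has_cell R 1 (1 + 1) (circles b)).
exists (2^-1)%:M, 2^-1, (row_mx 1%:M (- 1)%:M : 'rV[R]_(1 + 1)),
  (row_mx 0 1%:M : 'rV[R]_(1 + 1)).
split; first by rewrite invr_gt0.
  move=> v; rewrite mul_mx_row mulmx1 -[X in _ = X -> _]row_mx0.
  by move=> /eq_row_mx[].
move=> v /(le_lt_trans (norm_coord_le _ 0)); rewrite !mxE eqxx mulr1n ltr_norml => /andP[h1 h2].
left; rewrite mul_mx_row mulmx1 add_row_mx addr0 mul_mx_scalar scaleN1r.
have -> : row_mx v (- v + 1%:M) = row_mx (v 0 0)%:M (1 - v 0 0)%:M.
  by rewrite raddfB /= -mx11_scalar addrC.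
rewrite nu_row.
by rewrite !ger0_norm ?subr_ge0; lra.
Qed.

Lemma nuZ a (x : 'rV[R]_2) : nu (a *: x) = `|a| * nu x.
Proof. by rewrite /nu !mxE !normrM mulrDr. Qed.

(** Removing the poles disconnects the suspension of two circles: over the point
    at height t the l1-norm of the base coordinate is 1 or 2 times 1 - `|t|, so
    its difference psi with 3/2 (1 - `|t|) vanishes at the poles only and takes
    both signs. A sphere of dimension at least 2 has no such function, and those
    of smaller dimension contain no cell of dimension 2. *)
Lemma susp_circles_not_sphere i N :
  ~ pl_homeo (susp (@circles R true)) (iter_susp i (set0 : set 'rV[R]_N)).
Proof.
move=> /pl_homeo_trans/(_ (iter_susp_set0_homeo i N 0)) H.
have c2 : has_cell 2 (susp (@circles R true)) := has_cell_susp (has_cell_circles true).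
case: i H => [|[|[|i]]] H.
- by case: H => f [g [_ _ fK _]]; have [[]] := fK _ (or_introl erefl).
- have [|T [B [c Bc]]] := @susp_finite_lines _ (set0 : set 'rV[R]_0) [::].
    by move=> x.
  by have := has_cell_dim_le c2 H Bc.
- have [|T [B [c Bc]]] := @susp_finite_lines _ (susp (set0 : set 'rV[R]_0))
      [:: row_mx 1%:M 0; row_mx (- 1)%:M 0].
    by move=> x [->|[->|[? [? []]]]] //; rewrite !inE eqxx ?orbT.
  by have := has_cell_dim_le c2 H Bc.
case: H => f [g [plf plg fK gK]].
move: plf plg fK gK; rewrite iter_susp0E; set n := (i.+3 + 0)%N => plf plg fK gK.
pose psi (w : 'rV[R]_(1 + 2)) := nu (rsubmx w) - 3 / 2 * (1 - `|height w|).
have pln : pl_fun setT psi.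
  have plid := pl_id (@polyhedronT R (1 + 2)).
  have pl1 := pl_comp_sub (fun _ _ => I) (pl_rsubmx plid) (@pl_nu R).
  have := plD pl1 (pl_fun_affine (3 / 2) (- (3 / 2)) (pl_abs (pl_height plid))).
  by apply: pl_ext => w _ /=; rewrite -raddfD; congr (_%:M); rewrite /psi; ring.
have plm : pl_fun [set x : 'rV[R]_n | norm1 x = 1] (psi \o g).
  exact: pl_comp_sub (fun _ _ => I) plg pln.
pose N0 : 'rV[R]_(1 + 2) := row_mx 1%:M 0.
pose S0 : 'rV[R]_(1 + 2) := row_mx (- 1)%:M 0.
have psi0 w : susp (circles true) w -> psi w = 0 -> w = N0 \/ w = S0.
  move=> /suspE[[h1 y0] _|[h1 cy]].
    rewrite -[w]row_height y0; move/eqP: h1; rewrite eqr_norml.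
    by case/andP=> /orP[]/eqP-> _; [left|right].
  have hp : 0 < 1 - `|height w| by rewrite subr_gt0.
  set x := _ *: rsubmx w in cy.
  have wx : rsubmx w = (1 - `|height w|) *: x by rewrite scalerKV // gt_eqF.
  rewrite /psi wx nuZ gtr0_norm //.
  by case: cy => [|[_]] -> => h; exfalso; move: hp h; lra.
pose pt (r : R) : 'rV[R]_2 := (row_mx r%:M 0%:M : 'rV[R]_(1 + 1)).
have nupt r : 0 <= r -> nu (pt r) = r.
  by move=> r0; rewrite nu_row normr0 addr0 ger0_norm.
pose A (r : R) : 'rV[R]_(1 + 2) := row_mx 0%:M (pt r).
have SA r : circles true (pt r) -> susp (circles true) (A r).
  move=> cr; apply/suspE; right; rewrite height_row row_mxKr normr0 ltr01 subr0 invr1.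
  by rewrite scale1r.
have psiA r : 0 <= r -> psi (A r) = r - 3 / 2.
  by move=> r0; rewrite /psi height_row row_mxKr nupt // normr0 subr0 mulr1.
have S1 : susp (circles true) (A 1) by apply: SA; left; rewrite nupt.
have S2 : susp (circles true) (A 2) by apply: SA; right; rewrite nupt.
have [fS1 gS1] := fK _ S1; have [fS2 gS2] := fK _ S2.
have := @sphere_minus_two_points n (psi \o g) (f N0) (f S0) (f (A 1)) (f (A 2)) isT.
move=> /(_ _ _ fS1 fS2); rewrite /= gS1 gS2 !psiA // => h.
have : (2 : R) - 3 / 2 <= 0.
  apply: h; [|move=> x x1 gx0|lra].
    move=> x e x1 e0; have [d d0 Hd] := pl_continuous plm x1 e0.
    exists d => // y y1 xy; have := Hd y y1 xy.
    by move=> /(le_lt_trans (norm_coord_le _ 0)); rewrite !mxE eqxx !mulr1n.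
  have [Sg fg] := gK x x1; have [gx|gx] := psi0 _ Sg gx0; rewrite -gx fg; by [left|right].
lra.
Qed.

End NotSphere.

(** * Suspensions of finite sets *)

Section ZeroDim.
Variable R : realType.
Implicit Types N M : nat.

Definition discrete_set N (X : set 'rV[R]_N) :=
  forall x, X x -> \forall y \near x, X y -> y = x.

Lemma discrete_pair N (a b : 'rV[R]_N) : discrete_set [set a; b].
Proof.
have H (c d : 'rV[R]_N) : \forall y \near c, y = d -> y = c.
  have [->|cd] := eqVneq c d; first by apply: near_true.
  apply/near_ball; exists `|c - d|; first by rewrite normr_gt0 subr_eq0.
  by move=> y + yd; rewrite yd ltxx.
move=> x [->|->].
  by apply: filterS (H a b) => y h [|].
by apply: filterS (H b a) => y h [|].
Qed.

Lemma compact_discrete_finite N (X : set 'rV[R]_N) : compact X -> discrete_set X ->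
  exists s : seq 'rV[R]_N, forall x, X x -> x \in s.
Proof.
move=> cX dX.
have /choice[e He] : forall a, exists e : R, X a ->
    0 < e /\ forall y, X y -> `|a - y| < e -> y = a.
  move=> a; have [Xa|nXa] := pselect (X a); last by exists 0.
  have /near_ball[e e0 H] := dX a Xa; exists e => _; split=> // y Xy ye.
  exact: H.
have [s [sX Xs]] := compact_finite_net cX (fun a Xa => proj1 (He a Xa)).
exists s => x Xx; have [a sa ax] := Xs x Xx.
by rewrite (proj2 (He a (sX _ sa)) x Xx ax).
Qed.

Lemma pl_homeo_pair N M (a b : 'rV[R]_N) (c d : 'rV[R]_M) : a != b -> c != d ->
  pl_homeo [set a; b] [set c; d].
Proof.
move=> ab cd.
exists (fun x => if x == a then c else d), (fun y => if y == c then a else b); split.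
- by apply: pl_discrete; exact: discrete_pair.
- by apply: pl_discrete; exact: discrete_pair.
- move=> x [->|->]; first by rewrite !eqxx; split=> //; left.
  by rewrite eq_sym (negbTE ab) eq_sym (negbTE cd); split=> //; right.
- move=> x [->|->]; first by rewrite !eqxx; split=> //; left.
  by rewrite eq_sym (negbTE cd) eq_sym (negbTE ab); split=> //; right.
Qed.

Lemma susp_set0E N : susp (set0 : set 'rV[R]_N) = [set row_mx 1%:M 0; row_mx (- 1)%:M 0].
Proof.
by apply/seteqP; split=> w [->|h]; [left|case: h => [->|[? [? []]]] //; right|left|right; left].
Qed.

Lemma poles_neq N : row_mx 1%:M 0 != row_mx (- 1)%:M 0 :> 'rV[R]_(1 + N).
Proof.
apply/eqP => /(congr1 (@height R N)); rewrite !height_row; lra.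
Qed.

Lemma has_cell_prod i M (L : set 'rV[R]_M) :
  has_cell i (prod_space [set: 'rV[R]_i] (cone L)).
Proof.
exists 0, 1, (row_mx 1%:M 0), 0; split=> // [v|v _].
  by rewrite mul_mx_row mulmx1 mulmx0 -[X in _ = X -> _]row_mx0 => /eq_row_mx[].
by split=> //=; rewrite addr0 mul_mx_row mulmx0 row_mxKr; left.
Qed.

(** The segment from the upper pole to the point z of the base. *)
Definition arm N (z : 'rV[R]_N) (t : R) : 'rV[R]_(1 + N) := row_mx (1 - t)%:M (t *: z).

Lemma arm0 N (z : 'rV[R]_N) : arm z 0 = row_mx 1%:M 0.
Proof. by rewrite /arm subr0 scale0r. Qed.

Lemma armZ N (z : 'rV[R]_N) s t :
  row_mx 1%:M 0 + s *: (arm z t - row_mx 1%:M 0) = arm z (s * t).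
Proof.
rewrite /arm opp_row_mx add_row_mx scale_row_mx add_row_mx -raddfB /= subr0 add0r.
rewrite scale_scalar_mx -raddfD /= scalerA; congr (row_mx _%:M _); ring.
Qed.

Lemma arm_inj N (z1 z2 : 'rV[R]_N) t1 t2 : 0 < t1 -> arm z1 t1 = arm z2 t2 -> z1 = z2.
Proof.
move=> t10 h; have := congr1 (@height R N) h; rewrite !height_row => ht.
have tt : t1 = t2 by lra.
have := congr1 rsubmx h; rewrite !row_mxKr -tt => /(congr1 ( *:%R t1^-1)).
by rewrite !scalerK // gt_eqF.
Qed.

Lemma susp_arm N (Z : set 'rV[R]_N) z t : Z z -> 0 <= t <= 1 -> susp Z (arm z t).
Proof.
move=> Zz /andP[]; rewrite le_eqVlt => /orP[/eqP<- _|t0 t1]; first by rewrite arm0; left.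
apply/suspE; right; rewrite height_row row_mxKr ger0_norm ?subr_ge0 //.
by rewrite opprB addrCA subrr addr0 scalerK ?gt_eqF //; split=> //; lra.
Qed.

Lemma arm_near N (z : 'rV[R]_N) (e : R) : 0 < e ->
  exists2 t, 0 < t <= 1 & `|row_mx 1%:M 0 - arm z t| < e.
Proof.
move=> e0; have nz : 0 < 1 + `|z| by rewrite ltr_pwDl.
pose t := Num.min 1 (e / 2 / (1 + `|z|)).
have t0 : 0 < t by rewrite lt_min ltr01 !divr_gt0.
have te : t * (1 + `|z|) <= e / 2 by rewrite -ler_pdivlMr // ge_min lexx orbT.
have tz : 0 <= t * `|z| by rewrite mulr_ge0 // ltW.
exists t; first by rewrite t0 ge_min lexx.
rewrite /arm opp_row_mx add_row_mx -raddfB /= sub0r.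
apply: norm_row_lt; last by rewrite normrN normrZ gtr0_norm //; lra.
by rewrite opprB addrCA subrr addr0 gtr0_norm //; lra.
Qed.

Lemma susp_near_pole N (Z : set 'rV[R]_N) w : susp Z w -> 0 < height w ->
  w != row_mx 1%:M 0 -> exists z t, [/\ Z z, 0 < t < 1 & w = arm z t].
Proof.
move=> /suspE[[h1 y0]|[h1 Zy]] h0 wN.
  by move: wN; rewrite -[w]row_height y0 -h1 gtr0_norm // eqxx.
move: h1 Zy; rewrite gtr0_norm // => h1 Zy.
exists ((1 - height w)^-1 *: rsubmx w), (1 - height w); split=> //.
  by rewrite subr_gt0 h1 /=; lra.
by rewrite /arm scalerKV ?subr_eq0 ?gt_eqF // opprB addrCA subrr addr0 row_height.
Qed.

(** The inverse chart g is affine on the beginning of each arm, so that each arm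
    lies on one side of the image of the pole in the line. Two arms on the same
    side would overlap, and both sides are occupied because f maps all points
    near that image close to the pole. *)
Lemma two_arms N M (Z : set 'rV[R]_N) (U : set 'rV[R]_(1 + N)) f g
    (N0 : 'rV[R]_(1 + N) := row_mx 1%:M 0) :
  U `<=` susp Z -> (\forall y \near N0, susp Z y -> U y) ->
  pl_homeo_via (prod_space [set: 'rV[R]_1] (cone (set0 : set 'rV[R]_M))) U f g ->
  exists z1 z2, z1 != z2 /\ Z = [set z1; z2].
Proof.
move=> UZ /near_ball[e e0 eU] [plf plg fK gK].
have UN : U N0 by apply: eU; [rewrite subrr normr0|left].
have [d d0 Hd] := pl_germ plg UN.
have DE v : U v -> rsubmx (g v) = 0 by move=> /gK[[_ /cone0]].
pose G v := height (g v) - height (g N0).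
have Ginj v w : U v -> U w -> G v = G w -> v = w.
  move=> Uv Uw h; have [_ <-] := gK v Uv; have [_ <-] := gK w Uw; congr f.
  rewrite -[g v]row_height -[g w]row_height !DE //; congr (row_mx _%:M _).
  by move: h; rewrite /G; lra.
have GN : G N0 = 0 by rewrite /G subrr.
have Garm z t s : U (arm z t) -> `|N0 - arm z t| < d -> 0 <= s <= 1 ->
    U (arm z (s * t)) /\ G (arm z (s * t)) = s * G (arm z t).
  move=> Ut td s01; have [] := Hd _ s Ut td s01; rewrite armZ => Us gs; split=> //.
  by rewrite /G gs heightE mxE -heightE mxE -heightE heightB addrAC subrr add0r.
pose Arm (z : 'rV[R]_N) (c : R) := exists t, [/\ 0 < t, U (arm z t), `|N0 - arm z t| < d &
  0 < c * G (arm z t)].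
have armA z : Z z -> Arm z 1 \/ Arm z (- 1).
  move=> Zz; have m0 : 0 < Num.min e d by rewrite lt_min e0.
  have [t /andP[t0 t1]] := arm_near z m0; rewrite lt_min => /andP[te td].
  have Ut : U (arm z t) by apply: eU => //; apply: susp_arm => //; rewrite (ltW t0).
  have : G (arm z t) != 0.
    apply/eqP => h; have := Ginj _ _ Ut UN; rewrite GN h => /(_ erefl).
    by move=> /(congr1 (@height R N)); rewrite !height_row; lra.
  by rewrite neq_lt => /orP[h|h]; [right|left]; exists t; split=> //; lra.
have armB z1 z2 c : Arm z1 c -> Arm z2 c -> z1 = z2.
  move=> [t1 [t10 U1 d1 G1]] [t2 [t20 U2 d2 G2]].
  set g1 := G (arm z1 t1) in G1; set g2 := G (arm z2 t2) in G2.
  (* scale both arms so that g takes the same value at their ends *)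
  pose s1 := c * g2 / (c * g1 + c * g2); pose s2 := c * g1 / (c * g1 + c * g2).
  have sp : 0 < c * g1 + c * g2 by rewrite addr_gt0.
  have s10 : 0 < s1 by rewrite divr_gt0.
  have s20 : 0 < s2 by rewrite divr_gt0.
  have s11 : 0 <= s1 <= 1 by rewrite ltW //= ler_pdivrMr // mul1r lerDr ltW.
  have s21 : 0 <= s2 <= 1 by rewrite ltW //= ler_pdivrMr // mul1r lerDl ltW.
  have [U1' G1'] := Garm _ _ _ U1 d1 s11; have [U2' G2'] := Garm _ _ _ U2 d2 s21.
  apply: (@arm_inj _ _ _ (s1 * t1) (s2 * t2)); first by rewrite mulr_gt0.
  apply: Ginj => //; rewrite G1' G2' -/g1 -/g2 /s1 /s2.
  by rewrite mulrAC [RHS]mulrAC; congr (_ / _); ring.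
have armC c : c != 0 -> exists2 z, Z z & Arm z c.
  move=> c0; have [DN fN] := gK _ UN.
  have m0 : 0 < Num.min (Num.min d 1) (`|c|) by rewrite !lt_min d0 ltr01 normr_gt0.
  have [r r0 Hr] := pl_continuous plf DN m0.
  pose u : 'rV[R]_(1 + (1 + M)) :=
    row_mx (height (g N0) + c * (r / 2 / `|c|))%:M 0.
  have Du : prod_space [set: 'rV[R]_1] (cone (set0 : set 'rV[R]_M)) u.
    by split=> //=; rewrite row_mxKr; left.
  have cn : 0 < `|c| by rewrite normr_gt0.
  have ur : `|g N0 - u| < r.
    rewrite -[g N0]row_height DE // opp_row_mx add_row_mx subrr -raddfB /=.
    rewrite opprD addrA subrr sub0r; apply: norm_row_lt; last by rewrite normr0.
    rewrite normrN normrM [`|r / 2 / _|]ger0_norm; last by rewrite !divr_ge0 // ltW.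
    by rewrite mulrC divfK ?gt_eqF //; lra.
  have [Uf gf] := fK u Du.
  have := Hr u Du ur; rewrite fN lt_min => /andP[]; rewrite lt_min => /andP[fd f1] _.
  have Gf : G (f u) = c * (r / 2 / `|c|).
    by rewrite /G gf height_row addrAC subrr add0r.
  have Gfc : 0 < c * G (f u).
    rewrite Gf mulrA mulr_gt0 ?divr_gt0 //.
    by rewrite -expr2 exprn_even_gt0.
  have h0 : 0 < height (f u).
    have := le_lt_trans (height_norm _) f1; rewrite heightB height_row ltr_norml.
    by move=> /andP[_]; lra.
  have fuN : f u != N0.
    by apply/eqP => h; move: Gfc; rewrite h GN mulr0 ltxx.
  have [z [t [Zz /andP[t0 t1] fE]]] := susp_near_pole (UZ _ Uf) h0 fuN.
  by exists z => //; exists t; split; rewrite -?fE.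
have armD z : Arm z 1 -> Arm z (- 1) -> False.
  move=> [t1 [t10 U1 d1 G1]] [t2 [t20 U2 d2 G2]].
  have scale t t' : 0 < t -> t <= t' -> U (arm z t') -> `|N0 - arm z t'| < d ->
      exists2 s, 0 < s & G (arm z t) = s * G (arm z t').
    move=> t0 tt Ut td; have t'0 : 0 < t' by apply: lt_le_trans tt.
    have [|_] := Garm _ _ (t / t') Ut td.
      by rewrite ltW ?divr_gt0 //= ler_pdivrMr // mul1r.
    by rewrite divfK ?gt_eqF // => Gt; exists (t / t') => //; rewrite divr_gt0.
  have [t12|/ltW t21] := leP t1 t2.
    by have [s s0 Gs] := scale _ _ t10 t12 U2 d2; move: G1 G2; rewrite Gs; nra.
  by have [s s0 Gs] := scale _ _ t20 t21 U1 d1; move: G1 G2; rewrite Gs; nra.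
have [z1 Z1 A1] := armC 1 (oner_neq0 _).
have [|z2 Z2 A2] := armC (- 1); first by rewrite oppr_eq0 oner_eq0.
exists z1, z2; split.
  by apply/eqP => z12; rewrite -z12 in A2; exact: armD A1 A2.
apply/seteqP; split=> z; last by move=> [->|->].
by move=> /armA[h|h]; [left; exact: armB h A1|right; exact: armB h A2].
Qed.

(** The suspension of a finite set lies in finitely many lines, so its dimension
    is 1; being classical, it then has no 0-dimensional stratum, and the pole has
    a neighbourhood PL homeomorphic to the line. *)
Lemma susp_discrete_pair n N (Z : set 'rV[R]_N) : compact Z -> discrete_set Z ->
  Z !=set0 -> classical_pm n (susp Z) -> exists z1 z2, z1 != z2 /\ Z = [set z1; z2].
Proof.
move=> cZ dZ [z0 Zz0] [F [spF cF]]; pose N0 : 'rV[R]_(1 + N) := row_mx 1%:M 0.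
have SN : susp Z N0 by left.
case/stratified_pm_inv: (spF) => [[_ _ S0]|[_ _ dS]|[n0 fS dS cS]].
- by rewrite S0 in SN.
- have /near_ball[e e0 H] := dS _ SN; have [t /andP[t0 t1] te] := arm_near z0 e0.
  have : arm z0 t = N0 by apply: H => //; apply: susp_arm => //; rewrite (ltW t0).
  by move=> /(congr1 (@height R N)); rewrite !height_row; lra.
have [_ [Fn F0] _ _] := fS.
have chart (i : nat) w : n = i%:Z -> F i%:Z w -> ~ F (i%:Z - 1) w ->
    exists M U f g, [/\ U `<=` susp Z, \forall y \near w, susp Z y -> U y &
      pl_homeo_via (prod_space [set: 'rV[R]_i] (cone (set0 : set 'rV[R]_M))) U f g].
  move=> ni Fw nFw; have [U [M [L [G [f [g [[US nU] [_ spL] H _]]]]]]] := cS i w Fw nFw.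
  have L0 := stratified_pm_neg spL; rewrite L0 in H; first by exists M, U, f, g.
  by rewrite ni; lia.
have n1 : n = 1.
  have [i ni] : exists i : nat, n = i%:Z by exists `|n|%N; lia.
  have /closureP/(_ 1 ltr01)[w [Sw nFw] _] := dS _ SN.
  have [||M [U [f [g [US _ H]]]]] := chart i w ni; rewrite -?ni ?Fn //.
  have [s Zs] := compact_discrete_finite cZ dZ.
  have [T [B [c Bc]]] := susp_finite_lines Zs.
  have hU : pl_homeo (prod_space [set: 'rV[R]_i] (cone (set0 : set 'rV[R]_M))) U by exists f, g.
  have := has_cell_dim_le (@has_cell_prod i M set0) hU (fun y Uy => Bc y (US y Uy)).
  by lia.
have [||M [U [f [g [US nU H]]]]] := chart 1%N N0 n1.
- by rewrite -(n1 : n = 1%:Z) Fn.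
- by rewrite -(n1 : n = 1%:Z) cF F0 // n1.
exact: two_arms US nU H.
Qed.

End ZeroDim.

(** * The two kinds of classes of singularities *)

Section Classes.
Variable R : realType.
Implicit Types N M : nat.

Lemma pl_homeo_iter_susp i N M (X : set 'rV[R]_N) (Y : set 'rV[R]_M) :
  compact X -> compact Y -> pl_homeo X Y -> pl_homeo (iter_susp i X) (iter_susp i Y).
Proof.
move=> cX cY XY; elim: i => //= i.
by apply: pl_homeo_susp; apply: (proj1 (iter_susp_polyhedron i _ _)) => //;
  have [] := pl_homeo_polyhedron XY.
Qed.

Lemma iter_suspS_homeo i N (X : set 'rV[R]_N) : compact X -> polyhedron X ->
  pl_homeo (iter_susp i (susp X)) (iter_susp i.+1 X).
Proof.
move=> cX pX; apply: lin_equiv_pl (lin_equiv_iter_suspS i X).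
  by apply: (proj2 (iter_susp_polyhedron i _ _)); [exact: compact_susp|exact: polyhedron_susp].
exact: (proj2 (iter_susp_polyhedron i.+1 cX pX)).
Qed.

(** The circle is the twofold suspension of the empty set. *)
Lemma sphere_homeo j M :
  pl_homeo (iter_susp j (@circle R)) (iter_susp j.+2 (set0 : set 'rV[R]_M)).
Proof.
rewrite -circleE; have p0 := @polyhedron0 R 0; have c0 := @compact0 'rV[R]_0.
apply: pl_homeo_trans (iter_susp_set0_homeo R j.+2 0 M).
apply: pl_homeo_trans (iter_suspS_homeo j.+1 c0 p0).
by apply: iter_suspS_homeo; [exact: compact_susp|exact: polyhedron_susp].
Qed.

Lemma iter_susp_neq0 i N (X : set 'rV[R]_N) : X !=set0 -> iter_susp i X !=set0.
Proof. by case: i => // i _; exists (row_mx 1%:M 0); left. Qed.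

Lemma set0_or_nonempty N (X : set 'rV[R]_N) : X = set0 \/ X !=set0.
Proof.
have [->|/set0P] := eqVneq X set0; [by left|by right].
Qed.

Lemma pl_homeo_set0 N M (X : set 'rV[R]_N) :
  pl_homeo X (set0 : set 'rV[R]_M) -> X = set0.
Proof. by move=> [f [g [_ _ fK _]]]; rewrite -subset0 => x /fK[]. Qed.

Lemma Psi_polyhedron N (X : set 'rV[R]_N) : Psi X -> polyhedron X.
Proof. by move=> [_ [B [n [F [[[pX]]]]]]]. Qed.

Lemma compact_classical_pmP n N (X : set 'rV[R]_N) :
  0 <= n -> compact X -> classical_pm n X -> compact_classical_pm X.
Proof. by move=> n0 cX /(classical_pm_bd0 n0) h; split=> //; exists n. Qed.

Lemma compact_classical_pm_Psi N (X : set 'rV[R]_N) : compact_classical_pm X -> Psi X.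
Proof. by move=> [cX bX]; split=> //; exists set0. Qed.

Lemma compact_classical_pm_set0 N : compact_classical_pm (set0 : set 'rV[R]_N).
Proof.
exact: compact_classical_pmP (lexx 0) (@compact0 _) (classical_pm_set0 R N).
Qed.

Lemma classical_pm_discrete N (X : set 'rV[R]_N) : discrete_set X -> classical_pm 0 X.
Proof.
move=> dX; exists (manifold_skeleton 0 X); split=> //; apply: spm_discrete => //.
rewrite /manifold_skeleton; split.
- exact: polyhedron_discrete.
- by split=> // i ->.
- move=> i j ij; case: ltP => i0; first by move=> x [].
  by have -> : j < 0 = false by apply/negP/negP; rewrite -leNgt; lia.
- move=> i; case: ltP => i0; first by rewrite closure0 setI0; split=> // x [].
  have pX := polyhedron_discrete dX.
  by split=> //; move=> x [].
Qed.

Lemma classical_pm_susp_set0 N : classical_pm 0 (susp (set0 : set 'rV[R]_N)).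
Proof. by rewrite susp_set0E; apply: classical_pm_discrete; exact: discrete_pair. Qed.

Lemma has_dim0_discrete N (X : set 'rV[R]_N) : has_dim X 0 -> discrete_set X.
Proof.
move=> [B [F [[_ _ spX spB _] _]]].
have B0 : B = set0 by apply: stratified_pm_neg spB _; rewrite sub0r.
by move: spX; rewrite B0 setD0 => /stratified_pm_inv[[]|[_ _]|[]].
Qed.

Lemma pl_class_ext (C D : pl_class R) : (forall N X, C N X <-> D N X) -> C = D.
Proof.
move=> CD; apply: functional_extensionality_dep => N.
by apply/seteqP; split=> X /CD.
Qed.

Lemma G_compact_pm (G : pl_class R) (HG : pm_singularities G)
    N (X : set 'rV[R]_N) :
  G N X -> compact_classical_pm X.
Proof.
by move=> GX; have [cX _] := pms_Psi HG GX; have bX := pms_boundary HG GX.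
Qed.

Lemma G_iter_susp (G : pl_class R) (HG : pm_singularities G)
    i N (X : set 'rV[R]_N) :
  G N X -> G (i + N)%N (iter_susp i X).
Proof.
move=> GX; elim: i => //= i IH.
exact: (proj1 (pms_susp HG (pms_Psi HG IH)) IH).
Qed.

(** Y is desuspended as often as possible. This terminates: an i.+1-fold
    suspension contains a cell of dimension i, while Y lies in R^N. *)
Lemma G_desuspend (G : pl_class R) (HG : pm_singularities G) N (Y : set 'rV[R]_N) : G N Y ->
  exists i M (Z : set 'rV[R]_M), [/\ G M Z, ~ is_suspension Z & pl_homeo Y (iter_susp i Z)].
Proof.
move=> GY; pose P i := exists M (Z : set 'rV[R]_M), G M Z /\ pl_homeo Y (iter_susp i Z).
have exP : exists i, `[< P i >].
  exists 0%N; apply/asboolP; exists N, Y; split=> //=.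
  by apply: pl_homeo_refl; apply: Psi_polyhedron; exact: (pms_Psi HG GY).
have ubP i : `[< P i >] -> (i <= N.+1)%N.
  move=> /asboolP[M [Z [_ H]]]; case: i H => // i H.
  apply: (@has_cell_dim_le R i _ _ N _ Y unit (fun=> 1%:M) (fun=> 0)
    (has_cell_iter_susp i Z) (pl_homeo_sym H)).
  by move=> y _; exists tt, y; rewrite mulmx1 addr0.
case: (ex_maxnP exP ubP) => i /asboolP[M [Z [GZ YZ]]] max.
exists i, M, Z; split=> // -[K [W [cW ZW]]].
have [cW' _] := cW; have PW := compact_classical_pm_Psi cW.
have GSW : G _ (susp W) := pms_homeo HG ZW GZ.
have GW : G _ W := proj2 (pms_susp HG PW) GSW.
have [cZ _] := G_compact_pm HG GZ.
suff : `[< P i.+1 >] by move=> /max; rewrite ltnn.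
apply/asboolP; exists K, W; split=> //.
apply: pl_homeo_trans YZ _.
apply: pl_homeo_trans (iter_suspS_homeo i cW' (Psi_polyhedron PW)).
by apply: pl_homeo_iter_susp => //; exact: compact_susp.
Qed.

(** The suspension of Z belongs to G, so it is a classical pseudomanifold without
    boundary; this forces Z to have exactly two points. *)
Lemma G_dim0_is_suspension (G : pl_class R) (HG : pm_singularities G) N (Z : set 'rV[R]_N) :
  G N Z -> Z !=set0 -> has_dim Z 0 -> is_suspension Z.
Proof.
move=> GZ Z0 /has_dim0_discrete dZ; have [cZ _] := G_compact_pm HG GZ.
have [n /classical_dim_bd0 spS] := pms_boundary HG (G_iter_susp HG 1 GZ).
have [z1 [z2 [z12 ZE]]] := susp_discrete_pair cZ dZ Z0 spS.
exists 0%N, set0; split; first exact: compact_classical_pm_set0.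
by rewrite ZE susp_set0E; apply: pl_homeo_pair => //; exact: poles_neq.
Qed.

Lemma G_of_E_of (G : pl_class R) (HG : pm_singularities G) : G_of (E_of G) = G.
Proof.
apply: pl_class_ext => N Y; split.
  move=> [_ [i [M [Z [_ _ YZ [GZ _]]]]]].
  exact: (pms_homeo HG (pl_homeo_sym YZ) (G_iter_susp HG i GZ)).
move=> GY; split; first exact: (G_compact_pm HG GY).
have [i [M [Z [GZ nZ YZ]]]] := G_desuspend HG GY.
exists i, M, Z; split=> //; first exact: (G_compact_pm HG GZ).
by split=> // -[Z0 dZ]; apply: nZ; exact: (G_dim0_is_suspension HG GZ Z0 dZ).
Qed.

(** Only the suspensions of the empty space are not covered by stability under
    suspension: the first one has dimension 0 and is excluded from E_of, the next
    ones are iterated suspensions of the circle. *)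
Lemma E_of_G_of_sub (E : pl_class R) :
  stratified_pm_singularities E -> pl_class_sub (E_of (G_of E)) E.
Proof.
move=> HE N X [[_ [i [M [Z [_ _ XZ EZ]]]]] nX].
have E_iter j K (W : set 'rV[R]_K) : W !=set0 -> E K W -> E (j + K)%N (iter_susp j W).
  move=> W0 EW; elim: j => //= j IH; exact: (spms_susp HE (iter_susp_neq0 j W0) IH).
have [Z0|Z0] := set0_or_nonempty Z; last first.
  exact: (spms_homeo HE (pl_homeo_sym XZ) (E_iter i _ _ Z0 EZ)).
subst Z; case: i XZ => [|[|j]] XZ.
- exact: (spms_homeo HE (pl_homeo_sym XZ) EZ).
- exfalso; apply: nX; have ZX := pl_homeo_sym XZ; split.
    case: ZX => f [g [_ _ fK _]]; exists (f (row_mx 1%:M 0)).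
    by have [] := fK _ (or_introl erefl).
  exists set0; apply: classical_pm_bd0 => //.
  exact: classical_pm_homeo ZX (classical_pm_susp_set0 M).
have circ0 : @circle R !=set0.
  by rewrite -circleE; exists (row_mx 1%:M 0); left.
have SX := pl_homeo_trans (sphere_homeo j M) (pl_homeo_sym XZ).
exact: (spms_homeo HE SX (E_iter j _ _ circ0 (spms_circle HE))).
Qed.

(** The empty space is the only member which is not a suspension, so that G_of
    reduces this class to the spheres. *)
Definition suspensions : pl_class R := fun N X =>
  compact X /\ (X = set0 \/ exists n, [/\ 0 < n, classical_pm n X & is_suspension X]).

Definition suspended_spheres : pl_class R := fun N X =>
  suspensions X /\ exists i M, pl_homeo X (iter_susp i (set0 : set 'rV[R]_M)).

Lemma is_suspension_susp N (X : set 'rV[R]_N) :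
  compact_classical_pm X -> is_suspension (susp X).
Proof.
move=> cX; exists N, X; split=> //; apply: pl_homeo_refl.
by apply: polyhedron_susp; [case: cX|exact/Psi_polyhedron/compact_classical_pm_Psi].
Qed.

Lemma suspensions_pm N (X : set 'rV[R]_N) : suspensions X -> compact_classical_pm X.
Proof.
move=> [cX [->|[n [n0 spX _]]]]; first exact: compact_classical_pm_set0.
exact: compact_classical_pmP (ltW n0) cX spX.
Qed.

Lemma suspensions_susp N (X : set 'rV[R]_N) n : X !=set0 -> compact X -> 0 < n ->
  classical_pm n X -> suspensions (susp X).
Proof.
move=> X0 cX n0 spX; split; first exact: compact_susp.
right; exists (n + 1); split; first by lia.
- exact: classical_pm_susp.
- by apply: is_suspension_susp; exact: compact_classical_pmP (ltW n0) cX spX.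
Qed.

Lemma suspensions_circle : suspensions (@circle R).
Proof.
rewrite -circles_false; split; first exact: compact_circles.
right; exists 1; split=> //; first exact: classical_pm_circles.
rewrite circles_false -circleE; apply: is_suspension_susp.
apply: compact_classical_pmP (lexx 0) _ (classical_pm_susp_set0 0).
by apply: compact_susp; exact: compact0.
Qed.

Lemma suspensions_singularities : stratified_pm_singularities suspensions.
Proof.
split.
- by move=> N X /suspensions_pm/compact_classical_pm_Psi.
- move=> N X [cX [->|[n [n0 spX _]]]] X0; first by case: X0.
  by exists n; split=> //; exists set0; apply: classical_pm_bd0 => //; exact: ltW.
- by split; [exact: compact0|left].
- exact: suspensions_circle.
- move=> N M X Y XY [cX HX]; split; first exact: pl_homeo_compact cX XY.
  case: HX => [X0|[n [n0 spX [K [W [cW XW]]]]]].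
    by left; rewrite X0 in XY; exact: pl_homeo_set0 (pl_homeo_sym XY).
  right; exists n; split=> //; first exact: classical_pm_homeo XY spX.
  by exists K, W; split=> //; exact: pl_homeo_trans (pl_homeo_sym XY) XW.
- by move=> N X /suspensions_pm[].
- move=> N X X0 [cX [Xe|[n [n0 spX _]]]]; first by rewrite Xe in X0; case: X0.
  exact: suspensions_susp X0 cX n0 spX.
Qed.

Lemma suspended_spheres_singularities : stratified_pm_singularities suspended_spheres.
Proof.
have HE := suspensions_singularities; split.
- by move=> N X [/(spms_Psi HE)].
- by move=> N X [/(spms_dim HE)].
- split; first exact: (spms_empty HE).
  by exists 0%N, 0%N; apply: pl_homeo_refl.
- split; first exact: (spms_circle HE).
  by exists 2%N, 0%N; exact: (sphere_homeo 0).
- move=> N M X Y XY [EX [i [K XS]]]; split; first exact: (spms_homeo HE XY EX).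
  by exists i, K; exact: pl_homeo_trans (pl_homeo_sym XY) XS.
- by move=> N X [/(spms_boundary HE)].
- move=> N X X0 [EX [i [K XS]]]; split; first exact: (spms_susp HE X0 EX).
  exists i.+1, K; apply: pl_homeo_susp => //; first by case: EX.
  exact: (proj1 (iter_susp_polyhedron i (@compact0 _) (@polyhedron0 R K))).
Qed.

Lemma suspensions_desuspended N (Z : set 'rV[R]_N) :
  suspensions Z -> ~ is_suspension Z -> Z = set0.
Proof. by move=> [_ [//|[n [_ _ sZ]]]] /(_ sZ). Qed.

Lemma suspensions_two_spheres : suspensions (susp (@circles R true)).
Proof.
apply: (@suspensions_susp _ _ 1) => //; [|exact: compact_circles|exact: classical_pm_circles].
have [a [e [A [b [e0 _ H]]]]] := has_cell_circles R true.
by exists (a *m A + b); apply: H; rewrite subrr normr0.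
Qed.

Lemma suspensions_not_sub : ~ pl_class_sub suspensions (E_of (G_of suspensions)).
Proof.
move=> /(_ _ _ suspensions_two_spheres)[[_ [i [M [Z [_ nZ XZ EZ]]]]] _].
have Z0 := suspensions_desuspended EZ nZ; rewrite Z0 in XZ.
exact: susp_circles_not_sphere XZ.
Qed.

Lemma suspensions_neq : suspensions <> suspended_spheres.
Proof.
move=> h; have := suspensions_two_spheres; rewrite h => -[_ [i [M]]].
exact: susp_circles_not_sphere.
Qed.

Lemma G_of_suspensions : G_of suspensions = G_of suspended_spheres.
Proof.
apply: pl_class_ext => N Y; split; last first.
  by move=> [cY [i [M [Z [cZ nZ YZ [EZ _]]]]]]; split=> //; exists i, M, Z.
move=> [cY [i [M [Z [cZ nZ YZ EZ]]]]]; split=> //; exists i, M, Z; split=> //.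
split=> //; rewrite (suspensions_desuspended EZ nZ).
by exists 0%N, M; apply: pl_homeo_refl.
Qed.

End Classes.

Theorem lemma6p6 (R : realType) :
  [/\ forall G : pl_class R, pm_singularities G -> G_of (E_of G) = G,
      forall E : pl_class R, stratified_pm_singularities E ->
        pl_class_sub (E_of (G_of E)) E,
      exists E : pl_class R, stratified_pm_singularities E /\
        ~ pl_class_sub E (E_of (G_of E))
    & exists E E' : pl_class R,
        [/\ stratified_pm_singularities E, stratified_pm_singularities E',
            E <> E' & G_of E = G_of E']].
Proof.
split.
- exact: G_of_E_of.
- exact: E_of_G_of_sub.
- exists (@suspensions R); split; first exact: suspensions_singularities.
  exact: suspensions_not_sub.
- exists (@suspensions R), (@suspended_spheres R); split.
  + exact: suspensions_singularities.
  + exact: suspended_spheres_singularities.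
  + exact: suspensions_neq.
  + exact: G_of_suspensions.
Qed.
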